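(* Let $M\subset\mathbf{R}^3$ be an embedded, orientable $C^3$ surface with negative Gauss curvature and Gauss map $n\colon M\to\mathbf{S}^2$, let $\Gamma\subset M$ be a closed asymptotic curve, and let $u\in\mathbf{S}^2$ be a random direction, i.e. a direction such that the projection $\Gamma_u$ of $\Gamma$ into a plane orthogonal to $u$ is in general position. Then $$ \mathrm{Lk}(\Gamma,n)=\mathrm{Cr}(\Gamma_u)+\frac{1}{2}\,\#\big\{\langle u,n\rangle=0\big\}\,\mathrm{sign}(\tau_g), $$ where $\mathrm{Lk}(\Gamma,n)$ is the linking number of $\Gamma$ with the normal field $n$, $\mathrm{Cr}(\Gamma_u)$ is the sum of the signed crossings of $\Gamma_u$, $\#\{\langle u,n\rangle=0\}$ is the number of zeros of $t\mapsto\langle u,n(\Gamma(t))\rangle$ along $\Gamma$ (counted once over a period), and $\tau_g$ is the geodesic torsion of $\Gamma$.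
   Context: Closed asymptotic curve: with $\mathrm{I\!I}(X,Y)=\langle dn(X),Y\rangle$ the second fundamental form of $M$, a closed asymptotic curve is a closed integral curve of the directions where $\mathrm{I\!I}$ vanishes, i.e. a closed curve $\Gamma\colon\mathbf{R}/L\mathbf{Z}\to M$, parametrized by arclength and traversed once, with $\mathrm{I\!I}(T,T)=0$ for $T=\Gamma'$. Such a $\Gamma$ is $C^2$ and simple (it has no self-intersections). Write $n(t)$ for $n(\Gamma(t))$. Darboux frame and geodesic torsion: $n^\perp=n\times T$ (the frame $(T,n^\perp,n)$ is $C^1$), and $\tau_g=\langle (n^\perp)',n\rangle$. Since the curvature of $M$ is negative, $\tau_g$ never vanishes, so it has a constant sign $\mathrm{sign}(\tau_g)\in\{1,-1\}$. Projection and crossings: for $u\in\mathbf{S}^2$, $\Gamma_u$ is the orthogonal projection of $\Gamma$ into a plane $\Pi$ orthogonal to $u$. Almost every $u$ is a random direction, meaning $\Gamma_u$ is in general position: $\Gamma_u$ is an immersion ($u$ is not parallel to any tangent line of $\Gamma$), there are only finitely many points $p_i\in\Pi$ (crossings) with more than one preimage under $\Gamma_u$, and each is a transversal double point: $\Gamma_u^{-1}(p_i)=\{t_i^+,t_i^-\}$ with $\Gamma_u'(t_i^+)\times\Gamma_u'(t_i^-)\neq0$. Label so that $\langle\Gamma(t_i^+),u\rangle>\langle\Gamma(t_i^-),u\rangle$. Then $\mathrm{sign}(p_i)\in\{1,-1\}$ is the sign of $\langle\Gamma_u'(t_i^+)\times\Gamma_u'(t_i^-),u\rangle$, and $\mathrm{Cr}(\Gamma_u)=\sum_i\mathrm{sign}(p_i)$.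 Linking number: for a unit normal vector field $v$ along $\Gamma$, $\mathrm{Lk}(\Gamma,v)$ is the linking number of the disjoint closed curves $\Gamma$ and $\Gamma+\epsilon v$ for sufficiently small $\epsilon>0$. It is computed as half the sum of the signed crossings between the projections of the two curves along a generic direction $w$, where a crossing has the sign of $\langle a\times b,w\rangle$, with $a$ and $b$ the projected velocity vectors of the upper and lower strands respectively (upper meaning larger inner product with $w$). *)

(* Defs.v *)
From HB Require Import structures.
From mathcomp Require Import all_boot all_order all_algebra.
From mathcomp Require Import finmap.
From mathcomp Require Import all_classical all_reals all_analysis.
Import Order.TTheory GRing.Theory Num.Theory.
Import numFieldNormedType.Exports.

Set Implicit Arguments.
Unset Strict Implicit.
Unset Printing Implicit Defensive.

Local Open Scope classical_set_scope.
Local Open Scope ring_scope.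

(* The library norm on 'rV[R]_3 is the max norm, which gives the usual
   topology and derivatives; lengths and angles are taken from [dot]. *)
Definition dot (R : realType) (x y : 'rV[R]_3) : R := \sum_(i < 3) x 0 i * y 0 i.

(* Indices are added modulo 3. *)
Definition cross (R : realType) (x y : 'rV[R]_3) : 'rV[R]_3 :=
  \row_(i < 3) (x 0 (i + 1) * y 0 (i + 2) - x 0 (i + 2) * y 0 (i + 1)).

Fixpoint Ck (R : realType) (V W : normedModType R) (k : nat) (D : set V)
    (f : V -> W) : Prop :=
  if k is k'.+1 then
    (forall x, D x -> differentiable f x) /\ (forall v, Ck k' D ('D_v f))
  else forall x, D x -> {for x, continuous f}.

(* Regular C^3 parametrization of an open piece of M; the last two clauses say
   that phi is a homeomorphism from D onto a relatively open subset of M. *)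
Definition chart (R : realType) (M : set 'rV[R]_3) (D : set 'rV[R]_2)
    (phi : 'rV[R]_2 -> 'rV[R]_3) : Prop :=
  [/\ open D,
      Ck 3 D phi,
      forall q, D q -> injective ('d phi q),
      exists2 U, open U & phi @` D = M `&` U
    & exists2 psi : 'rV[R]_3 -> 'rV[R]_2,
        {within phi @` D, continuous psi} & forall q, D q -> psi (phi q) = q].

Definition embedded_C3_surface (R : realType) (M : set 'rV[R]_3) : Prop :=
  forall p, M p -> exists D phi, chart M D phi /\ (phi @` D) p.

Definition curve_at (R : realType) (M : set 'rV[R]_3) (p X : 'rV[R]_3)
    (c : R -> 'rV[R]_3) : Prop :=
  [/\ \forall t \near (0 : R), M (c t), c 0 = p & is_derive (0 : R) 1 c X].

Definition tangent (R : realType) (M : set 'rV[R]_3) (p : 'rV[R]_3)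
  : set 'rV[R]_3 := [set X | exists c, curve_at M p X c].

Definition gauss_map (R : realType) (M : set 'rV[R]_3)
    (n : 'rV[R]_3 -> 'rV[R]_3) : Prop :=
  [/\ {within M, continuous n},
      forall p, M p -> dot (n p) (n p) = 1
    & forall p X, M p -> tangent M p X -> dot (n p) X = 0].

(* dn_p(X) is the velocity of n \o c, for any curve c in M through p with
   velocity X; the value is the junk 0 when X is not tangent to M at p. *)
Definition dgauss (R : realType) (M : set 'rV[R]_3) (n : 'rV[R]_3 -> 'rV[R]_3)
    (p X : 'rV[R]_3) : 'rV[R]_3 :=
  xget 0 [set W | exists2 c, curve_at M p X c & is_derive (0 : R) 1 (n \o c) W].

Definition second_form (R : realType) (M : set 'rV[R]_3)
    (n : 'rV[R]_3 -> 'rV[R]_3) (p X Y : 'rV[R]_3) : R :=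
  dot (dgauss M n p X) Y.

(* det(dn_p), computed in a basis (X, Y) of the tangent plane at p; the value
   does not depend on the basis. *)
Definition gauss_curvature (R : realType) (M : set 'rV[R]_3)
    (n : 'rV[R]_3 -> 'rV[R]_3) (p X Y : 'rV[R]_3) : R :=
  (second_form M n p X X * second_form M n p Y Y
     - second_form M n p X Y * second_form M n p Y X)
  / (dot X X * dot Y Y - dot X Y ^+ 2).

Definition negatively_curved (R : realType) (M : set 'rV[R]_3)
    (n : 'rV[R]_3 -> 'rV[R]_3) : Prop :=
  forall p X Y, M p -> tangent M p X -> tangent M p Y -> cross X Y != 0 ->
    gauss_curvature M n p X Y < 0.

(* A curve on R/LZ is an L-periodic function on R; the last clause (L is the
   least period) says that it is traversed once. *)
Definition closed_asymptotic_curve (R : realType) (M : set 'rV[R]_3)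
    (n : 'rV[R]_3 -> 'rV[R]_3) (L : R) (G : R -> 'rV[R]_3) : Prop :=
  [/\ 0 < L /\ (forall t, G (t + L) = G t),
      (forall t, derivable G t 1) /\ continuous (derive1 G),
      forall t, dot (derive1 G t) (derive1 G t) = 1,
      forall t, M (G t) /\ second_form M n (G t) (derive1 G t) (derive1 G t) = 0
    & forall s, 0 < s < L -> exists t, G (t + s) != G t].

Definition nperp (R : realType) (n : 'rV[R]_3 -> 'rV[R]_3) (G : R -> 'rV[R]_3)
    (t : R) : 'rV[R]_3 := cross (n (G t)) (derive1 G t).

Definition geodesic_torsion (R : realType) (n : 'rV[R]_3 -> 'rV[R]_3)
    (G : R -> 'rV[R]_3) (t : R) : R := dot (derive1 (nperp n G) t) (n (G t)).

(* Orthogonal projection along the unit vector u. *)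
Definition proj (R : realType) (u x : 'rV[R]_3) : 'rV[R]_3 := x - dot x u *: u.

(* The half-open interval [0, L[ represents R/LZ. *)
Definition period (R : realType) (L : R) : set R := [set t | 0 <= t < L].

Definition crossing_points (R : realType) (L : R) (g : R -> 'rV[R]_3)
  : set 'rV[R]_3 :=
  [set p | exists s t, [/\ period L s, period L t, s != t, g s = p & g t = p]].

Definition general_position (R : realType) (L : R) (G : R -> 'rV[R]_3)
    (u : 'rV[R]_3) : Prop :=
  let Gu := proj u \o G in
  [/\ dot u u = 1,
      forall t, derive1 Gu t != 0,
      finite_set (crossing_points L Gu)
    & forall p, crossing_points L Gu p -> exists s t,
        period L `&` Gu @^-1` [set p] = [set s; t] /\
        cross (derive1 Gu s) (derive1 Gu t) != 0].

(* Pairs (s, t) such that g at s passes over d at t, seen along w. *)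
Definition overcrossings (R : realType) (L : R) (w : 'rV[R]_3)
    (g d : R -> 'rV[R]_3) : set (R * R) :=
  [set st | [/\ period L st.1, period L st.2,
                proj w (g st.1) = proj w (d st.2)
              & dot (d st.2) w < dot (g st.1) w]].

Definition crossing_sign (R : realType) (w : 'rV[R]_3) (g d : R -> 'rV[R]_3)
    (st : R * R) : R :=
  Num.sg (dot (cross (derive1 (proj w \o g) st.1) (derive1 (proj w \o d) st.2)) w).

Definition signed_overcrossings (R : realType) (L : R) (w : 'rV[R]_3)
    (g d : R -> 'rV[R]_3) : R :=
  \sum_(st \in overcrossings L w g d) crossing_sign w g d st.

(* Each crossing p_i is indexed by its pair (t_i^+, t_i^-), which lists it
   exactly once when u is in general position. *)
Definition Cr (R : realType) (L : R) (G : R -> 'rV[R]_3) (u : 'rV[R]_3) : R :=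
  signed_overcrossings L u G G.

Definition generic_direction (R : realType) (L : R) (g d : R -> 'rV[R]_3)
    (w : 'rV[R]_3) : Prop :=
  let X := [set st : R * R | [/\ period L st.1, period L st.2
                              & proj w (g st.1) = proj w (d st.2)]] in
  [/\ dot w w = 1,
      finite_set X
    & forall st, X st ->
        cross (derive1 (proj w \o g) st.1) (derive1 (proj w \o d) st.2) != 0].

(* k is the linking number of the disjoint L-periodic curves g and d: generic
   directions exist, and all of them give the value k. *)
Definition is_linking_number (R : realType) (L : R) (g d : R -> 'rV[R]_3)
    (k : R) : Prop :=
  [/\ forall s t, g s != d t,
      exists w, generic_direction L g d w
    & forall w, generic_direction L g d w ->
        2^-1 * (signed_overcrossings L w g d + signed_overcrossings L w d g)
        = k].

(* Lk(G, v) = k, for a normal field v along G. *)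
Definition Lk_is (R : realType) (L : R) (G v : R -> 'rV[R]_3) (k : R) : Prop :=
  exists2 e0 : R, 0 < e0 & forall e, 0 < e < e0 ->
    is_linking_number L G (fun t => G t + e *: v t) k.

Definition tangency_set (R : realType) (L : R) (n : 'rV[R]_3 -> 'rV[R]_3)
    (G : R -> 'rV[R]_3) (u : 'rV[R]_3) : set R :=
  [set t | period L t /\ dot u (n (G t)) = 0].

(* Main.v *)
(* For disjoint closed curves g and d, the integral of the solid angle form
   det (r, g', d') / |r|^3, where r(s, t) = g(s) - d(t), is 2 pi times the number of signed
   crossings seen along a generic direction w, each crossing being counted with both orders of the
   strands. Indeed the form has, away from the zeros of the projection of r along w, the primitive
   z / |r| * dtheta, and subtracting +- dtheta moves the singularity to the other side: each zero
   contributes its index. The integral is thus an integral multiple of 2 pi, and it does not change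
   when the push-off G + e n is rotated, about the curve, into the push-off G + e n^perp
   contained in the tangent planes of M.
   The latter is evaluated along u itself: a crossing of G_u gives two crossings of the same sign,
   and the other zeros occur where G_u and its push-off cross near the diagonal, that is where
   u is tangent to M. There the index is read off on the boundary of a small square: the component
   of r across u in the tangent plane has the sign of +-(s - t), and the normal component is
   -e tau_g (t - a), so the contribution is sign(tau_g).
   The curve is regular enough for this because its tangent solves in a chart the quadratic
   equations II(T, T) = 0 and <T, T> = 1, which are nondegenerate when K < 0. *)

Require Import Defs.
From HB Require Import structures.
From mathcomp Require Import all_boot all_order all_algebra.
From mathcomp Require Import finmap.
From mathcomp Require Import all_classical all_reals all_analysis.
From mathcomp Require Import ring lra.
Import Order.TTheory GRing.Theory Num.Theory.
Import numFieldNormedType.Exports.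

Set Implicit Arguments.
Unset Strict Implicit.
Unset Printing Implicit Defensive.

Local Open Scope classical_set_scope.
Local Open Scope ring_scope.

(** * Integrals and derivatives *)

(** The definition of the linking number asks for one value along all generic directions, whereas
    [u] is in general position for the curve alone: for the curve together with a push-off it need
    not be generic, because the number and the transversality of the zeros near a tangency are not
    controlled. Comparing both with an integral that does not depend on a frame settles the two
    questions, and a small square contributes through the winding number of the projected difference
    along its border. This fixes the order of choices: the squares first, then the size [e] of the
    push-off, small compared with them. Integrality at every stage of the rotation requires a
    generic direction for each intermediate push-off, known only to be C^1; hence a Sard theorem in
    class C^1. The definition of a closed asymptotic curve does not say that it is simple. At a
    point of the surface the two asymptotic directions have torsions of opposite signs, so two
    branches meeting in space are tangent there, which the transversality of double points
    excludes. *)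

Definition clamp (R : realType) (a b x : R) : R := Num.max a (Num.min x b).

Lemma clamp_bound (R : realType) (a b x : R) : a <= b -> a <= clamp a b x <= b.
Proof.
by move=> ab; rewrite /clamp le_max lexx/= ge_max ab ge_min lexx orbT.
Qed.

Lemma clamp_id (R : realType) (a b x : R) : a <= x <= b -> clamp a b x = x.
Proof. by move=> /andP[ax xb]; rewrite /clamp (min_idPl xb) (max_idPr ax). Qed.

Lemma clamp_lipschitz (R : realType) (a b x y : R) :
  `|clamp a b x - clamp a b y| <= `|x - y|.
Proof.
rewrite ler_norml; case: (lerP 0 (x - y)) => xy;
  rewrite ?(ger0_norm xy) ?(ltr0_norm xy) /clamp;
  case: (leP a (Num.min x b)); case: (leP a (Num.min y b));
  case: (leP x b) => ?; case: (leP y b) => ? ? ?; lra.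
Qed.

Lemma clamp_continuous (R : realType) (a b : R) : continuous (clamp a b).
Proof.
move=> x; apply/cvgrPdist_le => /= e e0; near=> y.
apply: le_trans (clamp_lipschitz _ _ _ _) _.
by near: y; apply/nbhs_ballP; exists e => // z /ltW.
Unshelve. all: by end_near. Qed.

Definition continuous_on_segment (R : realType) (a b : R) (f : R -> R) :=
  forall x, a <= x <= b -> {for x, continuous f}.

Definition integ (R : realType) (a b : R) (f : R -> R) : R :=
  (\int[@lebesgue_measure R]_(x in `[a, b]) f x)%R.

Section integral.
Context {R : realType}.
Implicit Types (f g F : R -> R) (a b c d x y k l e M L : R).

Lemma derive_continuous f x l : is_derive x 1 f l -> {for x, continuous f}.
Proof.
move=> h; apply: differentiable_continuous; apply/derivable1_diffP.
exact: ex_derive.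
Qed.

Lemma within_segment a b f : continuous_on_segment a b f ->
  {within `[a, b], continuous f}.
Proof.
move=> h; apply/continuous_in_subspaceT => x; rewrite inE/= in_itv/= => xab.
exact: h.
Qed.

Lemma deriveC k x : is_derive x 1 (fun=> k) (0 : R).
Proof. exact: (is_derive_cst k). Qed.

Lemma deriveA f g x df dg : is_derive x 1 f df -> is_derive x 1 g dg ->
  is_derive x 1 (fun y => f y + g y) (df + dg).
Proof. exact: is_deriveD. Qed.

Lemma deriveS f g x df dg : is_derive x 1 f df -> is_derive x 1 g dg ->
  is_derive x 1 (fun y => f y - g y) (df - dg).
Proof. exact: is_deriveB. Qed.

Lemma deriveP f g x df dg : is_derive x 1 f df -> is_derive x 1 g dg ->
  is_derive x 1 (fun y => f y * g y) (df * g x + f x * dg).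
Proof.
move=> hf hg; apply: is_derive_eq (is_deriveM hf hg) _.
by rewrite addrC [df * _]mulrC.
Qed.

Lemma deriveK k f x df : is_derive x 1 f df -> is_derive x 1 (fun y => k * f y) (k * df).
Proof. exact: is_deriveZ. Qed.

Lemma deriveI f x df : f x != 0 -> is_derive x 1 f df ->
  is_derive x 1 (fun y => (f y)^-1) (- df / f x ^+ 2).
Proof.
move=> f0 hf; apply: is_derive_eq (is_deriveV f0 hf) _.
by rewrite -[_ *: _]/(_ * _) !mulNr mulrC.
Qed.

Lemma deriveR f x df : 0 < f x -> is_derive x 1 f df ->
  is_derive x 1 (fun y => Num.sqrt (f y)) (df / (2 * Num.sqrt (f x))).
Proof.
move=> f0 hf.
apply: is_derive_eq (is_derive1_comp (is_derive1_sqrt f0) hf) _.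
by rewrite mulrC.
Qed.

(** The integral over [[A, x]] is taken over a set and is 0 for [x < A], so the derivative is
    claimed only to the right of [A]; users start far enough to the left. *)
Lemma primitive f A : continuous f ->
  exists F, forall x, A < x -> is_derive x 1 F (f x).
Proof.
move=> cf; exists (fun x => \int[@lebesgue_measure R]_(t in `[A, x]) f t)%R => x Ax.
have iA : (@lebesgue_measure R).-integrable `[A, x + 1] (EFin \o f).
  apply: continuous_compact_integrable; first exact: segment_compact.
  by apply: within_segment => y _; exact: cf.
have [d1 d2] := @continuous_FTC1_closed R f A x (x + 1) (ltr_pwDr ltr01 (lexx x)) iA Ax (cf x).
by apply: DeriveDef; [exact: d1|rewrite -derive1E; exact: d2].
Qed.

Lemma int_primitive f F a b : a <= b -> continuous_on_segment a b f ->
  (forall x, a <= x <= b -> is_derive x 1 F (f x)) -> integ a b f = F b - F a.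
Proof.
rewrite le_eqVlt => /predU1P[<- _ _|ab cf dF].
  by rewrite /integ set_itv1 Rintegral_set1 subrr.
have cF x : a <= x <= b -> {for x, continuous F}.
  by move=> /dF; exact: derive_continuous.
rewrite /integ /Rintegral (continuous_FTC2 (F := F) ab (within_segment cf))//.
- split.
  + by move=> x; rewrite in_itv/= => /andP[/ltW ax /ltW xb]; apply: ex_derive; apply: dF; rewrite ax.
  + by apply: cvg_at_right_filter; apply: cF; rewrite lexx ltW.
  + by apply: cvg_at_left_filter; apply: cF; rewrite lexx ltW.
- move=> x; rewrite in_itv/= => /andP[/ltW ax /ltW xb].
  by rewrite derive1E; apply: derive_val; apply: dF; rewrite ax.
Qed.

Lemma comp_clamp_continuous a b f : a <= b -> continuous_on_segment a b f ->
  continuous (f \o clamp a b).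
Proof.
move=> ab cf x; apply: continuous_comp; first exact: clamp_continuous.
by apply: cf; exact: clamp_bound.
Qed.

(** Composing with [clamp] extends the integrand continuously to the line, so the primitive has a
    two-sided derivative at the ends [a] and [b] as well. *)
Lemma segment_primitive f a b : a <= b -> continuous_on_segment a b f ->
  exists F, forall x, a <= x <= b -> is_derive x 1 F (f x).
Proof.
move=> ab cf; have [F dF] := primitive (a - 1) (comp_clamp_continuous ab cf).
exists F => x xab; have := dF x; rewrite /= (clamp_id xab); apply.
by case/andP: xab => ax _; lra.
Qed.

Lemma sub_continuous_on_segment a b a' b' f : a <= a' -> b' <= b ->
  continuous_on_segment a b f -> continuous_on_segment a' b' f.
Proof. by move=> aa bb cf x /andP[h1 h2]; apply: cf; rewrite (le_trans aa)//= (le_trans h2). Qed.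

Lemma int_split f a b c : a <= b -> b <= c -> continuous_on_segment a c f ->
  integ a c f = integ a b f + integ b c f.
Proof.
move=> ab bc cf; have ac := le_trans ab bc.
have [F dF] := segment_primitive ac cf.
have E x y : a <= x -> x <= y -> y <= c -> integ x y f = F y - F x.
  move=> ax xy yc; apply: int_primitive => //.
    exact: sub_continuous_on_segment cf.
  by move=> z /andP[h1 h2]; apply: dF; rewrite (le_trans ax)//= (le_trans h2).
by rewrite !E//; ring.
Qed.

Lemma eq_int f g a b : (forall x, a <= x <= b -> f x = g x) -> integ a b f = integ a b g.
Proof.
move=> fg; apply: eq_Rintegral => x; rewrite inE/= in_itv/= => /fg.
exact.
Qed.

Lemma intD f g a b : a <= b -> continuous_on_segment a b f ->
  continuous_on_segment a b g -> integ a b (fun x => f x + g x) = integ a b f + integ a b g.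
Proof.
move=> ab cf cg; have [F dF] := segment_primitive ab cf.
have [H dH] := segment_primitive ab cg.
rewrite (int_primitive ab cf dF) (int_primitive ab cg dH).
transitivity ((F + H) b - (F + H) a); last by rewrite !fctE; ring.
apply: int_primitive => //.
  by move=> x xab; apply: continuousD; [exact: cf|exact: cg].
by move=> x xab; apply: is_deriveD; [exact: dF|exact: dH].
Qed.

Lemma intZ k f a b : a <= b -> continuous_on_segment a b f ->
  integ a b (fun x => k * f x) = k * integ a b f.
Proof.
move=> ab cf; have [F dF] := segment_primitive ab cf.
rewrite (int_primitive ab cf dF).
transitivity ((k *: F) b - (k *: F) a); last by rewrite -scalerBr.
apply: int_primitive => //.
  by move=> x xab; apply: continuousM; [exact: cst_continuous|exact: cf].
by move=> x xab; apply: is_deriveZ; exact: dF.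
Qed.

Lemma intN f a b : a <= b -> continuous_on_segment a b f ->
  integ a b (fun x => - f x) = - integ a b f.
Proof.
move=> ab cf; rewrite -mulN1r -intZ//; apply: eq_int => x _.
by rewrite mulN1r.
Qed.

Lemma continuous_on_segmentN f a b : continuous_on_segment a b f ->
  continuous_on_segment a b (fun x => - f x).
Proof. by move=> cf x xab; apply: continuousN; exact: cf. Qed.

Lemma intB f g a b : a <= b -> continuous_on_segment a b f ->
  continuous_on_segment a b g -> integ a b (fun x => f x - g x) = integ a b f - integ a b g.
Proof.
move=> ab cf cg; rewrite intD//; last exact: continuous_on_segmentN.
by rewrite intN.
Qed.

Lemma int_bound f a b M : a <= b -> continuous_on_segment a b f ->
  (forall x, a <= x <= b -> `|f x| <= M) -> `|integ a b f| <= M * (b - a).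
Proof.
move=> ab cf fM; have [F dF] := segment_primitive ab cf.
rewrite (int_primitive ab cf dF).
have [||c cab ->] := @MVT_segment R F f a b ab.
- by move=> x; rewrite in_itv/= => /andP[/ltW ax /ltW xb]; apply: dF; rewrite ax.
- apply: within_segment => x xab; exact: derive_continuous (dF x xab).
rewrite normrM (ger0_norm (x := b - a)) ?subr_ge0//.
by rewrite ler_wpM2r ?subr_ge0//; apply: fM; move: cab; rewrite in_itv.
Qed.

(** For a primitive [F], the function [F (x + L) - F x] has derivative 0 by periodicity, hence is
    constant. *)
Lemma int_shift f a c L : 0 < L -> continuous f -> (forall x, f (x + L) = f x) ->
  a <= c -> integ a (a + L) f = integ c (c + L) f.
Proof.
move=> L0 cf pf; rewrite le_eqVlt => /predU1P[->//|ac].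
have [F dF] := primitive (a - 1) cf.
have E x : a <= x -> integ x (x + L) f = F (x + L) - F x.
  move=> ax; apply: int_primitive => //; [lra|by move=> y _; exact: cf|].
  by move=> y /andP[h1 h2]; apply: dF; lra.
rewrite !E//; last exact: ltW.
have dH x : a - 1 < x -> is_derive x 1 ((F \o shift L) - F) 0.
  move=> ax; rewrite -(subrr (f x)); apply: is_deriveB; last exact: dF.
  rewrite -pf -[f (x + L)]mulr1; apply: is_derive1_comp; last exact: is_derive_shift.
  by apply: dF; rewrite /shift /=; lra.
have [||e eac] := @MVT_segment R ((F \o shift L) - F) (fun=> 0) a c (ltW ac).
- by move=> x; rewrite in_itv/= => /andP[ax xc]; apply: dH; lra.
- apply: within_segment => x /andP[h1 h2]; apply: (derive_continuous (l := 0)).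
  by apply: dH; lra.
by rewrite mul0r => /eqP; rewrite subr_eq0 !fctE/= => /eqP.
Qed.

Lemma frac_le e k : 0 < e -> 0 <= k -> e / (k + 1) * k <= e.
Proof.
move=> e0 k0; have k1 : 0 < k + 1 by lra.
by rewrite mulrAC ler_pdivrMr// ler_pM2l//; lra.
Qed.

Lemma dist_between (x y z : R) :
  Num.min x y <= z <= Num.max x y -> `|x - z| <= `|x - y|.
Proof.
have [xy|/ltW yx] := leP x y => /andP[h1 h2].
  by rewrite !ler0_norm ?subr_le0 ?lerN2 ?lerB.
by rewrite !ger0_norm ?subr_ge0 ?lerB.
Qed.

Lemma derive_mean_bound F (f : R -> R) x y k e : 0 <= e ->
  (forall z, Num.min x y <= z <= Num.max x y ->
     is_derive z 1 F (f z) /\ `|f z - k| <= e) ->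
  `|F y - F x - k * (y - x)| <= e * `|y - x|.
Proof.
move=> e0; wlog xy : x y / x <= y.
  move=> H; have /orP[xy|yx] := le_total x y; first exact: H.
  rewrite minC maxC => h; have := H y x yx h.
  rewrite -normrN (distrC x y); congr (`|_| <= _); ring.
rewrite (min_idPl xy) (max_idPr xy) => h.
have [||c cxy ->] := @MVT_segment R F f x y xy.
- by move=> z; rewrite in_itv/= => /andP[/ltW h1 /ltW h2]; apply: (h z _).1; rewrite h1.
- by apply: within_segment => z /h[+ _]; exact: derive_continuous.
rewrite -mulrBl normrM ler_wpM2r//; apply: (h c _).2.
by move: cxy; rewrite in_itv.
Qed.

Lemma is_derive_epsP F x l : is_derive x 1 F l <->
  (forall e, 0 < e -> \forall y \near x, `|F y - F x - l * (y - x)| <= e * `|y - x|).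
Proof.
split=> [/is_derive1_caratheodory[h [hF ch <-]] e e0|h].
  near=> y; rewrite hF -mulrBl normrM ler_wpM2r//.
  near: y; have /cvgrPdist_le := ch; move=> /(_ e e0).
  by apply: filterS => y; rewrite distrC.
apply/is_derive1_caratheodory.
exists (fun y => if y == x then l else (F y - F x) / (y - x)); split.
- by move=> z; case: eqP => [->|/eqP zx]; rewrite ?subrr ?mulr0// divfK// subr_eq0.
- apply/cvgrPdist_le => e e0; rewrite eqxx.
  have := h e e0; apply: filterS => y; case: eqP => [->|/eqP yx].
    by move=> _; rewrite subrr normr0 ltW.
  have yx0 : 0 < `|y - x| by rewrite normr_gt0 subr_eq0.
  have -> : F y - F x - l * (y - x) = - ((l - (F y - F x) / (y - x)) * (y - x)).
    by field; rewrite subr_eq0.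
  by rewrite normrN normrM ler_pM2r.
- by rewrite eqxx.
Unshelve. all: by end_near. Qed.

(** Tube lemma, by compactness of the segment. *)
Lemma near_segment (X : topologicalType) (P : X -> R -> Prop) (x : X) a b :
  (forall s, a <= s <= b -> \forall p \near (x, s), P p.1 p.2) ->
  \forall y \near x, forall s, a <= s <= b -> P y s.
Proof.
move=> h.
have /compact_near_coveringP K := @segment_compact R a b.
have := K X (nbhs x) P _.
have H s : `[a, b]%classic s -> \forall s' \near s & y \near x, P y s'.
  rewrite /= in_itv/= => /h [[U V]/= [Ux Vs] UVP].
  by exists (V, U) => //= -[s' y]/= [Vs' Uy]; exact: (UVP (y, s')).
move=> /(_ _ H); apply: filterS => y Py s sab.
by apply: Py => /=; rewrite in_itv.
Qed.

Lemma continuous_pairr (X Y Z : topologicalType) (f : X -> Y -> Z) (x : X) :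
  continuous (fun p => f p.1 p.2) -> continuous (f x).
Proof.
move=> cf y.
have h : (x, y') @[y' --> y] --> (x, y) by apply: cvg_pair; [exact: cvg_cst|exact: cvg_id].
exact: (cvg_comp _ _ h (cf (x, y))).
Qed.

Lemma continuous_pairl (X Y Z : topologicalType) (f : X -> Y -> Z) (y : Y) :
  continuous (fun p => f p.1 p.2) -> continuous (f^~ y).
Proof.
move=> cf x.
have h : (x', y) @[x' --> x] --> (x, y) by apply: cvg_pair; [exact: cvg_id|exact: cvg_cst].
exact: (cvg_comp _ _ h (cf (x, y))).
Qed.

Lemma continuous_swap (X Y Z : topologicalType) (f : X -> Y -> Z) :
  continuous (fun p => f p.1 p.2) -> continuous (fun p : Y * X => f p.2 p.1).
Proof.
move=> cf [y x].
have h : (p.2, p.1) @[p --> nbhs (y, x)] --> (x, y).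
  by apply: (@cvg_pair _ _ _ (nbhs (y, x))); [exact: cvg_snd|exact: cvg_fst].
exact: (cvg_comp _ _ h (cf (x, y))).
Qed.

Lemma near_segment_dist (X : topologicalType) (f : X -> R -> R) (x : X) a b e :
  continuous (fun p => f p.1 p.2) -> 0 < e ->
  \forall y \near x, forall s, a <= s <= b -> `|f x s - f y s| <= e.
Proof.
move=> cf e0; apply: near_segment => s _.
have e20 : 0 < e / 2 by rewrite divr_gt0.
have /cvgrPdist_le/(_ _ e20) h1 := cf (x, s).
have cfx : continuous (f x) by exact: continuous_pairr.
have /cvgrPdist_le/(_ _ e20) h2 := cfx s.
have {}h2 : \forall p \near (x, s), `|f x s - f x p.2| <= e / 2.
  exact: (cvg_snd (F := nbhs x) (G := nbhs s) h2).
apply: filterS2 h1 h2 => -[y s']/= h1 h2.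
rewrite (_ : _ - _ = (f x s - f y s') - (f x s - f x s')); last by ring.
by rewrite (le_trans (ler_normB _ _))//; lra.
Qed.

(** Uniform closeness of the integrands on the compact segment. The parameter space is arbitrary:
    for the homotopy of push-offs it is a plane. *)
Lemma int_continuous (X : topologicalType) (f : X -> R -> R) a b : a <= b ->
  continuous (fun p => f p.1 p.2) -> continuous (fun x : X => integ a b (f x)).
Proof.
move=> ab cf x; apply/cvgrPdist_le => e e0.
have e1 : 0 < e / (b - a + 1) by rewrite divr_gt0//; lra.
have := near_segment_dist x a b cf e1; apply: filterS => y h.
have c z : continuous_on_segment a b (f z).
  by move=> s _; exact: continuous_pairr.
rewrite -intB//; apply: le_trans (int_bound ab _ h) _.
  by move=> s sab; apply: continuousB; exact: (c _).
by rewrite frac_le// subr_ge0.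
Qed.

(** Fubini for continuous integrands, through the fundamental theorem: differentiating the left side
    with respect to its upper bound [d] gives the integrand of the right side. *)
Lemma int_swap (f : R -> R -> R) a b c d : a <= b -> c <= d ->
  continuous (fun p => f p.1 p.2) ->
  integ a b (fun s => integ c d (f s)) = integ c d (fun t => integ a b (f^~ t)).
Proof.
move=> ab cd cf.
have cfr s : continuous (f s) by exact: continuous_pairr.
have cfl t : continuous (f^~ t) by exact: continuous_pairl.
have cf' := continuous_swap cf.
(* Starting at [c - 1] makes the inner integral differentiable on both sides of [y = c]. *)
pose P s y := integ (c - 1) y (f s).
have dP s y : c - 1 < y -> is_derive y 1 (P s) (f s y).
  move=> cy; have [F dF] := primitive (c - 2) (cfr s).
  apply: (near_eq_is_derive (f := fun y => F y - F (c - 1))).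
    near=> z; rewrite /P; apply/esym/int_primitive.
    - by apply/ltW; near: z; exact: lt_nbhsr.
    - by move=> ? _; exact: cfr.
    - by move=> w /andP[w1 _]; apply: dF; lra.
  have cy2 : c - 2 < y by lra.
  exact: is_derive_eq (deriveS (dF _ cy2) (deriveC _ _)) (subr0 _).
have cP y : c - 1 < y -> continuous (P^~ y).
  by move=> cy; apply: (int_continuous (f := f)) => //; exact: ltW.
pose H y := integ a b (P^~ y).
have dH y : c <= y <= d -> is_derive y 1 H (integ a b (f^~ y)).
  move=> /andP[cy yd]; apply/is_derive_epsP => e e0.
  have e1 : 0 < e / (b - a + 1) by rewrite divr_gt0//; lra.
  have /nbhs_ballP[r/= r0 hr] := near_segment_dist (f := fun t s => f s t) y a b cf' e1.
  near=> z.
  have cz : c - 1 < z by near: z; apply: lt_nbhsr; lra.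
  have cy' : c - 1 < y by lra.
  have zr : `|y - z| < r by near: z; apply/nbhs_ballP; exists r.
  have E : H z - H y - integ a b (f^~ y) * (z - y) =
           integ a b (fun s => P s z - P s y - (z - y) * f s y).
    rewrite intB//; last 2 first.
    - by move=> s _; apply: continuousB; exact: cP.
    - by move=> s _; apply: continuousM; [exact: cst_continuous|exact: cfl].
    rewrite intB//; last 2 first.
    - by move=> s _; exact: cP.
    - by move=> s _; exact: cP.
    by rewrite intZ//; [rewrite [(z - y) * _]mulrC|move=> s _; exact: cfl].
  rewrite E.
  have B s : a <= s <= b ->
      `|P s z - P s y - (z - y) * f s y| <= e / (b - a + 1) * `|z - y|.
    move=> sab; rewrite [(z - y) * _]mulrC.
    apply: (derive_mean_bound (f := f s)); first exact: ltW.
    move=> w hw; split.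
      apply: dP; case/andP: hw => + _; apply: lt_le_trans.
      by rewrite lt_min cy' cz.
    rewrite distrC; apply: hr => //=; rewrite /ball/=; apply: le_lt_trans zr.
    exact: dist_between.
  apply: le_trans (int_bound ab _ B) _.
    move=> s _; apply: continuousB; last first.
      by apply: continuousM; [exact: cst_continuous|exact: cfl].
    by apply: continuousB; exact: cP.
  by rewrite mulrAC ler_wpM2r// frac_le// subr_ge0.
transitivity (H d - H c).
  rewrite /H -intB//; last 2 first.
  - by move=> s _; apply: cP; lra.
  - by move=> s _; apply: cP; lra.
  apply: eq_int => s _; rewrite /P (@int_split _ (c - 1) c d)//; last 2 first.
  - by lra.
  - by move=> ? _; exact: cfr.
  by rewrite [RHS]addrC addKr.
apply/esym/int_primitive => // t _.
by apply: (int_continuous (f := fun t s => f s t)).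
Unshelve. all: by end_near. Qed.

End integral.

(** * Potentials of the solid angle form *)

Section continuity.
Context {R : realType} {X : topologicalType}.
Implicit Types (f g : X -> R) (p : X).

Lemma contC (k : R) p : {for p, continuous (fun=> k)}.
Proof. exact: cvg_cst. Qed.

Lemma contA f g p : {for p, continuous f} -> {for p, continuous g} ->
  {for p, continuous (fun y => f y + g y)}.
Proof. exact: continuousD. Qed.

Lemma contN f p : {for p, continuous f} -> {for p, continuous (fun y => - f y)}.
Proof. exact: continuousN. Qed.

Lemma contM f g p : {for p, continuous f} -> {for p, continuous g} ->
  {for p, continuous (fun y => f y * g y)}.
Proof. exact: continuousM. Qed.

Lemma contI f p : f p != 0 -> {for p, continuous f} -> {for p, continuous (fun y => (f y)^-1)}.
Proof. by move=> f0 cf; apply: continuousV. Qed.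

Lemma contX f n p : {for p, continuous f} -> {for p, continuous (fun y => f y ^+ n)}.
Proof.
move=> cf; elim: n => [|n IH]; first exact: cvg_cst.
rewrite (_ : (fun y => _) = (fun y => f y * f y ^+ n)); first exact: contM.
by apply/funext => y; rewrite exprS.
Qed.

Lemma contR f p : {for p, continuous f} -> {for p, continuous (fun y => Num.sqrt (f y))}.
Proof. by move=> cf; apply: (continuous_comp cf); exact: sqrt_continuous. Qed.

End continuity.

Lemma cont_comp2 (T X Y Z : topologicalType) (h : X -> Y -> Z) (f : T -> X) (g : T -> Y) p :
  {for (f p, g p), continuous (fun q => h q.1 q.2)} ->
  {for p, continuous f} -> {for p, continuous g} ->
  {for p, continuous (fun u => h (f u) (g u))}.
Proof.
move=> ch cf cg.
have H : (f u, g u) @[u --> nbhs p] --> (f p, g p) by apply: (@cvg_pair _ _ _ (nbhs p)).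
exact: (cvg_comp _ _ H ch).
Qed.

Lemma cont_comp (T X Y : topologicalType) (h : X -> Y) (f : T -> X) p :
  {for f p, continuous h} -> {for p, continuous f} -> {for p, continuous (fun u => h (f u))}.
Proof. by move=> ch cf; exact: (cvg_comp _ _ cf ch). Qed.

Lemma cont_fst (X Y : topologicalType) (p : X * Y) : {for p, continuous fst}.
Proof. by case: p => x y; exact: cvg_fst. Qed.

Lemma cont_snd (X Y : topologicalType) (p : X * Y) : {for p, continuous snd}.
Proof. by case: p => x y; exact: cvg_snd. Qed.

Lemma cont_comp_fst (X Y Z : topologicalType) (f : X -> Z) (p : X * Y) :
  {for p.1, continuous f} -> {for p, continuous (fun u => f u.1)}.
Proof. by move=> cf; apply: cont_comp cf _; exact: cont_fst. Qed.

Lemma cont_comp_snd (X Y Z : topologicalType) (f : Y -> Z) (p : X * Y) :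
  {for p.2, continuous f} -> {for p, continuous (fun u => f u.2)}.
Proof. by move=> cf; apply: cont_comp cf _; exact: cont_snd. Qed.

(** Descends along the syntax of the function; what remains is the nonvanishing of inverted factors
    and the subterms whose continuity is not at hand. *)
Ltac cont := lazymatch goal with
  | |- @prop_for _ ?p ?P _ => let g := eval cbv beta in (P p) in change g; cont
  | |- continuous_at ?p (fun x => @?f x + @?g x) => apply: (@contA _ _ f g p); cont
  | |- continuous_at ?p (fun x => @?f x * @?g x) => apply: (@contM _ _ f g p); cont
  | |- continuous_at ?p (fun x => - @?f x) => apply: (@contN _ _ f p); cont
  | |- continuous_at ?p (fun x => (@?f x)^-1) => apply: (@contI _ _ f p); [idtac|cont]
  | |- continuous_at ?p (fun x => @?f x ^+ ?n) => apply: (@contX _ _ f n p); cont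
  | |- continuous_at ?p (fun x => Num.sqrt (@?f x)) => apply: (@contR _ _ f p); cont
  | |- _ => first [assumption | exact: contC | idtac]
  end.

(** * Green's formula on rectangles *)

Section green.
Context {R : realType}.
Implicit Types (P Q Ps Qt : R -> R -> R) (a b c d : R).

Definition continuous2_at (f : R -> R -> R) (s t : R) :=
  {for (s, t), continuous (fun p : R * R => f p.1 p.2)}.

Lemma clamp2_continuous (f : R -> R -> R) a b c d : a <= b -> c <= d ->
  (forall s t, a <= s <= b -> c <= t <= d -> continuous2_at f s t) ->
  continuous (fun p : R * R => f (clamp a b p.1) (clamp c d p.2)).
Proof.
move=> ab cd cf [s t].
apply: (@cont_comp2 (R * R)%type R R R f (fun p => clamp a b p.1) (fun p => clamp c d p.2) (s, t)).
- by apply: cf; exact: clamp_bound.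
- by apply: cont_comp_fst; exact: clamp_continuous.
- by apply: cont_comp_snd; exact: clamp_continuous.
Qed.

Lemma continuous2_at_r f (s t : R) : continuous2_at f s t -> {for t, continuous (f s)}.
Proof.
move=> cf.
by apply: (@cont_comp2 R R R R f (fun=> s) id t cf); [exact: cvg_cst|exact: cvg_id].
Qed.

Lemma continuous2_at_l f (s t : R) : continuous2_at f s t -> {for s, continuous (f^~ t)}.
Proof.
move=> cf.
by apply: (@cont_comp2 R R R R f id (fun=> t) s cf); [exact: cvg_id|exact: cvg_cst].
Qed.

Lemma int_int_derivel P Ps a b c d : a <= b -> c <= d ->
  (forall s t, a <= s <= b -> c <= t <= d -> is_derive s 1 (P^~ t) (Ps s t)) ->
  (forall s t, a <= s <= b -> c <= t <= d -> continuous2_at P s t) ->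
  (forall s t, a <= s <= b -> c <= t <= d -> continuous2_at Ps s t) ->
  integ a b (fun s => integ c d (Ps s)) = integ c d (P b) - integ c d (P a).
Proof.
move=> ab cd dP cP cPs.
have aab : a <= a <= b by rewrite lexx.
have bab : a <= b <= b by rewrite lexx ab.
pose f s t := Ps (clamp a b s) (clamp c d t).
have cf : continuous (fun p : R * R => f p.1 p.2) by exact: clamp2_continuous.
transitivity (integ a b (fun s => integ c d (f s))).
  apply: eq_int => s sab; apply: eq_int => t tcd.
  by rewrite /f (clamp_id sab) (clamp_id tcd).
rewrite int_swap// -intB//; last 2 first.
- by move=> t tcd; apply: (continuous2_at_r (f := P)); exact: cP.
- by move=> t tcd; apply: (continuous2_at_r (f := P)); exact: cP.
apply: eq_int => t tcd.
apply: (int_primitive (F := P^~ t)) => //.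
- by move=> s _; apply: (continuous2_at_l (f := f)); exact: cf.
- by move=> s sab; rewrite /f (clamp_id sab) (clamp_id tcd); exact: dP.
Qed.

(** [P] is differentiated in [s] and [Q] in [t]. This suits C^1 curves: the component of a potential
    along [dt] contains the velocity of the second curve, which depends on [t] alone and so is never
    differentiated. *)
Lemma green P Q Ps Qt a b c d : a <= b -> c <= d ->
  (forall s t, a <= s <= b -> c <= t <= d -> is_derive s 1 (P^~ t) (Ps s t)) ->
  (forall s t, a <= s <= b -> c <= t <= d -> is_derive t 1 (Q s) (Qt s t)) ->
  (forall s t, a <= s <= b -> c <= t <= d -> continuous2_at P s t) ->
  (forall s t, a <= s <= b -> c <= t <= d -> continuous2_at Q s t) ->
  (forall s t, a <= s <= b -> c <= t <= d -> continuous2_at Ps s t) ->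
  (forall s t, a <= s <= b -> c <= t <= d -> continuous2_at Qt s t) ->
  integ a b (fun s => integ c d (fun t => Ps s t - Qt s t)) =
  integ c d (P b) - integ c d (P a) - (integ a b (Q^~ d) - integ a b (Q^~ c)).
Proof.
move=> ab cd dP dQ cP cQ cPs cQt.
pose p s t := Ps (clamp a b s) (clamp c d t).
pose q s t := Qt (clamp a b s) (clamp c d t).
have cp : continuous (fun u : R * R => p u.1 u.2) by exact: clamp2_continuous.
have cq : continuous (fun u : R * R => q u.1 u.2) by exact: clamp2_continuous.
have E (f : R -> R -> R) : integ a b (fun s => integ c d (f s)) =
    integ a b (fun s => integ c d (fun t => f (clamp a b s) (clamp c d t))).
  apply: eq_int => s sab; apply: eq_int => t tcd.
  by rewrite (clamp_id sab) (clamp_id tcd).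
rewrite -(int_int_derivel ab cd dP cP cPs) (E Ps) (E (fun s t => Ps s t - Qt s t)).
have -> : integ a b (Q^~ d) - integ a b (Q^~ c) = integ a b (fun s => integ c d (q s)).
  have dcd : c <= d <= d by rewrite lexx cd.
  have ccd : c <= c <= d by rewrite lexx.
  rewrite -intB//; last 2 first.
  - by move=> s sab; apply: (continuous2_at_l (f := Q)); exact: cQ.
  - by move=> s sab; apply: (continuous2_at_l (f := Q)); exact: cQ.
  apply: eq_int => s sab; apply/esym/int_primitive => //.
  - by move=> t _; apply: (continuous2_at_r (f := q)); exact: cq.
  - by move=> t tcd; rewrite /q (clamp_id sab) (clamp_id tcd); exact: dQ.
rewrite -intB//; last 2 first.
- by move=> s _; apply: (int_continuous (f := p)).
- by move=> s _; apply: (int_continuous (f := q)).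
apply: eq_int => s _; rewrite intB//.
- by move=> t _; apply: (continuous2_at_r (f := p)); exact: cp.
- by move=> t _; apply: (continuous2_at_r (f := q)); exact: cq.
Qed.

End green.

Definition rho (R : realType) (x y z : R) := Num.sqrt (x ^+ 2 + y ^+ 2 + z ^+ 2).

(* A potential is k (x dy - y dx); [m] records the radial derivative of k, with
   dk = m (x dx + y dy) + dz / rho^3, so that the exterior derivative of the
   potential is minus the solid angle form. *)
Definition potential (R : realType) (k m : R -> R -> R -> R) (x y z : R) :=
  [/\ (x ^+ 2 + y ^+ 2) * m x y z + 2 * k x y z = - z / rho x y z ^+ 3,
   forall (X Y Z : R -> R) s X' Y' Z', X s = x -> Y s = y -> Z s = z ->
     is_derive s 1 X X' -> is_derive s 1 Y Y' -> is_derive s 1 Z Z' ->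
     is_derive s 1 (fun s => k (X s) (Y s) (Z s))
       (m x y z * (x * X' + y * Y') + Z' / rho x y z ^+ 3) &
   forall (T : topologicalType) (X Y Z : T -> R) p, X p = x -> Y p = y -> Z p = z ->
     {for p, continuous X} -> {for p, continuous Y} -> {for p, continuous Z} ->
     {for p, continuous (fun p => k (X p) (Y p) (Z p))} /\
     {for p, continuous (fun p => m (X p) (Y p) (Z p))}].

Section potentials.
Context {R : realType}.
Implicit Types x y z e : R.

(** [k_mid] is the form [z / rho * dtheta], singular on the whole axis [x = y = 0]. Subtracting
    [e * dtheta] with [e = 1] or [-1] gives [k_pole e]: since [x^2 + y^2 = (rho - e z)(rho + e z)],
    one factor cancels and the only singularity left is the half-axis where [e z < 0]. The functions
    [m] are forced by the relation between [k] and [m] in [potential]. *)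
Definition k_mid x y z := z / (rho x y z * (x ^+ 2 + y ^+ 2)).
Definition m_mid x y z := - (z / rho x y z ^+ 3 + 2 * k_mid x y z) / (x ^+ 2 + y ^+ 2).
Definition k_pole e x y z := - e / (rho x y z * (rho x y z + e * z)).
Definition m_pole e x y z :=
  e * (2 * rho x y z + e * z) / (rho x y z ^+ 3 * (rho x y z + e * z) ^+ 2).

Lemma rho_gt0 x y z : (0 < rho x y z) = (0 < x ^+ 2 + y ^+ 2 + z ^+ 2).
Proof. by rewrite /rho sqrtr_gt0. Qed.

Lemma rho_ge0 x y z : 0 <= rho x y z.
Proof. exact: sqrtr_ge0. Qed.

Lemma sqr_rho x y z : rho x y z ^+ 2 = x ^+ 2 + y ^+ 2 + z ^+ 2.
Proof. by rewrite /rho sqr_sqrtr// !addr_ge0// sqr_ge0. Qed.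

Lemma derive_sqr (X : R -> R) (s X' : R) : is_derive s 1 X X' ->
  is_derive s 1 (fun s => X s ^+ 2) (2 * X s * X').
Proof. by move=> h; apply: is_derive_eq (deriveP h h) _; ring. Qed.

Lemma derive_rho (X Y Z : R -> R) (s X' Y' Z' : R) : 0 < rho (X s) (Y s) (Z s) ->
  is_derive s 1 X X' -> is_derive s 1 Y Y' -> is_derive s 1 Z Z' ->
  is_derive s 1 (fun s => rho (X s) (Y s) (Z s))
    ((X s * X' + Y s * Y' + Z s * Z') / rho (X s) (Y s) (Z s)).
Proof.
rewrite rho_gt0 /rho => r0 /derive_sqr dX /derive_sqr dY /derive_sqr dZ.
apply: is_derive_eq (deriveR (f := fun s => X s ^+ 2 + Y s ^+ 2 + Z s ^+ 2) r0 (deriveA (deriveA dX dY) dZ)) _.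
by field; rewrite gt_eqF// sqrtr_gt0.
Qed.

Lemma cont_rho (T : topologicalType) (X Y Z : T -> R) p :
  {for p, continuous X} -> {for p, continuous Y} -> {for p, continuous Z} ->
  {for p, continuous (fun p => rho (X p) (Y p) (Z p))}.
Proof. by move=> cX cY cZ; rewrite /rho; cont.
Qed.

Lemma potential_mid x y z : 0 < x ^+ 2 + y ^+ 2 -> potential k_mid m_mid x y z.
Proof.
move=> q0; have r0 : 0 < rho x y z by rewrite rho_gt0 ltr_pwDl// sqr_ge0.
have rE := sqr_rho x y z.
split.
- by rewrite /m_mid mulrCA divff ?gt_eqF// mulr1; ring.
- move=> X Y Z s X' Y' Z' hX hY hZ dX dY dZ.
  have q0' : rho (X s) (Y s) (Z s) * (X s ^+ 2 + Y s ^+ 2) != 0.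
    by rewrite hX hY hZ mulf_neq0// gt_eqF.
  have r0' : 0 < rho (X s) (Y s) (Z s) by rewrite hX hY hZ.
  apply: is_derive_eq (deriveP dZ (deriveI (f := fun s => rho (X s) (Y s) (Z s) * (X s ^+ 2 + Y s ^+ 2)) q0'
    (deriveP (derive_rho r0' dX dY dZ) (deriveA (derive_sqr dX) (derive_sqr dY))))) _.
  rewrite hX hY hZ /m_mid /k_mid.
  move: (rho x y z) r0 rE => r r0 rE.
  have qE : x ^+ 2 + y ^+ 2 = r ^+ 2 - z ^+ 2 by rewrite rE; ring.
  rewrite qE in q0 *.
  by field; rewrite !gt_eqF.
- move=> T X Y Z p hX hY hZ cX cY cZ.
  have cr := cont_rho cX cY cZ.
  have q0' : X p ^+ 2 + Y p ^+ 2 != 0 by rewrite hX hY gt_eqF.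
  have r0' : rho (X p) (Y p) (Z p) != 0 by rewrite hX hY hZ gt_eqF.
  by split; rewrite /m_mid /k_mid; cont; rewrite ?mulf_neq0// expf_neq0.
Qed.

Lemma potential_pole e x y z : e ^+ 2 = 1 -> 0 < rho x y z -> 0 < rho x y z + e * z ->
  potential (k_pole e) (m_pole e) x y z.
Proof.
move=> e1 r0 rz0; have rE := sqr_rho x y z.
split.
- rewrite /m_pole /k_pole; move: (rho x y z) r0 rz0 rE => r r0 rz0 rE.
  have -> : x ^+ 2 + y ^+ 2 = r ^+ 2 - z ^+ 2 by rewrite rE; ring.
  move: e1 rz0 => /eqP; rewrite sqrf_eq1 => /orP[] /eqP-> h;
    by field; rewrite (gt_eqF r0) gt_eqF//; move: h; rewrite ?mul1r ?mulN1r.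
- move=> X Y Z s X' Y' Z' hX hY hZ dX dY dZ.
  have q0' : rho (X s) (Y s) (Z s) * (rho (X s) (Y s) (Z s) + e * Z s) != 0.
    by rewrite hX hY hZ mulf_neq0// gt_eqF.
  have r0' : 0 < rho (X s) (Y s) (Z s) by rewrite hX hY hZ.
  apply: is_derive_eq (deriveK (- e) (deriveI (f := fun s => rho (X s) (Y s) (Z s) * (rho (X s) (Y s) (Z s) + e * Z s))
    q0' (deriveP (derive_rho r0' dX dY dZ) (deriveA (derive_rho r0' dX dY dZ) (deriveK e dZ))))) _.
  rewrite hX hY hZ /m_pole.
  move: (rho x y z) r0 rz0 rE => r r0 rz0 rE.
  move: e1 rz0 => /eqP; rewrite sqrf_eq1 => /orP[] /eqP-> h;
    by field; rewrite (gt_eqF r0) gt_eqF//; move: h; rewrite ?mul1r ?mulN1r.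
- move=> T X Y Z p hX hY hZ cX cY cZ.
  have cr := cont_rho cX cY cZ.
  have r0' : rho (X p) (Y p) (Z p) != 0 by rewrite hX hY hZ gt_eqF.
  have q0' : rho (X p) (Y p) (Z p) + e * Z p != 0 by rewrite hX hY hZ gt_eqF.
  by split; rewrite /m_pole /k_pole; cont; rewrite !(mulf_neq0, expf_neq0).
Qed.

End potentials.

(** * Angles *)

Section angle.
Context {R : realType}.
Implicit Types x y p q a b : R.

(** The signed angle from [(p, q)] to [(x, y)] when their scalar product is positive. On that
    half-plane it is a branch of the polar angle, so [dtheta] integrates to its differences. *)
Definition angle p q x y := atan ((p * y - q * x) / (p * x + q * y)).

Lemma integ_angle (X Y X' Y' : R -> R) p q a b : a <= b ->
  (forall s, a <= s <= b -> is_derive s 1 X (X' s)) ->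
  (forall s, a <= s <= b -> is_derive s 1 Y (Y' s)) ->
  (forall s, a <= s <= b -> {for s, continuous X'}) ->
  (forall s, a <= s <= b -> {for s, continuous Y'}) ->
  (forall s, a <= s <= b -> 0 < p * X s + q * Y s) ->
  integ a b (fun s => (X s ^+ 2 + Y s ^+ 2)^-1 * (X s * Y' s - Y s * X' s)) =
  angle p q (X b) (Y b) - angle p q (X a) (Y a).
Proof.
move=> ab dX dY cX' cY' H.
have H2 s : a <= s <= b -> X s ^+ 2 + Y s ^+ 2 != 0.
  move=> /H h; rewrite paddr_eq0 ?sqr_ge0// !sqrf_eq0.
  by apply/negP => /andP[/eqP X0 /eqP Y0]; move: h; rewrite X0 Y0 !mulr0 addr0 ltxx.
apply: (int_primitive (F := fun s => angle p q (X s) (Y s))) => //.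
- move=> s sab; have cX := derive_continuous (dX s sab).
  have cY := derive_continuous (dY s sab); have := cX' s sab; have := cY' s sab.
  by move=> ? ?; have := H2 s sab => ?; cont.
- move=> s sab; have h := H s sab; have h2 := H2 s sab.
  have D1 := deriveS (deriveK p (dY s sab)) (deriveK q (dX s sab)).
  have D2 := deriveA (deriveK p (dX s sab)) (deriveK q (dY s sab)).
  have D := deriveP D1 (deriveI (f := fun s => p * X s + q * Y s) (lt0r_neq0 h) D2).
  apply: is_derive_eq (is_derive1_comp (is_derive1_atan _) D) _.
  have pq0 : p ^+ 2 + q ^+ 2 != 0.
    rewrite paddr_eq0 ?sqr_ge0// !sqrf_eq0.
    by apply/negP => /andP[/eqP p0 /eqP q0]; move: h; rewrite p0 q0 !mul0r addr0 ltxx.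
  have n0 := lt0r_neq0 h.
  have -> : 1 + ((p * Y s - q * X s) / (p * X s + q * Y s)) ^+ 2 =
      (p ^+ 2 + q ^+ 2) * (X s ^+ 2 + Y s ^+ 2) / (p * X s + q * Y s) ^+ 2 by field.
  by field; rewrite h2 pq0 n0.
Qed.

Lemma cos_angle p q x y : 0 < p * x + q * y ->
  cos (angle p q x y) = (p * x + q * y) / (Num.sqrt (p ^+ 2 + q ^+ 2) * Num.sqrt (x ^+ 2 + y ^+ 2)).
Proof.
move=> h; rewrite /angle cos_atan.
rewrite (_ : 1 + _ = (p ^+ 2 + q ^+ 2) * (x ^+ 2 + y ^+ 2) / (p * x + q * y) ^+ 2); last first.
  by field; rewrite lt0r_neq0.
rewrite sqrtrM ?mulr_ge0 ?addr_ge0 ?sqr_ge0// sqrtrM ?addr_ge0 ?sqr_ge0//.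
by rewrite sqrtrV ?sqr_ge0// sqrtr_sqr gtr0_norm// invfM invrK mulrC.
Qed.

Lemma sin_angle p q x y : 0 < p * x + q * y ->
  sin (angle p q x y) = (p * y - q * x) / (Num.sqrt (p ^+ 2 + q ^+ 2) * Num.sqrt (x ^+ 2 + y ^+ 2)).
Proof.
move=> h; have c0 : cos (angle p q x y) != 0.
  by rewrite lt0r_neq0// cos_gt0_pihalf// /angle atan_gtNpi2 atan_ltpi2.
have := atanK ((p * y - q * x) / (p * x + q * y)); rewrite /tan -/(angle p q x y).
move/(congr1 (fun u => u * cos (angle p q x y))); rewrite divfK// => ->.
by rewrite cos_angle// mulrA divfK// lt0r_neq0.
Qed.

End angle.

Section turns.
Context {R : realType}.
Implicit Types x y p q a b c s : R.

(* [a] is an angle from the unit vector (c, s) to the unit vector (c', s'). *)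
Definition turn a c s c' s' := cos a = c * c' + s * s' /\ sin a = c * s' - s * c'.

Lemma turnD a b c s c' s' c'' s'' : c' ^+ 2 + s' ^+ 2 = 1 ->
  turn a c s c' s' -> turn b c' s' c'' s'' -> turn (a + b) c s c'' s''.
Proof.
move=> h [ca sa] [cb sb]; split.
  rewrite cosD ca sa cb sb.
  transitivity ((c' ^+ 2 + s' ^+ 2) * (c * c'' + s * s'')); [ring|by rewrite h mul1r].
rewrite sinD ca sa cb sb.
transitivity ((c' ^+ 2 + s' ^+ 2) * (c * s'' - s * c'')); [ring|by rewrite h mul1r].
Qed.

Lemma cos_eq1_2pi a : 0 < a < 4 * pi -> cos a = 1 -> a = 2 * pi.
Proof.
move=> /andP[a0 a4]; rewrite {1}(splitr a) -mulr2n cos_mulr2n => h.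
have s0 : sin (a / 2) = 0.
  apply/eqP; rewrite -sqrf_eq0; have := cos2Dsin2 (a / 2); move: h.
  by move: (cos _) (sin _) => u v h1 h2; apply/eqP; lra.
have [h1|h1|h1] := ltgtP (a / 2) pi.
- by have := @sin_gt0_pi R (a / 2); rewrite s0 ltxx h1 divr_gt0// => /(_ isT).
- have := @sin_gt0_pi R (a / 2 - pi); rewrite sinB cospi sinpi s0 mul0r mulr0 subrr ltxx.
  have -> : 0 < a / 2 - pi < pi by lra.
  by move=> /(_ isT).
- lra.
Qed.

(** The composed turn brings the first vector back to itself, so the sum has cosine 1; it lies
    between 0 and [4 * pi], which leaves only [2 * pi]. *)
Lemma turn4 a0 a1 a2 a3 c0 s0 c1 s1 c2 s2 c3 s3 :
  c0 ^+ 2 + s0 ^+ 2 = 1 -> c1 ^+ 2 + s1 ^+ 2 = 1 ->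
  c2 ^+ 2 + s2 ^+ 2 = 1 -> c3 ^+ 2 + s3 ^+ 2 = 1 ->
  turn a0 c0 s0 c1 s1 -> turn a1 c1 s1 c2 s2 -> turn a2 c2 s2 c3 s3 -> turn a3 c3 s3 c0 s0 ->
  0 < a0 < pi -> 0 < a1 < pi -> 0 < a2 < pi -> 0 < a3 < pi ->
  a0 + a1 + a2 + a3 = 2 * pi.
Proof.
move=> n0 n1 n2 n3 t0 t1 t2 t3 b0 b1 b2 b3.
have [h _] := turnD n3 (turnD n2 (turnD n1 t0 t1) t2) t3.
by apply: cos_eq1_2pi; [lra|rewrite h -!expr2].
Qed.

Lemma functional_gt0 p q x y : 0 < p * x + q * y ->
  0 < p ^+ 2 + q ^+ 2 /\ 0 < x ^+ 2 + y ^+ 2.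
Proof.
move=> h; split; rewrite lt_def addr_ge0 ?sqr_ge0// andbT paddr_eq0 ?sqr_ge0// !sqrf_eq0;
  by apply/negP => /andP[/eqP e1 /eqP e2]; move: h; rewrite e1 e2 ?mulr0 ?mul0r addr0 ltxx.
Qed.

Lemma angle_turn p q x y x' y' : 0 < p * x + q * y -> 0 < p * x' + q * y' ->
  turn (angle p q x' y' - angle p q x y)
    (x / Num.sqrt (x ^+ 2 + y ^+ 2)) (y / Num.sqrt (x ^+ 2 + y ^+ 2))
    (x' / Num.sqrt (x' ^+ 2 + y' ^+ 2)) (y' / Num.sqrt (x' ^+ 2 + y' ^+ 2)).
Proof.
move=> h h'; have [n0 m0] := functional_gt0 h; have [_ m0'] := functional_gt0 h'.
rewrite /turn cosB sinB !cos_angle// !sin_angle//.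
have nE := sqr_sqrtr (ltW n0).
have := n0; have := m0; have := m0'; rewrite -(sqrtr_gt0 (p ^+ 2 + _)).
rewrite -(sqrtr_gt0 (x ^+ 2 + _)) -(sqrtr_gt0 (x' ^+ 2 + _)).
move: nE; move: (Num.sqrt (p ^+ 2 + _)) => n nE.
move: (Num.sqrt (x ^+ 2 + _)) (Num.sqrt (x' ^+ 2 + _)) => k l l0 k0 nn0.
have [nn kn ln] : [/\ n != 0, k != 0 & l != 0] by rewrite !gt_eqF.
split.
  transitivity ((p ^+ 2 + q ^+ 2) * (x * x' + y * y') / (n ^+ 2 * (k * l))).
    by field; rewrite nn kn ln.
  by rewrite -nE; field; rewrite nn kn ln.
transitivity ((p ^+ 2 + q ^+ 2) * (x * y' - y * x') / (n ^+ 2 * (k * l))).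
  by field; rewrite nn kn ln.
by rewrite -nE; field; rewrite nn kn ln.
Qed.

Lemma angle_diff_lt_pi p q x y x' y' : - pi < angle p q x' y' - angle p q x y < pi.
Proof.
rewrite /angle; set u := atan _; set v := atan _.
have := atan_gtNpi2 ((p * y' - q * x') / (p * x' + q * y')).
have := atan_ltpi2 ((p * y' - q * x') / (p * x' + q * y')).
have := atan_gtNpi2 ((p * y - q * x) / (p * x + q * y)).
have := atan_ltpi2 ((p * y - q * x) / (p * x + q * y)).
rewrite -/u -/v => h1 h2 h3 h4; lra.
Qed.

Lemma sin_gt0_range a : - pi < a < pi -> 0 < sin a -> 0 < a < pi.
Proof.
move=> /andP[a1 a2] s0; rewrite a2 andbT ltNge; apply/negP => a0.
have : 0 <= sin (- a) by apply: sin_ge0_pi; lra.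
by rewrite sinN oppr_ge0 leNgt s0.
Qed.

Lemma turnN a c s c' s' : turn a c s c' s' -> turn (- a) c (- s) c' (- s').
Proof. by move=> [h1 h2]; rewrite /turn cosN sinN h1 h2; split; ring. Qed.

(** Each difference is the angle between consecutive vectors, measured in the half-plane of one
    linear form, and the sign of the cross product puts [f] times it between 0 and [pi]. For
    [f = -1] the plane is reflected, which reverses the turns, so that [turn4] serves both
    orientations. *)
Lemma angle_turn4 f p0 q0 p1 q1 p2 q2 p3 q3 x0 y0 x1 y1 x2 y2 x3 y3 :
  f ^+ 2 = 1 ->
  0 < p0 * x0 + q0 * y0 -> 0 < p0 * x1 + q0 * y1 ->
  0 < p1 * x1 + q1 * y1 -> 0 < p1 * x2 + q1 * y2 ->
  0 < p2 * x2 + q2 * y2 -> 0 < p2 * x3 + q2 * y3 ->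
  0 < p3 * x3 + q3 * y3 -> 0 < p3 * x0 + q3 * y0 ->
  0 < f * (x0 * y1 - y0 * x1) -> 0 < f * (x1 * y2 - y1 * x2) ->
  0 < f * (x2 * y3 - y2 * x3) -> 0 < f * (x3 * y0 - y3 * x0) ->
  (angle p0 q0 x1 y1 - angle p0 q0 x0 y0) + (angle p1 q1 x2 y2 - angle p1 q1 x1 y1) +
  (angle p2 q2 x3 y3 - angle p2 q2 x2 y2) + (angle p3 q3 x0 y0 - angle p3 q3 x3 y3)
  = f * (2 * pi).
Proof.
move=> f1 h00 h01 h11 h12 h22 h23 h33 h30 c0 c1 c2 c3.
have U x y : 0 < x ^+ 2 + y ^+ 2 ->
    (x / Num.sqrt (x ^+ 2 + y ^+ 2)) ^+ 2 + (y / Num.sqrt (x ^+ 2 + y ^+ 2)) ^+ 2 = 1.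
  by move=> n0; rewrite !expr_div_n sqr_sqrtr ?ltW// -mulrDl divff// gt_eqF.
have u0 := U _ _ (functional_gt0 h00).2; have u1 := U _ _ (functional_gt0 h11).2.
have u2 := U _ _ (functional_gt0 h22).2; have u3 := U _ _ (functional_gt0 h33).2.
have T p q x y x' y' : 0 < p * x + q * y -> 0 < p * x' + q * y' -> 0 < f * (x * y' - y * x') ->
    exists2 a : R, angle p q x' y' - angle p q x y = f * a & 0 < a < pi /\
      turn a (x / Num.sqrt (x ^+ 2 + y ^+ 2)) (f * (y / Num.sqrt (x ^+ 2 + y ^+ 2)))
        (x' / Num.sqrt (x' ^+ 2 + y' ^+ 2)) (f * (y' / Num.sqrt (x' ^+ 2 + y' ^+ 2))).
  move=> h h' c; have t := angle_turn h h'; have b := angle_diff_lt_pi p q x y x' y'.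
  have n0 := (functional_gt0 h).2; have n0' := (functional_gt0 h').2.
  exists (f * (angle p q x' y' - angle p q x y)); first by rewrite mulrA -expr2 f1 mul1r.
  have S : 0 < f * sin (angle p q x' y' - angle p q x y).
    have [_ ->] := t.
    rewrite (_ : f * _ = f * (x * y' - y * x') /
      (Num.sqrt (x ^+ 2 + y ^+ 2) * Num.sqrt (x' ^+ 2 + y' ^+ 2))).
      by rewrite divr_gt0// mulr_gt0// sqrtr_gt0.
    by field; rewrite !gt_eqF// sqrtr_gt0.
  move: (f1) S t b => /eqP; rewrite sqrf_eq1 => /orP[] /eqP->;
    rewrite ?mul1r ?mulN1r ?mul1r => S t b.
    by split=> //; exact: sin_gt0_range.
  split; last exact: turnN.
  by apply: sin_gt0_range; [lra|rewrite sinN].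
have [a0 -> [b0 t0]] := T _ _ _ _ _ _ h00 h01 c0.
have [a1 -> [b1 t1]] := T _ _ _ _ _ _ h11 h12 c1.
have [a2 -> [b2 t2]] := T _ _ _ _ _ _ h22 h23 c2.
have [a3 -> [b3 t3]] := T _ _ _ _ _ _ h33 h30 c3.
have F x y : x ^+ 2 + y ^+ 2 = 1 -> x ^+ 2 + (f * y) ^+ 2 = 1.
  by rewrite exprMn f1 mul1r.
by rewrite -(turn4 (F _ _ u0) (F _ _ u1) (F _ _ u2) (F _ _ u3) t0 t1 t2 t3 b0 b1 b2 b3); ring.
Qed.

End turns.

(** * Solid angle over a rectangle *)

(** Coordinates and velocities are separate fields, so that the same space curve can be read in any
    orthonormal frame; [smooth] ties them together in class C^1. *)
Record curve (R : realType) := Curve {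
  cx : R -> R; cy : R -> R; cz : R -> R;
  vx : R -> R; vy : R -> R; vz : R -> R }.

Definition smooth (R : realType) (g : curve R) :=
  [/\ forall t : R, is_derive t 1 (cx g) (vx g t), forall t : R, is_derive t 1 (cy g) (vy g t),
      forall t : R, is_derive t 1 (cz g) (vz g t) &
      [/\ continuous (vx g), continuous (vy g) & continuous (vz g)]].

Definition periodic_curve (R : realType) (L : R) (g : curve R) :=
  [/\ forall t : R, cx g (t + L) = cx g t, forall t : R, cy g (t + L) = cy g t &
      forall t : R, cz g (t + L) = cz g t] /\
  [/\ forall t : R, vx g (t + L) = vx g t, forall t : R, vy g (t + L) = vy g t &
      forall t : R, vz g (t + L) = vz g t].

Section pair_of_curves.
Context {R : realType} (g d : curve R).
Context (sg : smooth g) (sd : smooth d).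
Implicit Types (s t a b c e : R) (k m : R -> R -> R -> R).

Definition rx s t := cx g s - cx d t.
Definition ry s t := cy g s - cy d t.
Definition rz s t := cz g s - cz d t.

Definition solid s t := (rx s t * (vy g s * vz d t - vz g s * vy d t)
  - ry s t * (vx g s * vz d t - vz g s * vx d t)
  + rz s t * (vx g s * vy d t - vy g s * vx d t)) / rho (rx s t) (ry s t) (rz s t) ^+ 3.

(* Components of k (x dy - y dx) along dt and ds. *)
Definition form_t k s t := k (rx s t) (ry s t) (rz s t) * (ry s t * vx d t - rx s t * vy d t).
Definition form_s k s t := k (rx s t) (ry s t) (rz s t) * (rx s t * vy g s - ry s t * vx g s).

(** The integral of the form along the border of the rectangle, counterclockwise in the plane of
    [(s, t)]. *)
Definition circulation k a b c e :=
  integ c e (form_t k b) - integ c e (form_t k a)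
  - (integ a b (form_s k ^~ e) - integ a b (form_s k ^~ c)).

Lemma cont_curves s t :
  [/\ continuous2_at rx s t, continuous2_at ry s t, continuous2_at rz s t &
   [/\ continuous2_at (fun s _ => vx g s) s t, continuous2_at (fun s _ => vy g s) s t &
       continuous2_at (fun s _ => vz g s) s t] /\
   [/\ continuous2_at (fun _ t => vx d t) s t, continuous2_at (fun _ t => vy d t) s t &
       continuous2_at (fun _ t => vz d t) s t]].
Proof.
have [x1 y1 z1 [a1 b1 c1]] := sg; have [x2 y2 z2 [a2 b2 c2]] := sd.
have cS (f h : R -> R) (l1 l2 : R) : is_derive s 1 f l1 -> is_derive t 1 h l2 ->
    continuous2_at (fun s t => f s - h t) s t.
  move=> /derive_continuous cf /derive_continuous ch.
  apply: (@contA R (R * R)%type (fun p => f p.1) (fun p => - h p.2)).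
    exact: (@cont_comp_fst _ _ _ f (s, t)).
  apply: contN; exact: (@cont_comp_snd _ _ _ h (s, t)).
split.
- exact: cS (x1 s) (x2 t).
- exact: cS (y1 s) (y2 t).
- exact: cS (z1 s) (z2 t).
split; split.
- exact: (@cont_comp_fst _ _ _ (vx g) (s, t) (a1 s)).
- exact: (@cont_comp_fst _ _ _ (vy g) (s, t) (b1 s)).
- exact: (@cont_comp_fst _ _ _ (vz g) (s, t) (c1 s)).
- exact: (@cont_comp_snd _ _ _ (vx d) (s, t) (a2 t)).
- exact: (@cont_comp_snd _ _ _ (vy d) (s, t) (b2 t)).
- exact: (@cont_comp_snd _ _ _ (vz d) (s, t) (c2 t)).
Qed.

(** Green's formula for the pullback of the potential by [r = g - d]. The exterior derivative of the
    potential is minus the solid angle form; this sign is cancelled by the minus sign of [d] in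
    [r]. *)
Lemma rect_potential k m a b c e : a <= b -> c <= e ->
  (forall s t, a <= s <= b -> c <= t <= e ->
     0 < rho (rx s t) (ry s t) (rz s t) /\ potential k m (rx s t) (ry s t) (rz s t)) ->
  integ a b (fun s => integ c e (solid s)) = circulation k a b c e.
Proof.
move=> ab ce H.
have [x1 y1 z1 _] := sg; have [x2 y2 z2 _] := sd.
pose r3 s t := rho (rx s t) (ry s t) (rz s t) ^+ 3.
pose M s t := m (rx s t) (ry s t) (rz s t).
pose K s t := k (rx s t) (ry s t) (rz s t).
pose Ks s t := M s t * (rx s t * vx g s + ry s t * vy g s) + vz g s / r3 s t.
pose Kt s t := M s t * (rx s t * - vx d t + ry s t * - vy d t) + - vz d t / r3 s t.
pose Ps s t := Ks s t * (ry s t * vx d t - rx s t * vy d t) +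
               K s t * (vy g s * vx d t - vx g s * vy d t).
pose Qt s t := Kt s t * (rx s t * vy g s - ry s t * vx g s) +
               K s t * (- vx d t * vy g s - - vy d t * vx g s).
have dl (f h : R -> R) s t (l : R) : is_derive s 1 f l -> is_derive s 1 (fun s => f s - h t) l.
  by move=> df; apply: is_derive_eq (deriveS df (deriveC _ _)) (subr0 _).
have dr (f h : R -> R) s t (l : R) : is_derive t 1 h l -> is_derive t 1 (fun t => f s - h t) (- l).
  by move=> df; apply: is_derive_eq (deriveS (deriveC _ _) df) (sub0r _).
have C s t : a <= s <= b -> c <= t <= e -> [/\ continuous2_at K s t, continuous2_at Ps s t &
    continuous2_at Qt s t].
  move=> sab tce; have [r0 [_ _ cp]] := H _ _ sab tce.
  have [cX cY cZ [[w1 w2 w3] [w4 w5 w6]]] := cont_curves s t.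
  have [cK0 cM0] := cp (R * R)%type _ _ _ (s, t) erefl erefl erefl cX cY cZ.
  have cK : continuous2_at K s t := cK0.
  have cM : continuous2_at M s t := cM0.
  have cr3 : continuous2_at r3 s t.
    by apply: (@contX _ _ (fun p : R * R => rho (rx p.1 p.2) (ry p.1 p.2) (rz p.1 p.2))); exact: cont_rho.
  have r30 : r3 s t != 0 by rewrite expf_neq0// gt_eqF.
  rewrite /continuous2_at in cK cM cX cY cZ cr3 *; rewrite /Ps /Qt /Ks /Kt.
  clear -cX cY w1 w2 w3 w4 w5 w6 cK cM cr3 r30; clearbody K M r3.
  by split; cont.
transitivity (integ a b (fun s => integ c e (fun t => Ps s t - Qt s t))).
  apply: eq_int => s sab; apply: eq_int => t tce.
  have [r0 [E _ _]] := H _ _ sab tce.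
  have E2 : (rx s t ^+ 2 + ry s t ^+ 2) * M s t = - rz s t / r3 s t - 2 * K s t.
    by rewrite -E addrK.
  rewrite /solid -/(r3 s t) /Ps /Qt /Ks /Kt.
  transitivity ((rx s t * (vy g s * vz d t - vz g s * vy d t)
    - ry s t * (vx g s * vz d t - vz g s * vx d t)) / r3 s t
    - ((rx s t ^+ 2 + ry s t ^+ 2) * M s t + 2 * K s t) * (vx g s * vy d t - vy g s * vx d t)).
    by rewrite E2; ring.
  by ring.
apply: (@green _ (form_t k) (form_s k) Ps Qt) => //.
- move=> s t sab tce; have [r0 [_ dk _]] := H _ _ sab tce.
  have dX := dl _ (cx d) s t _ (x1 s); have dY := dl _ (cy d) s t _ (y1 s).
  have dK := dk _ _ _ s _ _ _ erefl erefl erefl dX dY (dl _ (cz d) s t _ (z1 s)).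
  apply: is_derive_eq (deriveP dK (deriveS (deriveP dY (deriveC (vx d t) s))
    (deriveP dX (deriveC (vy d t) s)))) _.
  by rewrite /Ps /Ks /K -/(rx s t) -/(ry s t) -/(rz s t) -/(M s t) -/(r3 s t); ring.
- move=> s t sab tce; have [r0 [_ dk _]] := H _ _ sab tce.
  have dX := dr (cx g) _ s t _ (x2 t); have dY := dr (cy g) _ s t _ (y2 t).
  have dK := dk _ _ _ t _ _ _ erefl erefl erefl dX dY (dr (cz g) _ s t _ (z2 t)).
  apply: is_derive_eq (deriveP dK (deriveS (deriveP dX (deriveC (vy g s) t))
    (deriveP dY (deriveC (vx g s) t)))) _.
  by rewrite /Qt /Kt /K -/(rx s t) -/(ry s t) -/(rz s t) -/(M s t) -/(r3 s t); ring.
- move=> s t sab tce; have [cK _ _] := C _ _ sab tce.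
  have [? ? ? [[? ? ?] [? ? ?]]] := cont_curves s t.
  by rewrite /continuous2_at /form_t in cK *; cont.
- move=> s t sab tce; have [cK _ _] := C _ _ sab tce.
  have [? ? ? [[? ? ?] [? ? ?]]] := cont_curves s t.
  by rewrite /continuous2_at /form_s in cK *; cont.
- by move=> s t sab tce; have [] := C _ _ sab tce.
- by move=> s t sab tce; have [] := C _ _ sab tce.
Qed.

Context (r_gt0 : forall s t, 0 < rho (rx s t) (ry s t) (rz s t)).

Definition planar s t := rx s t ^+ 2 + ry s t ^+ 2.

Definition k_angle (x y z : R) := (x ^+ 2 + y ^+ 2)^-1.

(** What [k_mid] fails to account for on a rectangle. It is additive under subdivision and vanishes
    on rectangles without zeros of the planar part of [r], hence is concentrated at those zeros. *)
Definition defect a b c e :=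
  integ a b (fun s => integ c e (solid s)) - circulation (@k_mid R) a b c e.

Lemma planar_ge0 s t : 0 <= planar s t.
Proof. by rewrite addr_ge0 ?sqr_ge0. Qed.

Lemma planar_gt0 s t : (0 < planar s t) = (planar s t != 0).
Proof. by rewrite lt_def planar_ge0 andbT. Qed.

Lemma cont_form k s t : continuous2_at (fun s t => k (rx s t) (ry s t) (rz s t)) s t ->
  continuous2_at (form_t k) s t /\ continuous2_at (form_s k) s t.
Proof.
move=> cK; have [? ? ? [[? ? ?] [? ? ?]]] := cont_curves s t.
by rewrite /continuous2_at /form_t /form_s in cK *; split; cont.
Qed.

Lemma cont_k_mid s t : 0 < planar s t ->
  continuous2_at (form_t (@k_mid R)) s t /\ continuous2_at (form_s (@k_mid R)) s t.
Proof.
move=> q0; apply: cont_form; have [_ _ cp] := potential_mid (rz s t) q0.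
have [cX cY cZ _] := cont_curves s t.
by have [] := cp (R * R)%type _ _ _ (s, t) erefl erefl erefl cX cY cZ.
Qed.

Lemma cont_k_angle s t : 0 < planar s t ->
  continuous2_at (form_t k_angle) s t /\ continuous2_at (form_s k_angle) s t.
Proof.
rewrite planar_gt0 => q0; apply: cont_form.
have [cX cY _ _] := cont_curves s t.
by rewrite /continuous2_at /k_angle in cX cY *; cont.
Qed.

Lemma cont_k_pole f s t : f ^+ 2 = 1 ->
  0 < rho (rx s t) (ry s t) (rz s t) + f * rz s t ->
  continuous2_at (form_t (k_pole f)) s t /\ continuous2_at (form_s (k_pole f)) s t.
Proof.
move=> f1 q0; apply: cont_form; have [_ _ cp] := potential_pole f1 (r_gt0 s t) q0.
have [cX cY cZ _] := cont_curves s t.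
by have [] := cp (R * R)%type _ _ _ (s, t) erefl erefl erefl cX cY cZ.
Qed.

Lemma cont_solid : continuous (fun p : R * R => solid p.1 p.2).
Proof.
move=> [s t]; have [cX cY cZ [[? ? ?] [? ? ?]]] := cont_curves s t.
have r0 := r_gt0 s t; have r0' : rho (rx s t) (ry s t) (rz s t) ^+ 3 != 0.
  by rewrite expf_neq0// gt_eqF.
have cr : {for (s, t), continuous (fun p : R * R => rho (rx p.1 p.2) (ry p.1 p.2) (rz p.1 p.2))}.
  exact: cont_rho.
by rewrite /continuous2_at /solid in cX cY cZ *; cont.
Qed.

(** Off the axis [|z| < rho] already gives positivity; only on the axis does the sign of [z]
    matter. *)
Lemma pole_gt0 f s t : f ^+ 2 = 1 -> (planar s t = 0 -> 0 < f * rz s t) ->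
  0 < rho (rx s t) (ry s t) (rz s t) + f * rz s t.
Proof.
move=> f1 h; have r0 := r_gt0 s t; have [/h q0|q0] := eqVneq (planar s t) 0.
  exact: addr_gt0.
have rE := sqr_rho (rx s t) (ry s t) (rz s t).
have {}q0 : 0 < rx s t ^+ 2 + ry s t ^+ 2 by rewrite planar_gt0.
have : (f * rz s t) ^+ 2 < rho (rx s t) (ry s t) (rz s t) ^+ 2.
  by rewrite rE exprMn f1 mul1r ltrDr.
move: (rho _ _ _) r0 => r r0; move: (f * _) => u ur.
by rewrite ltNge; apply/negP => ru; nra.
Qed.

Lemma defect_free a b c e : a <= b -> c <= e ->
  (forall s t, a <= s <= b -> c <= t <= e -> planar s t != 0) -> defect a b c e = 0.
Proof.
move=> ab ce H; rewrite /defect (@rect_potential (@k_mid R) (@m_mid R))// ?subrr// => s t hs ht.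
by split=> //; apply: potential_mid; rewrite -/(planar s t) planar_gt0 H.
Qed.

Definition on_border a b c e s t :=
  a <= s <= b /\ c <= t <= e /\ [\/ s = a, s = b, t = c | t = e].

Lemma circulation_pole f a b c e : a <= b -> c <= e -> f ^+ 2 = 1 ->
  (forall s t, on_border a b c e s t -> planar s t != 0) ->
  circulation (@k_mid R) a b c e = circulation (k_pole f) a b c e + f * circulation k_angle a b c e.
Proof.
move=> ab ce f1 H.
have K s t : planar s t != 0 -> k_mid (rx s t) (ry s t) (rz s t) =
    k_pole f (rx s t) (ry s t) (rz s t) + f * k_angle (rx s t) (ry s t) (rz s t).
  move=> q0; have p0 : 0 < rho (rx s t) (ry s t) (rz s t) + f * rz s t.
    by apply: pole_gt0 => // /eqP; rewrite (negbTE q0).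
  have r0 := r_gt0 s t; rewrite /k_mid /k_pole /k_angle; move: q0 p0 r0.
  have := sqr_rho (rx s t) (ry s t) (rz s t); rewrite /planar.
  move: (rho _ _ _) => r rE q0 p0 r0.
  have qE : rx s t ^+ 2 + ry s t ^+ 2 = r ^+ 2 - rz s t ^+ 2 by rewrite rE; ring.
  rewrite qE in q0 *; move: p0.
  move: f1 => /eqP; rewrite sqrf_eq1 => /orP[] /eqP->; rewrite ?mul1r ?mulN1r => p0;
    by field; rewrite q0 !gt_eqF.
have P s t : planar s t != 0 ->
    [/\ form_t (@k_mid R) s t = form_t (k_pole f) s t + f * form_t k_angle s t &
        form_s (@k_mid R) s t = form_s (k_pole f) s t + f * form_s k_angle s t].
  by move=> /K E; rewrite /form_t /form_s E; split; ring.
have C s t : planar s t != 0 -> [/\ continuous2_at (form_t (k_pole f)) s t,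
    continuous2_at (form_s (k_pole f)) s t, continuous2_at (form_t k_angle) s t
    & continuous2_at (form_s k_angle) s t].
  move=> q0; have [] := cont_k_angle (s := s) (t := t); first by rewrite planar_gt0.
  have [] := @cont_k_pole f s t f1; last by [].
  by apply: pole_gt0 => // /eqP; rewrite (negbTE q0).
have It s : (forall t, c <= t <= e -> planar s t != 0) -> integ c e (form_t (@k_mid R) s) =
    integ c e (form_t (k_pole f) s) + f * integ c e (form_t k_angle s).
  move=> h.
  have c1 : continuous_on_segment c e (form_t (k_pole f) s).
    by move=> t /h /C[+ _ _ _]; exact: continuous2_at_r.
  have c2 : continuous_on_segment c e (form_t k_angle s).
    by move=> t /h /C[_ _ + _]; exact: continuous2_at_r.
  rewrite -intZ// -intD//; last by move=> t /c2 ?; cont.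
  by apply: eq_int => t /h /P[].
have Is t : (forall s, a <= s <= b -> planar s t != 0) -> integ a b (form_s (@k_mid R) ^~ t) =
    integ a b (form_s (k_pole f) ^~ t) + f * integ a b (form_s k_angle ^~ t).
  move=> h.
  have c1 : continuous_on_segment a b (form_s (k_pole f) ^~ t).
    by move=> s /h /C[_ + _ _]; exact: (continuous2_at_l (f := form_s (k_pole f))).
  have c2 : continuous_on_segment a b (form_s k_angle ^~ t).
    by move=> s /h /C[_ _ _]; exact: (continuous2_at_l (f := form_s k_angle)).
  rewrite -intZ// -intD//; last by move=> s /c2 ?; cont.
  by apply: eq_int => s /h /P[].
rewrite /circulation !It ?Is; first by ring.
- by move=> s hs; apply: H; rewrite /on_border ce !lexx; split=> //; split=> //; constructor 3.
- by move=> s hs; apply: H; rewrite /on_border ce !lexx; split=> //; split=> //; constructor 4.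
- by move=> t ht; apply: H; rewrite /on_border ab !lexx; split=> //; split=> //; constructor 1.
- by move=> t ht; apply: H; rewrite /on_border ab !lexx; split=> //; split=> //; constructor 2.
Qed.

(** If [z] has the sign [f] at every zero inside, then [k_pole f] is a potential on the whole box,
    while on the border it differs from [k_mid] by [f * dtheta]. What remains is the winding number
    of the planar part along the border, whatever the number and the nature of the zeros inside. *)
Lemma defect_box f a b c e : a <= b -> c <= e -> f ^+ 2 = 1 ->
  (forall s t, on_border a b c e s t -> planar s t != 0) ->
  (forall s t, a <= s <= b -> c <= t <= e -> planar s t = 0 -> 0 < f * rz s t) ->
  defect a b c e = - f * circulation k_angle a b c e.
Proof.
move=> ab ce f1 H1 H2; rewrite /defect (@rect_potential (k_pole f) (m_pole f))//.
  by rewrite (circulation_pole ab ce f1 H1); ring.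
move=> s t hs ht; split=> //; apply: potential_pole => //; apply: pole_gt0 => //.
exact: H2.
Qed.

(** The integral along the cut [s = b] is the same term on both sides and cancels; continuity of the
    form is required on the two edges that the cut divides. *)
Lemma defect_split_s a b c e f : a <= b -> b <= c -> e <= f ->
  (forall s, a <= s <= c -> planar s e != 0 /\ planar s f != 0) ->
  defect a c e f = defect a b e f + defect b c e f.
Proof.
move=> ab bc ef H; rewrite /defect /circulation (int_split ab bc); last first.
  by move=> s _; apply: (int_continuous (f := solid) ef cont_solid).
rewrite (int_split (f := form_s (@k_mid R) ^~ f) ab bc); last first.
  move=> s /H[_ h]; apply: (continuous2_at_l (f := form_s (@k_mid R))).
  by have [] := @cont_k_mid s f; rewrite ?planar_gt0.
rewrite (int_split (f := form_s (@k_mid R) ^~ e) ab bc); first by ring.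
move=> s /H[h _]; apply: (continuous2_at_l (f := form_s (@k_mid R))).
by have [] := @cont_k_mid s e; rewrite ?planar_gt0.
Qed.

Lemma defect_split_t a b c e f : a <= b -> c <= e -> e <= f ->
  (forall t, c <= t <= f -> planar a t != 0 /\ planar b t != 0) ->
  defect a b c f = defect a b c e + defect a b e f.
Proof.
move=> ab ce ef H.
have cs s : continuous (solid s) by apply: continuous_pairr; exact: cont_solid.
have -> : defect a b c f = integ a b (fun s => integ c e (solid s)) +
    integ a b (fun s => integ e f (solid s)) - circulation (@k_mid R) a b c f.
  have c1 : continuous_on_segment a b (fun s => integ c e (solid s)).
    by move=> s _; apply: (int_continuous (f := solid) ce cont_solid).
  have c2 : continuous_on_segment a b (fun s => integ e f (solid s)).
    by move=> s _; apply: (int_continuous (f := solid) ef cont_solid).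
  rewrite /defect; congr (_ - _); apply: etrans (intD ab c1 c2).
  by apply: eq_int => s _; apply: int_split => // t _; exact: cs.
have Eb : integ c f (form_t (@k_mid R) b) = integ c e (form_t (@k_mid R) b) + integ e f (form_t (@k_mid R) b).
  apply: int_split => // t /H[_ h]; apply: continuous2_at_r.
  by have [] := @cont_k_mid b t; rewrite ?planar_gt0.
have Ea : integ c f (form_t (@k_mid R) a) = integ c e (form_t (@k_mid R) a) + integ e f (form_t (@k_mid R) a).
  apply: int_split => // t /H[h _]; apply: continuous2_at_r.
  by have [] := @cont_k_mid a t; rewrite ?planar_gt0.
rewrite /defect /circulation Eb Ea.
have ring_id (i1 i2 b1 b2 a1 a2 s1 s2 s3 : R) :
  i1 + i2 - (b1 + b2 - (a1 + a2) - (s1 - s2)) =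
  i1 - (b1 - a1 - (s3 - s2)) + (i2 - (b2 - a2 - (s1 - s3))) by ring.
exact: ring_id.
Qed.

Lemma integ_form_t p q s t0 t1 : t0 <= t1 ->
  (forall t, t0 <= t <= t1 -> 0 < p * rx s t + q * ry s t) ->
  integ t0 t1 (form_t k_angle s) = angle p q (rx s t1) (ry s t1) - angle p q (rx s t0) (ry s t0).
Proof.
move=> tt H; have [x2 y2 _ [cx2 cy2 _]] := sd.
have dr (h f : R -> R) t (l : R) : is_derive t 1 h l -> is_derive t 1 (fun t => f s - h t) (- l).
  by move=> df; apply: is_derive_eq (deriveS (deriveC _ _) df) (sub0r _).
have dX t (_ : t0 <= t <= t1) := dr _ (cx g) t _ (x2 t).
have dY t (_ : t0 <= t <= t1) := dr _ (cy g) t _ (y2 t).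
have cX t (_ : t0 <= t <= t1) := contN (cx2 t).
have cY t (_ : t0 <= t <= t1) := contN (cy2 t).
apply: etrans (integ_angle tt dX dY cX cY H).
by apply: eq_int => t _; rewrite /form_t /k_angle /rx /ry; congr (_ * _); ring.
Qed.

Lemma integ_form_s p q t s0 s1 : s0 <= s1 ->
  (forall s, s0 <= s <= s1 -> 0 < p * rx s t + q * ry s t) ->
  integ s0 s1 (form_s k_angle ^~ t) = angle p q (rx s1 t) (ry s1 t) - angle p q (rx s0 t) (ry s0 t).
Proof.
move=> ss H; have [x1 y1 _ [cx1 cy1 _]] := sg.
have dl (f h : R -> R) s (l : R) : is_derive s 1 f l -> is_derive s 1 (fun s => f s - h t) l.
  by move=> df; apply: is_derive_eq (deriveS df (deriveC _ _)) (subr0 _).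
have dX s (_ : s0 <= s <= s1) := dl _ (cx d) s _ (x1 s).
have dY s (_ : s0 <= s <= s1) := dl _ (cy d) s _ (y1 s).
have cX s (_ : s0 <= s <= s1) := cx1 s.
have cY s (_ : s0 <= s <= s1) := cy1 s.
exact: (integ_angle ss dX dY cX cY H).
Qed.

(* The border is cut into four arcs, at one point of each edge, on which the
   linear forms A, B, -A and -B are positive, in this order. *)
Lemma circulation_box (f A1 A2 B1 B2 a b c e m1 m2 m3 m4 : R) :
  a <= m1 <= b -> c <= m2 <= e -> a <= m3 <= b -> c <= m4 <= e ->
  f ^+ 2 = 1 -> 0 < f * (A1 * B2 - A2 * B1) ->
  (forall s, m1 <= s <= b -> 0 < A1 * rx s c + A2 * ry s c) ->
  (forall t, c <= t <= m2 -> 0 < A1 * rx b t + A2 * ry b t) ->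
  (forall t, m2 <= t <= e -> 0 < B1 * rx b t + B2 * ry b t) ->
  (forall s, m3 <= s <= b -> 0 < B1 * rx s e + B2 * ry s e) ->
  (forall s, a <= s <= m3 -> A1 * rx s e + A2 * ry s e < 0) ->
  (forall t, m4 <= t <= e -> A1 * rx a t + A2 * ry a t < 0) ->
  (forall t, c <= t <= m4 -> B1 * rx a t + B2 * ry a t < 0) ->
  (forall s, a <= s <= m1 -> B1 * rx s c + B2 * ry s c < 0) ->
  circulation k_angle a b c e = f * (2 * pi).
Proof.
move=> /andP[am1 m1b] /andP[cm2 m2e] /andP[am3 m3b] /andP[cm4 m4e] f1 D.
move=> h1 h2 h3 h4 h5' h6' h7' h8'.
have neg (u v x y : R) : u * x + v * y < 0 -> 0 < - u * x + - v * y.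
  by move=> h; rewrite !mulNr -opprD oppr_gt0.
have h5 s (h : a <= s <= m3) := neg _ _ _ _ (h5' s h).
have h6 t (h : m4 <= t <= e) := neg _ _ _ _ (h6' t h).
have h7 t (h : c <= t <= m4) := neg _ _ _ _ (h7' t h).
have h8 s (h : a <= s <= m1) := neg _ _ _ _ (h8' s h).
have P (u v s t : R) : 0 < u * rx s t + v * ry s t -> 0 < planar s t.
  by move=> /functional_gt0[].
have ct s t0 t1 : (forall t, t0 <= t <= t1 -> 0 < planar s t) ->
    continuous_on_segment t0 t1 (form_t k_angle s).
  by move=> h t /h /cont_k_angle[+ _]; exact: continuous2_at_r.
have cs t s0 s1 : (forall s, s0 <= s <= s1 -> 0 < planar s t) ->
    continuous_on_segment s0 s1 (form_s k_angle ^~ t).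
  by move=> h s /h /cont_k_angle[_]; exact: (continuous2_at_l (f := form_s k_angle)).
have split_t s (m : R) : c <= m -> m <= e -> (forall t, c <= t <= m -> 0 < planar s t) ->
    (forall t, m <= t <= e -> 0 < planar s t) ->
    integ c e (form_t k_angle s) = integ c m (form_t k_angle s) + integ m e (form_t k_angle s).
  move=> cm me q1 q2; apply: int_split => //; apply: ct => t /andP[t1 t2].
  by have [tm|mt] := leP t m; [apply: q1|apply: q2]; rewrite ?t1 ?t2 ?(ltW mt).
have split_s t (m : R) : a <= m -> m <= b -> (forall s, a <= s <= m -> 0 < planar s t) ->
    (forall s, m <= s <= b -> 0 < planar s t) ->
    integ a b (form_s k_angle ^~ t) = integ a m (form_s k_angle ^~ t) + integ m b (form_s k_angle ^~ t).
  move=> cm me q1 q2; apply: int_split => //; apply: cs => s /andP[t1 t2].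
  by have [tm|mt] := leP s m; [apply: q1|apply: q2]; rewrite ?t1 ?t2 ?(ltW mt).
have Eb : integ c e (form_t k_angle b) = integ c m2 (form_t k_angle b) + integ m2 e (form_t k_angle b).
  by apply: split_t => // t ht; [apply: P (h2 _ ht)|apply: P (h3 _ ht)].
have Ea : integ c e (form_t k_angle a) = integ c m4 (form_t k_angle a) + integ m4 e (form_t k_angle a).
  by apply: split_t => // t ht; [apply: P (h7 _ ht)|apply: P (h6 _ ht)].
have Ec : integ a b (form_s k_angle ^~ c) =
    integ a m1 (form_s k_angle ^~ c) + integ m1 b (form_s k_angle ^~ c).
  by apply: split_s => // s hs; [apply: P (h8 _ hs)|apply: P (h1 _ hs)].
have Ee : integ a b (form_s k_angle ^~ e) =
    integ a m3 (form_s k_angle ^~ e) + integ m3 b (form_s k_angle ^~ e).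
  by apply: split_s => // s hs; [apply: P (h5 _ hs)|apply: P (h4 _ hs)].
rewrite /circulation Eb Ea Ec Ee.
rewrite (integ_form_t cm2 h2) (integ_form_t m2e h3) (integ_form_t cm4 h7) (integ_form_t m4e h6).
rewrite (integ_form_s am1 h8) (integ_form_s m1b h1) (integ_form_s am3 h5) (integ_form_s m3b h4).
have i1 : m1 <= m1 <= b by rewrite lexx.
have i2 : m2 <= m2 <= e by rewrite lexx.
have i2' : c <= m2 <= m2 by rewrite lexx cm2.
have i3 : m3 <= m3 <= b by rewrite lexx.
have i3' : a <= m3 <= m3 by rewrite lexx am3.
have i4 : m4 <= m4 <= e by rewrite lexx.
have i4' : c <= m4 <= m4 by rewrite lexx cm4.
have i1' : a <= m1 <= m1 by rewrite lexx am1.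
(* The linear map [(A, B)] multiplies cross products by [A1 * B2 - A2 * B1], whose sign is [f]. The
   orientation of consecutive corner vectors is thus read off the signs of the two forms. *)
have X (x y x' y' : R) :
    0 < (A1 * x + A2 * y) * (B1 * x' + B2 * y') - (B1 * x + B2 * y) * (A1 * x' + A2 * y') ->
    0 < f * (x * y' - y * x').
  move=> h; rewrite -(pmulr_rgt0 _ D).
  have -> : f * (A1 * B2 - A2 * B1) * (f * (x * y' - y * x')) =
      f ^+ 2 * ((A1 * x + A2 * y) * (B1 * x' + B2 * y') - (B1 * x + B2 * y) * (A1 * x' + A2 * y')).
    by ring.
  by rewrite f1 mul1r.
have := @angle_turn4 R f A1 A2 B1 B2 (- A1) (- A2) (- B1) (- B2)
  (rx m1 c) (ry m1 c) (rx b m2) (ry b m2) (rx m3 e) (ry m3 e) (rx a m4) (ry a m4) f1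
  (h1 _ i1) (h2 _ i2') (h3 _ i2) (h4 _ i3) (h5 _ i3') (h6 _ i4) (h7 _ i4') (h8 _ i1').
have j1 := h1 _ i1; have j2 := h2 _ i2'; have j3 := h3 _ i2; have j4 := h4 _ i3.
have j5 := h5' _ i3'; have j6 := h6' _ i4; have j7 := h7' _ i4'; have j8 := h8' _ i1'.
have Y (u v u' v' : R) : 0 < u * v' -> v * u' < 0 -> 0 < u * v' - v * u'.
  by move=> u1 u2; rewrite subr_gt0 (lt_trans u2).
have C0 : 0 < f * (rx m1 c * ry b m2 - ry m1 c * rx b m2).
  by apply: X; apply: Y; [exact: mulr_gt0|rewrite nmulr_rlt0].
have C1 : 0 < f * (rx b m2 * ry m3 e - ry b m2 * rx m3 e).
  by apply: X; apply: Y; [exact: mulr_gt0|rewrite pmulr_rlt0].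
have C2 : 0 < f * (rx m3 e * ry a m4 - ry m3 e * rx a m4).
  by apply: X; apply: Y; [rewrite nmulr_rgt0|rewrite pmulr_rlt0].
have C3 : 0 < f * (rx a m4 * ry m1 c - ry a m4 * rx m1 c).
  by apply: X; apply: Y; [rewrite nmulr_rgt0|rewrite nmulr_rlt0].
move=> /(_ C0 C1 C2 C3) <-.
have ring_id (u0 u1 u2 u3 u4 u5 u6 u7 v0 v1 v2 v3 : R) :
  u0 - u1 + (u2 - u3) - (u4 - u5 + (u6 - u7)) - (v0 - u6 + (u2 - v1) - (v2 - u5 + (u1 - v3)))
  = u0 - v3 + (v1 - u3) + (u7 - v0) + (v2 - u4) by ring.
exact: ring_id.
Qed.

End pair_of_curves.

(** * The degree formula *)

Lemma pairwise_neq (T : eqType) (r : rel T) (s : seq T) x y : pairwise r s ->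
  x \in s -> y \in s -> x != y -> r x y \/ r y x.
Proof.
move=> /(pairwiseP x) h xs ys xy; rewrite -(nth_index x xs) -(nth_index x ys).
have [ij|ij|ij] := ltngtP (index x s) (index y s).
- by left; apply: h; rewrite ?inE ?index_mem.
- by right; apply: h; rewrite ?inE ?index_mem.
- by move: xy; rewrite -(nth_index x xs) ij nth_index// eqxx.
Qed.

Section cuts.
Context {R : realType}.
Implicit Types (x y z a b c E del : R) (S : seq R).

Definition apart del c c' := c + del < c' - del.

Lemma path_apart del a S : 0 < del -> path (apart del) a S ->
  forall x, x \in S -> apart del a x.
Proof.
move=> d0 h x xS.
have tr : transitive (apart del) by move=> u v w; rewrite /apart; lra.
by move: h => /(order_path_min tr) /allP; exact.
Qed.

(** The interval runs from [a - del] to [E - del], so each cut lies inside a piece of radius [del];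
    the gaps between these pieces contribute 0. In the induction [a :: S] shrinks while [S0] stays
    the full list of cuts: gaps must avoid those already passed too. *)
Lemma cut_sum (mu : R -> R -> R) del E a S S0 : 0 < del ->
  path (apart del) a (rcons S E) ->
  (forall x, x \in S0 -> x <= a \/ x \in S) ->
  (forall x y z, a - del <= x -> x <= y -> y <= z -> z <= E - del ->
     mu x z = mu x y + mu y z) ->
  (forall x y, a - del <= x -> x <= y -> y <= E - del ->
     (forall c, c \in S0 -> c + del <= x \/ y <= c - del) -> mu x y = 0) ->
  mu (a - del) (E - del) = \sum_(c <- a :: S) mu (c - del) (c + del).
Proof.
move=> d0; elim: S a => [|b S IH] a /=.
  rewrite andbT /apart => aE hS0 add gap; rewrite big_seq1.
  rewrite (add _ (a + del)); [|lra..].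
  rewrite (gap (a + del)) ?addr0//; [lra..|].
  by move=> c /hS0[ca|//]; left; lra.
move=> /andP[ab h] hS0 add gap; rewrite big_cons -IH//.
- have bE : apart del b E by apply: (path_apart d0 h); rewrite mem_rcons mem_head.
  rewrite /apart in ab bE.
  rewrite (add _ (a + del)); [|lra..].
  rewrite (add (a + del) (b - del)); [|lra..].
  rewrite (gap (a + del) (b - del)) ?add0r//; [lra..|].
  move=> c /hS0[ca|]; first by left; lra.
  rewrite inE => /predU1P[->|cS]; first by right.
  right; have : apart del b c.
    by apply: (path_apart d0 h); rewrite mem_rcons inE cS orbT.
  by rewrite /apart; lra.
- move=> x /hS0[xa|]; first by left; move: ab; rewrite /apart; lra.
  by rewrite inE => /predU1P[->|]; [left|right].
- by move=> x y z h1 h2 h3 h4; apply: add => //; move: ab; rewrite /apart; lra.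
- by move=> x y h1 h2 h3 h4; apply: gap => //; move: ab; rewrite /apart; lra.
Qed.

End cuts.

Section degree.
Context {R : realType} (g d : curve R) (L : R).
Context (sg : smooth g) (sd : smooth d).
Context (pg : periodic_curve L g) (pd : periodic_curve L d) (L0 : 0 < L).
Context (r_gt0 : forall s t, 0 < rho (rx g d s t) (ry g d s t) (rz g d s t)).

Definition total_angle := integ 0 L (fun s => integ 0 L (solid g d s)).

Lemma r_periodic_s s t : [/\ rx g d (s + L) t = rx g d s t, ry g d (s + L) t = ry g d s t &
  rz g d (s + L) t = rz g d s t].
Proof. by have [[h1 h2 h3] _] := pg; rewrite /rx /ry /rz h1 h2 h3. Qed.

Lemma r_periodic_t s t : [/\ rx g d s (t + L) = rx g d s t, ry g d s (t + L) = ry g d s t &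
  rz g d s (t + L) = rz g d s t].
Proof. by have [[h1 h2 h3] _] := pd; rewrite /rx /ry /rz h1 h2 h3. Qed.

Lemma solid_periodic_s s t : solid g d (s + L) t = solid g d s t.
Proof.
have [_ [h1 h2 h3]] := pg; have [e1 e2 e3] := r_periodic_s s t.
by rewrite /solid e1 e2 e3 h1 h2 h3.
Qed.

Lemma solid_periodic_t s t : solid g d s (t + L) = solid g d s t.
Proof.
have [_ [h1 h2 h3]] := pd; have [e1 e2 e3] := r_periodic_t s t.
by rewrite /solid e1 e2 e3 h1 h2 h3.
Qed.

(** With the window from 0 to [L] the boxes around the parameter 0 would be cut in two; periodicity
    moves the window by [del]. *)
Lemma total_angle_shift (del : R) : 0 < del ->
  total_angle = integ (- del) (L - del) (fun s => integ (- del) (L - del) (solid g d s)).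
Proof.
move=> d0; have cs := cont_solid sg sd r_gt0.
have dL : - del <= L - del.
  by have l0 := L0; lra.
have csr s : continuous (solid g d s) by exact: continuous_pairr.
have csl t : continuous (solid g d ^~ t) by exact: continuous_pairl.
have E s : integ 0 L (solid g d s) = integ (- del) (L - del) (solid g d s).
  have := @int_shift R (solid g d s) (- del) 0 L L0 (csr s).
  by rewrite add0r [- del + L]addrC => -> //; [exact: solid_periodic_t|lra].
rewrite /total_angle; transitivity (integ 0 L (fun s => integ (- del) (L - del) (solid g d s))).
  by apply: eq_int => s _; exact: E.
have := @int_shift R (fun s => integ (- del) (L - del) (solid g d s)) (- del) 0 L L0.
rewrite add0r [- del + L]addrC => -> //.
- exact: (int_continuous (f := solid g d) dL cs).
- by move=> s; apply: eq_int => t _; exact: solid_periodic_s.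
- by lra.
Qed.

(** Opposite sides of the shifted window carry the same form by periodicity, so its border has
    circulation 0 and the total angle is the defect of the window. This is cut into strips around
    the parameters [s], then each strip into boxes. [L] ends the list as a sentinel: the last box
    must stay away from the next copy of the first one. *)
Lemma degree_formula (del : R) S W : 0 < del ->
  path (apart del) 0 (rcons S L) ->
  (forall s t, - del <= s <= L - del -> - del <= t <= L - del -> planar g d s t = 0 ->
     exists a b, [/\ a \in 0 :: S, b \in 0 :: S, `|s - a| < del & `|t - b| < del]) ->
  (forall a b, a \in 0 :: S -> b \in 0 :: S ->
     defect g d (a - del) (a + del) (b - del) (b + del) = W a b) ->
  total_angle = \sum_(a <- 0 :: S) \sum_(b <- 0 :: S) W a b.
Proof.
move=> d0 hp hz hW.
have l0 := L0.
have tr : transitive (apart del) by move=> u v w; rewrite /apart; lra.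
have hpw : pairwise (apart del) (rcons (0 :: S) L) by rewrite -sorted_pairwise.
move: (hpw); rewrite pairwise_rcons => /andP[/allP SL Spw].
have S0 x : x \in 0 :: S -> 0 <= x.
  rewrite inE => /predU1P[->//|xS].
  have : apart del 0 x by apply: (path_apart d0 hp); rewrite mem_rcons inE xS orbT.
  by rewrite /apart; lra.
have SS x y := pairwise_neq (x := x) (y := y) Spw.
have far a x : a \in 0 :: S -> x \in 0 :: S -> `|a - del - x| < del \/ `|a + del - x| < del -> False.
  move=> aS xS; have [->|ax] := eqVneq a x.
    by case; rewrite ltr_norml; lra.
  by have [] := SS _ _ aS xS ax; rewrite /apart => h []; rewrite ltr_norml; lra.
have farL x : x \in 0 :: S -> ~ `|L - del - x| < del.
  by move=> /SL; rewrite /apart ltr_norml; lra.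
have far0 x : x \in 0 :: S -> ~ `|- del - x| < del.
  by move=> /S0; rewrite ltr_norml; lra.
have SLt x : x \in 0 :: S -> - del <= x - del /\ x + del <= L - del.
  by move=> xS; have := S0 _ xS; have := SL _ xS; rewrite /apart; lra.
have dL : - del <= L - del by lra.
rewrite (total_angle_shift d0).
have -> : integ (- del) (L - del) (fun s => integ (- del) (L - del) (solid g d s)) =
    defect g d (- del) (L - del) (- del) (L - del).
  rewrite /defect /circulation.
  have -> : form_t g d (@k_mid R) (L - del) = form_t g d (@k_mid R) (- del).
    apply/funext => t; have [e1 e2 e3] := r_periodic_s (- del) t.
    by rewrite /form_t [L - del]addrC e1 e2 e3.
  have -> : (form_s g d (@k_mid R))^~ (L - del) = (form_s g d (@k_mid R))^~ (- del).
    apply/funext => s; have [e1 e2 e3] := r_periodic_t s (- del).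
    by rewrite /form_s [L - del]addrC e1 e2 e3.
  by rewrite !subrr subr0.
have mem0 x : x \in 0 :: S -> x <= 0 \/ x \in S.
  by rewrite inE => /predU1P[->|]; [left|right].
have := @cut_sum R (fun x y => defect g d x y (- del) (L - del)) del L 0 S (0 :: S) d0 hp mem0.
rewrite sub0r => ->.
- rewrite big_seq [RHS]big_seq; apply: eq_bigr => a aS.
  have [a1 a2] := SLt _ aS.
  have aa : a - del <= a + del by lra.
  have := @cut_sum R (fun x y => defect g d (a - del) (a + del) x y) del L 0 S (0 :: S) d0 hp mem0.
  rewrite sub0r => ->.
  + by rewrite big_seq [RHS]big_seq; apply: eq_bigr => b bS; exact: hW.
  + move=> x y z h1 h2 h3 h4; apply: defect_split_t => // t ht.
    have [ht1 ht2] : - del <= t /\ t <= L - del by lra.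
    split; apply/eqP => z0.
      have [||a' [b' [a'S _ h _]]] := hz _ _ _ _ z0; [lra|lra|].
      by apply: (far a a' aS a'S); left.
    have [||a' [b' [a'S _ h _]]] := hz _ _ _ _ z0; [lra|lra|].
    by apply: (far a a' aS a'S); right.
  + move=> x y h1 h2 h3 gap; apply: defect_free => // s t hs ht; apply/eqP => z0.
    have [||a' [b' [_ b'S _]]] := hz _ _ _ _ z0; [lra|lra|].
    by have := gap _ b'S; rewrite ltr_norml; lra.
- move=> x y z h1 h2 h3 h4; apply: defect_split_s => // s hs.
  split; apply/eqP => z0.
    have [||a' [b' [_ b'S _ h]]] := hz _ _ _ _ z0; [lra|lra|].
    exact: (far0 _ b'S h).
  have [||a' [b' [_ b'S _ h]]] := hz _ _ _ _ z0; [lra|lra|].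
  exact: (farL _ b'S h).
- move=> x y h1 h2 h3 gap; apply: defect_free => // s t hs ht; apply/eqP => z0.
  have [||a' [b' [a'S _ + _]]] := hz _ _ _ _ z0; [lra|lra|].
  by have := gap _ a'S; rewrite ltr_norml; lra.
Qed.

End degree.

Lemma near_all (T : eqType) (I : Type) (F : set_system I) (FF : Filter F)
    (P : T -> I -> Prop) (s : seq T) :
  (forall x, x \in s -> \forall i \near F, P x i) ->
  \forall i \near F, forall x, x \in s -> P x i.
Proof.
elim: s => [_|y s IH h]; first by near=> i.
have h1 := h y (mem_head y s).
have h2 : \forall i \near F, forall x, x \in s -> P x i.
  by apply: IH => x xs; apply: h; rewrite inE xs orbT.
by apply: filterS2 h1 h2 => i p q x; rewrite inE => /predU1P[->|/q].
Unshelve. all: by end_near. Qed.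

(** * Defects of small boxes around a point *)

Section local.
Context {R : realType}.
Implicit Types (a b s t del e : R) (g d : curve R).

Lemma near_right_ball (x : R) (P : R -> Prop) : (\forall y \near x, P y) ->
  \forall del \near 0^'+, forall y, `|y - x| <= del -> P y.
Proof.
move=> /nbhs_ballP[r/= r0 h]; near=> del => y yd; apply: h; rewrite /ball/= distrC.
by rewrite (le_lt_trans yd)//; near: del; exact: nbhs_right_lt.
Unshelve. all: by end_near. Qed.

Lemma near_right_ball2 (x y : R) (P : R -> R -> Prop) :
  (\forall p \near (x, y), P p.1 p.2) ->
  \forall del \near 0^'+, forall s t, `|s - x| <= del -> `|t - y| <= del -> P s t.
Proof.
move=> [[U V]/= [Ux Vy] UVP].
have hU := near_right_ball Ux; have hV := near_right_ball Vy.
by apply: filterS2 hU hV => del h1 h2 s t sx ty; apply: (UVP (s, t)); split; [exact: h1|exact: h2].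
Qed.

Lemma path_apart_near a S : path <%R a S ->
  \forall del \near 0^'+, path (apart del) a S.
Proof.
elim: S a => [a _|b S IH a /= /andP[ab /IH h]]; first by near=> del.
have ba : 0 < (b - a) / 2 by rewrite divr_gt0// subr_gt0.
have h2 := nbhs_right_lt ba.
by apply: filterS2 h h2 => del -> hd; rewrite andbT /apart; lra.
Unshelve. all: by end_near. Qed.

Lemma derive_near_right (f : R -> R) a l e : is_derive a 1 f l -> 0 < e ->
  \forall del \near 0^'+, forall s, `|s - a| <= del -> `|f s - f a - l * (s - a)| <= e * del.
Proof.
move=> /is_derive_epsP h e0; have := near_right_ball (h e e0).
apply: filterS => del H s sa; apply: le_trans (H s sa) _.
by rewrite ler_wpM2l// ltW.
Qed.

Definition in_box a b del s t := `|s - a| <= del /\ `|t - b| <= del.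

Lemma in_boxE a b del s t : a - del <= s <= a + del -> b - del <= t <= b + del ->
  in_box a b del s t.
Proof. by rewrite /in_box !ler_distl. Qed.

Section pair.
Context (g d : curve R).
Context (sg : smooth g) (sd : smooth d).
Context (r_gt0 : forall s t, 0 < rho (rx g d s t) (ry g d s t) (rz g d s t)).

(* Near (a, b) the planar projection of r is close to the nondegenerate linear
   map with columns p and q, whose inverse provides the linear forms. *)
Lemma linear_box (p1 p2 q1 q2 eta a b del : R) : 0 < del -> 0 <= eta ->
  p1 * q2 - p2 * q1 != 0 ->
  (`|p1| + `|p2| + `|q1| + `|q2|) * eta < `|p1 * q2 - p2 * q1| ->
  (forall s t, in_box a b del s t ->
     `|rx g d s t - (p1 * (s - a) + q1 * (t - b))| <= eta * del /\
     `|ry g d s t - (p2 * (s - a) + q2 * (t - b))| <= eta * del) ->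
  circulation g d (@k_angle R) (a - del) (a + del) (b - del) (b + del) =
    Num.sg (p1 * q2 - p2 * q1) * (2 * pi) /\
  (forall s t, on_border (a - del) (a + del) (b - del) (b + del) s t -> planar g d s t != 0).
Proof.
set D := _ - _ => d0 eta0 D0 etaD H.
have f1 : Num.sg D ^+ 2 = 1 by rewrite sqr_sg D0.
have fD : Num.sg D * D = `|D| by rewrite normrEsg.
have bound (u v x y : R) : `|u| <= `|p1| + `|p2| + `|q1| + `|q2| - `|v| ->
    `|x| <= eta * del -> `|y| <= eta * del -> `|u * x + v * y| < `|D| * del.
  move=> uv hx hy; apply: le_lt_trans (ler_normD _ _) _; rewrite !normrM.
  have : (`|u| + `|v|) * (eta * del) < `|D| * del.
    rewrite mulrA ltr_pM2r//; apply: le_lt_trans etaD.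
    by rewrite ler_wpM2r// -lerBrDr.
  apply: le_lt_trans; rewrite mulrDl.
  by apply: lerD; rewrite ler_wpM2l.
(* Cramer's rule: these combinations equal [|D| (s - a)] and, below, [|D| (t - b)] up to an error
   less than [|D| del], so each has a fixed sign on the two opposite edges where its main term is
   extreme. *)
have X s t : in_box a b del s t ->
    `|Num.sg D * (q2 * rx g d s t - q1 * ry g d s t) - `|D| * (s - a)| < `|D| * del.
  move=> /H[h1 h2].
  set x := rx g d s t - _ in h1; set y := ry g d s t - _ in h2.
  rewrite (_ : _ - _ = Num.sg D * (q2 * x + - q1 * y)); last first.
    by rewrite -fD /x /y /D; ring.
  rewrite normrM (_ : `|Num.sg D| = 1) ?mul1r; last by rewrite normr_sg D0.
  apply: bound => //; rewrite normrN; have := normr_ge0 p1; have := normr_ge0 p2.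
  have := normr_ge0 q1; lra.
have Y s t : in_box a b del s t ->
    `|Num.sg D * (p1 * ry g d s t - p2 * rx g d s t) - `|D| * (t - b)| < `|D| * del.
  move=> /H[h1 h2].
  set x := rx g d s t - _ in h1; set y := ry g d s t - _ in h2.
  rewrite (_ : _ - _ = Num.sg D * (- p2 * x + p1 * y)); last first.
    by rewrite -fD /x /y /D; ring.
  rewrite normrM (_ : `|Num.sg D| = 1) ?mul1r; last by rewrite normr_sg D0.
  apply: bound => //; rewrite normrN; have := normr_ge0 p1; have := normr_ge0 p2.
  have := normr_ge0 q1; have := normr_ge0 q2; lra.
have ad : a - del <= a + del by lra.
have bd : b - del <= b + del by lra.
have inb s t : a - del <= s <= a + del -> b - del <= t <= b + del -> in_box a b del s t.
  exact: in_boxE.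
have Xr t : b - del <= t <= b + del -> 0 < Num.sg D * q2 * rx g d (a + del) t + - (Num.sg D * q1) * ry g d (a + del) t.
  move=> ht; have := X _ _ (inb (a + del) t _ ht); rewrite ad lexx => /(_ isT).
  rewrite ltr_norml addrAC subrr add0r => /andP[+ _]; lra.
have Xl t : b - del <= t <= b + del -> Num.sg D * q2 * rx g d (a - del) t + - (Num.sg D * q1) * ry g d (a - del) t < 0.
  move=> ht; have := X _ _ (inb (a - del) t _ ht); rewrite ad lexx => /(_ isT).
  rewrite ltr_norml addrAC subrr add0r => /andP[_]; lra.
have Yt s : a - del <= s <= a + del -> 0 < - (Num.sg D * p2) * rx g d s (b + del) + Num.sg D * p1 * ry g d s (b + del).
  move=> hs; have := Y _ _ (inb s (b + del) hs _); rewrite bd lexx => /(_ isT).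
  rewrite ltr_norml addrAC subrr add0r => /andP[+ _]; lra.
have Yb s : a - del <= s <= a + del -> - (Num.sg D * p2) * rx g d s (b - del) + Num.sg D * p1 * ry g d s (b - del) < 0.
  move=> hs; have := Y _ _ (inb s (b - del) hs _); rewrite bd lexx => /(_ isT).
  rewrite ltr_norml addrAC subrr add0r => /andP[_]; lra.
split.
- apply: (@circulation_box R g d sg sd (Num.sg D) (Num.sg D * q2) (- (Num.sg D * q1))
    (- (Num.sg D * p2)) (Num.sg D * p1) _ _ _ _ (a + del) (b + del) (a - del) (b - del));
    rewrite ?lexx ?ad ?bd//.
  + have -> : Num.sg D * (Num.sg D * q2 * (Num.sg D * p1) - - (Num.sg D * q1) * - (Num.sg D * p2)) =
        (Num.sg D * D) * Num.sg D ^+ 2 by rewrite /D; ring.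
    by rewrite f1 mulr1 fD normr_gt0.
  + move=> s hs; have -> : s = a + del by lra.
    by apply: Xr; rewrite lexx.
  + move=> t ht; have -> : t = b + del by lra.
    by apply: Yt; rewrite lexx ad.
  + move=> s hs; have -> : s = a - del by lra.
    by apply: Xl; rewrite lexx bd.
  + move=> t ht; have -> : t = b - del by lra.
    by apply: Yb; rewrite lexx.
- move=> s t [hs [ht]]; rewrite -planar_gt0.
  have P u v : u * rx g d s t + v * ry g d s t != 0 -> 0 < planar g d s t.
    move=> h; rewrite planar_gt0 /planar paddr_eq0 ?sqr_ge0// !sqrf_eq0.
    by apply/negP => /andP[/eqP e1 /eqP e2]; move: h; rewrite e1 e2 !mulr0 addr0 eqxx.
  case=> E; rewrite ?E in hs ht P *.
  + by apply: P (Num.sg D * q2) (- (Num.sg D * q1)) _; rewrite lt_eqF// Xl.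
  + by apply: P (Num.sg D * q2) (- (Num.sg D * q1)) _; rewrite gt_eqF// Xr.
  + by apply: P (- (Num.sg D * p2)) (Num.sg D * p1) _; rewrite lt_eqF// Yb.
  + by apply: P (- (Num.sg D * p2)) (Num.sg D * p1) _; rewrite gt_eqF// Yt.
Qed.

Definition planar_cross s t := vx g s * vy d t - vy g s * vx d t.

Lemma rz_neq0 s t : planar g d s t = 0 -> rz g d s t != 0.
Proof.
move=> q0; have := r_gt0 s t; rewrite rho_gt0 -/(planar g d s t) q0 add0r.
by apply: contraTneq => ->; rewrite expr0n ltxx.
Qed.

Lemma cont_rz a b e : 0 < e ->
  \forall del \near 0^'+, forall s t, in_box a b del s t -> `|rz g d a b - rz g d s t| <= e.
Proof.
move=> e0; have [_ _ cz0 _] := cont_curves sg sd a b.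
have h : \forall p \near (a, b), `|rz g d a b - rz g d p.1 p.2| <= e.
  by move/cvgrPdist_le : cz0; apply.
have := near_right_ball2 (P := fun s t => `|rz g d a b - rz g d s t| <= e) h.
by apply: filterS => del H s t [h1 h2]; exact: H.
Qed.

Lemma zero_free_near a b : planar g d a b != 0 ->
  \forall del \near 0^'+, defect g d (a - del) (a + del) (b - del) (b + del) = 0.
Proof.
move=> q0; have [cX cY _ _] := cont_curves sg sd a b.
have cq : continuous2_at (planar g d) a b by rewrite /continuous2_at /planar in cX cY *; cont.
have h : \forall p \near (a, b), planar g d p.1 p.2 != 0.
  have q0' : 0 < `|planar g d a b| / 2 by rewrite divr_gt0// normr_gt0.
  have /cvgrPdist_le/(_ _ q0') := cq; apply: filterS => -[s t]/= h.
  apply: contra_leN h => /eqP->; rewrite subr0; lra.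
have := near_right_ball2 (P := fun s t => planar g d s t != 0) h.
have d0 := nbhs_right_gt (0 : R); apply: filterS2 d0 => del d0 H; apply: (defect_free sg sd r_gt0); [lra|lra|].
by move=> s t hs ht; have [h1 h2] := in_boxE hs ht; exact: H.
Qed.

(** Transversality makes the linear part of the planar difference invertible, and on a small box [z]
    keeps its sign. Two signs cancel: the determinant is minus [planar_cross], because [d] enters
    [r] with a minus sign, and [defect_box] has a minus sign. *)
Lemma transversal_near a b : planar g d a b = 0 -> planar_cross a b != 0 ->
  \forall del \near 0^'+, defect g d (a - del) (a + del) (b - del) (b + del) =
    Num.sg (rz g d a b) * Num.sg (planar_cross a b) * (2 * pi).
Proof.
move=> q0 c0; have z0 := rz_neq0 q0.
have [X0 Y0] : rx g d a b = 0 /\ ry g d a b = 0.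
  move: q0 => /eqP; rewrite /planar paddr_eq0 ?sqr_ge0// !sqrf_eq0.
  by move=> /andP[/eqP-> /eqP->].
have [x1 y1 _ _] := sg; have [x2 y2 _ _] := sd.
pose D := vx g a * - vy d b - vy g a * - vx d b.
have DE : D = - planar_cross a b by rewrite /D /planar_cross; ring.
have D0 : D != 0 by rewrite DE oppr_eq0.
pose N := `|vx g a| + `|vy g a| + `|- vx d b| + `|- vy d b|.
have N0 : 0 <= N by rewrite !addr_ge0.
(* Makes [N * eta] at most half of [|D|], the smallness asked by [linear_box]. *)
pose eta := `|D| / 2 / (N + 1).
have Dp : 0 < `|D| / 2 by rewrite divr_gt0// normr_gt0.
have eta0 : 0 < eta by rewrite divr_gt0//; lra.
have etaN : N * eta < `|D|.
  by rewrite mulrC; apply: le_lt_trans (frac_le Dp N0) _; lra.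
have e0 : 0 < eta / 2 by rewrite divr_gt0.
have zp : 0 < `|rz g d a b| / 2 by rewrite divr_gt0// normr_gt0.
have h1 := derive_near_right (x1 a) e0; have h2 := derive_near_right (y1 a) e0.
have h3 := derive_near_right (x2 b) e0; have h4 := derive_near_right (y2 b) e0.
have h5 := cont_rz a b zp; have d0 := nbhs_right_gt (0 : R).
near=> del.
have del0 : 0 < del by near: del.
have H1 : forall s, `|s - a| <= del -> `|cx g s - cx g a - vx g a * (s - a)| <= eta / 2 * del by near: del.
have H2 : forall s, `|s - a| <= del -> `|cy g s - cy g a - vy g a * (s - a)| <= eta / 2 * del by near: del.
have H3 : forall s, `|s - b| <= del -> `|cx d s - cx d b - vx d b * (s - b)| <= eta / 2 * del by near: del.
have H4 : forall s, `|s - b| <= del -> `|cy d s - cy d b - vy d b * (s - b)| <= eta / 2 * del by near: del.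
have H5 : forall s t, in_box a b del s t -> `|rz g d a b - rz g d s t| <= `|rz g d a b| / 2 by near: del.
have [|circ brd] := @linear_box (vx g a) (vy g a) (- vx d b) (- vy d b) eta a b del del0 (ltW eta0) D0 etaN.
  move=> s t [hs ht]; split.
    rewrite (_ : _ - _ = (cx g s - cx g a - vx g a * (s - a)) - (cx d t - cx d b - vx d b * (t - b))).
      apply: le_trans (ler_normB _ _) _; have := H1 _ hs; have := H3 _ ht; lra.
    by move: X0; rewrite /rx => /eqP; rewrite subr_eq0 => /eqP ->; ring.
  rewrite (_ : _ - _ = (cy g s - cy g a - vy g a * (s - a)) - (cy d t - cy d b - vy d b * (t - b))).
    apply: le_trans (ler_normB _ _) _; have := H2 _ hs; have := H4 _ ht; lra.
  by move: Y0; rewrite /ry => /eqP; rewrite subr_eq0 => /eqP ->; ring.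
rewrite (@defect_box R g d sg sd r_gt0 (Num.sg (rz g d a b)))//.
- by rewrite circ -/D DE sgrN; ring.
- lra.
- lra.
- by rewrite sqr_sg z0.
- move=> s t hs ht _; have := H5 _ _ (in_boxE hs ht).
  rewrite ler_distlC => /andP[]; case: (sgrP (rz g d a b)) z0 => [->|z0 _|z0 _]; rewrite ?eqxx//;
    rewrite ?(gtr0_norm z0) ?(ltr0_norm z0); lra.
Unshelve. all: by end_near. Qed.

End pair.
End local.

Section generic_degree.
Context {R : realType} (g d : curve R) (L : R).
Context (sg : smooth g) (sd : smooth d).
Context (pg : periodic_curve L g) (pd : periodic_curve L d) (L0 : 0 < L).
Context (r_gt0 : forall s t, 0 < rho (rx g d s t) (ry g d s t) (rz g d s t)).

(** A zero with a negative parameter would be translated by [L] to one within [del] of [L], where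
    the separation from the sentinel leaves no listed parameter. *)
Lemma zeros_in_window (S : seq R) (del s t : R) : 0 < del -> path (apart del) 0 (rcons S L) ->
  (forall s t, 0 <= s < L -> 0 <= t < L -> planar g d s t = 0 -> s \in 0 :: S /\ t \in 0 :: S) ->
  - del <= s <= L - del -> - del <= t <= L - del -> planar g d s t = 0 ->
  s \in 0 :: S /\ t \in 0 :: S.
Proof.
move=> d0 hp hz hs ht q0; have l0 := L0.
have tr : transitive (apart del) by move=> u v w; rewrite /apart; lra.
have hpw : pairwise (apart del) (rcons (0 :: S) L) by rewrite -sorted_pairwise.
move: (hpw); rewrite pairwise_rcons => /andP[/allP SL _].
have dL : del < L by have := SL 0 (mem_head _ _); rewrite /apart; lra.
have [s0|s0] := leP 0 s; have [t0|t0] := leP 0 t.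
- by apply: hz => //; lra.
- have [e1 e2 _] := r_periodic_t g pd s t.
  have q0' : planar g d s (t + L) = 0 by rewrite /planar e1 e2.
  have [||_ /SL] := hz _ _ _ _ q0'; [lra|lra|rewrite /apart; lra].
- have [e1 e2 _] := r_periodic_s d pg s t.
  have q0' : planar g d (s + L) t = 0 by rewrite /planar e1 e2.
  have [||/SL] := hz _ _ _ _ q0'; [lra|lra|rewrite /apart; lra].
- have [e1 e2 _] := r_periodic_s d pg s t; have [e3 e4 _] := r_periodic_t g pd (s + L) t.
  have q0' : planar g d (s + L) (t + L) = 0 by rewrite /planar e3 e4 e1 e2.
  have [||/SL] := hz _ _ _ _ q0'; [lra|lra|rewrite /apart; lra].
Qed.

(** The list of parameters is finite, so one radius suits all boxes of the grid; those centred at a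
    grid point that is not a zero contribute 0. *)
Lemma generic_degree (S : seq R) : path <%R 0 (rcons S L) ->
  (forall s t, 0 <= s < L -> 0 <= t < L -> planar g d s t = 0 ->
     [/\ s \in 0 :: S, t \in 0 :: S & planar_cross g d s t != 0]) ->
  total_angle g d L = \sum_(a <- 0 :: S) \sum_(b <- 0 :: S)
    if planar g d a b == 0 then Num.sg (rz g d a b) * Num.sg (planar_cross g d a b) * (2 * pi) else 0.
Proof.
move=> hp hz.
have S0L x : x \in 0 :: S -> 0 <= x < L.
  have tr := @lt_trans _ R.
  have hpw : pairwise <%R (rcons (0 :: S) L) by rewrite -sorted_pairwise//; exact: lt_trans.
  move: (hpw); rewrite pairwise_rcons => /andP[/allP SL _] xS; rewrite [x < L]SL// andbT.
  move: xS hpw; rewrite inE => /predU1P[->//|xS]; rewrite rcons_cons /= => /andP[/allP h _].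
  by apply/ltW/h; rewrite mem_rcons inE xS orbT.
pose W a b := if planar g d a b == 0 then
  Num.sg (rz g d a b) * Num.sg (planar_cross g d a b) * (2 * pi) else 0.
have h : \forall del \near (0 : R)^'+, forall a, a \in 0 :: S -> forall b, b \in 0 :: S ->
    defect g d (a - del) (a + del) (b - del) (b + del) = W a b.
  apply: near_all => a aS; apply: near_all => b bS; rewrite /W; case: eqP => [q0|/eqP q0].
    by apply: transversal_near => //; have [] := hz _ _ (S0L _ aS) (S0L _ bS) q0.
  exact: zero_free_near.
near (0 : R)^'+ => del.
have d0 : 0 < del by near: del; exact: nbhs_right_gt.
have hp' : path (apart del) 0 (rcons S L) by near: del; exact: path_apart_near.
apply: (@degree_formula R g d L sg sd pg pd L0 r_gt0 del S W d0 hp').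
- move=> s t hs ht q0; exists s, t.
  have [|sS tS] := zeros_in_window d0 hp' _ hs ht q0.
    by move=> s' t' h1 h2 /(hz _ _ h1 h2)[].
  by rewrite !subrr !normr0.
- by move=> a b aS bS; move: a aS b bS; near: del.
Unshelve. all: by end_near. Qed.

End generic_degree.

(** * Sard theorem for the direction map *)

Section compactness.
Context {R : realType}.
Implicit Types (a b c e s t x y : R).

Lemma near_square (I : Type) (F : set_system I) (FF : Filter F) (P : I -> R -> R -> Prop) a b c e :
  (forall s t, a <= s <= b -> c <= t <= e ->
     \forall p \near (s, t) & i \near F, P i p.1 p.2) ->
  \forall i \near F, forall s t, a <= s <= b -> c <= t <= e -> P i s t.
Proof.
move=> h; have cK := compact_setX (@segment_compact R a b) (@segment_compact R c e).
have /compact_near_coveringP K := cK.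
have H : forall p, (`[a, b] `*` `[c, e])%classic p ->
    \forall p' \near p & i \near F, P i p'.1 p'.2.
  by move=> [s t] [/=]; rewrite !in_itv/=; exact: h.
have := K I F (fun i p => P i p.1 p.2) FF H.
apply: filterS => i Hi s t hs ht; apply: (Hi (s, t)).
by split; rewrite /= in_itv.
Qed.

Lemma near_segmentF (I : Type) (F : set_system I) (FF : Filter F) (P : I -> R -> Prop) a b :
  (forall s, a <= s <= b -> \forall s' \near s & i \near F, P i s') ->
  \forall i \near F, forall s, a <= s <= b -> P i s.
Proof.
move=> h; have /compact_near_coveringP K := @segment_compact R a b.
have H : forall s, `[a, b]%classic s -> \forall s' \near s & i \near F, P i s'.
  by move=> s; rewrite /= in_itv/=; exact: h.
have := K I F (fun i s => P i s) FF H.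
by apply: filterS => i Hi s hs; apply: Hi; rewrite /= in_itv.
Qed.

Lemma unif_continuous_segment (f : R -> R) a b e : continuous f -> 0 < e ->
  \forall h \near 0^'+, forall s, a <= s <= b -> forall s', `|s' - s| <= h -> `|f s' - f s| <= e.
Proof.
move=> cf e0; apply: near_segmentF => s _.
have e2 : 0 < e / 2 by rewrite divr_gt0.
have /cvgrPdist_le/(_ _ e2)/nbhs_ballP[r/= r0 hr] := cf s.
have r2 : 0 < r / 2 by rewrite divr_gt0.
exists (ball s (r / 2), [set h | h < r / 2]) => [|[s' h]/= [sb hr2] s'' hs].
  by split; [exact: nbhsx_ballx|exact: nbhs_right_lt].
rewrite (_ : _ - _ = (f s - f s') - (f s - f s'')); last by ring.
have rr : r / 2 <= r by lra.
have h1 := hr _ (le_ball rr sb).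
have h2 : `|f s - f s''| <= e / 2.
  apply: hr; rewrite /ball/= in sb *.
  rewrite (_ : s - s'' = (s - s') - (s'' - s')); last by ring.
  by apply: le_lt_trans (ler_normB _ _) _; lra.
by apply: le_trans (ler_normB _ _) _; lra.
Qed.

Lemma bounded_segment (f : R -> R) a b : continuous f ->
  exists2 B, 0 < B & forall s, a <= s <= b -> `|f s| <= B.
Proof.
move=> cf.
have : \forall B \near +oo, forall s, a <= s <= b -> `|f s| <= B.
  apply: near_segmentF => s _.
  have /cvgrPdist_le/(_ _ ltr01) h := cf s.
  exists ([set s' | `|f s - f s'| <= 1], [set B | `|f s| + 1 <= B]) => [|[s' B]/= [h1 h2]].
    by split=> //; exact: nbhs_pinfty_ge.
  rewrite (_ : f s' = f s - (f s - f s')); last by ring.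
  by apply: le_trans (ler_normB _ _) _; lra.
move=> h; near (+oo : set_system R) => B; exists B; last by near: B.
by near: B; exact: nbhs_pinfty_gt.
Unshelve. all: by end_near. Qed.

Lemma pos_min_square (f : R -> R -> R) a b c e :
  (forall s t, a <= s <= b -> c <= t <= e -> continuous2_at f s t /\ 0 < f s t) ->
  exists2 m, 0 < m & forall s t, a <= s <= b -> c <= t <= e -> m <= f s t.
Proof.
move=> H.
have : \forall m \near 0^'+, forall s t, a <= s <= b -> c <= t <= e -> m <= f s t.
  apply: near_square => s t hs ht; have [cf f0] := H s t hs ht.
  have f2 : 0 < f s t / 2 by rewrite divr_gt0.
  have h : \forall p \near (s, t), `|f s t - f p.1 p.2| <= f s t / 2.
    by move/cvgrPdist_le : cf; apply.
  exists ([set p | `|f s t - f p.1 p.2| <= f s t / 2], [set m | m < f s t / 2]).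
    by split=> //; exact: nbhs_right_lt.
  by move=> [p m]/= [h1 h2]; move: h1; rewrite ler_distlC; lra.
move=> h; near (0 : R)^'+ => m; exists m; last by near: m.
by near: m; exact: nbhs_right_gt.
Unshelve. all: by end_near. Qed.

End compactness.

(** * Counting points of a grid in a thin strip *)

Section counting.
Context {R : realType}.
Implicit Types (c e : R) (K : nat).

Lemma card_interval K (A : {set 'I_K}) c e : 0 <= e ->
  (forall i, i \in A -> `|i%:R / K%:R - c| <= e) -> #|A|%:R <= 2 * e * K%:R + 1.
Proof.
move=> e0 H; have [->|[i0 i0A]] := set_0Vmem A.
  by rewrite cards0 addr_ge0// !mulr_ge0.
have K0 : (0 < K)%N by exact: leq_ltn_trans (ltn_ord i0).
have KR : 0 < K%:R :> R by rewrite ltr0n.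
pose a := [arg min_(i < i0 in A) (i : nat)]%N.
pose b := [arg max_(i > i0 in A) (i : nat)]%N.
have [aA amin] : a \in A /\ forall i, i \in A -> (a <= i)%N.
  by rewrite /a; case: arg_minnP.
have [bA bmax] : b \in A /\ forall i, i \in A -> (i <= b)%N.
  by rewrite /b; case: arg_maxnP.
have ab : (a <= b)%N by exact: amin.
have le : (#|A| <= (b - a).+1)%N.
  rewrite cardE -(size_map (@nat_of_ord K)) -(size_iota a (b - a).+1).
  apply: uniq_leq_size; first by rewrite map_inj_uniq ?enum_uniq//; exact: ord_inj.
  move=> _ /mapP[i + ->]; rewrite mem_enum mem_iota => iA.
  by rewrite amin//= addnS ltnS subnKC// bmax.
have : (b - a)%:R <= 2 * e * K%:R.
  have := H _ aA; have := H _ bA; rewrite !ler_norml => /andP[_ h1] /andP[h2 _].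
  rewrite natrB// -ler_pdivrMr// mulrBl; lra.
by move=> h; apply: le_trans (_ : (b - a).+1%:R <= _); rewrite ?ler_nat// -natr1; lra.
Qed.

(** Counted row by row: boundedly many rows meet [A], and the points of a row [j] lie in an interval
    about [c j]. *)
Lemma card_strip K (A : {set 'I_K * 'I_K}) (c : nat -> R) y0 e1 e2 : 0 <= e1 -> 0 <= e2 ->
  (forall i j, (i, j) \in A -> `|i%:R / K%:R - c j| <= e1 /\ `|j%:R / K%:R - y0| <= e2) ->
  #|A|%:R <= (2 * e1 * K%:R + 1) * (2 * e2 * K%:R + 1).
Proof.
move=> e10 e20 H.
pose B (j : 'I_K) : {set 'I_K} := finset (fun i => (i, j) \in A).
pose J : {set 'I_K} := finset (fun j => [exists i, (i, j) \in A]).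
have cA : #|A| = (\sum_(j in J) #|B j|)%N.
  rewrite -sum1_card big_mkcond/= (eq_bigr (fun p => (((p.1, p.2) \in A) : nat))); last first.
    by move=> [i j] _ /=; case: ifP.
  rewrite -(pair_bigA _ (fun i j => (((i, j) \in A) : nat)))/= exchange_big/=.
  rewrite (bigID (mem J))/= [X in (_ + X)%N]big1 ?addn0; last first.
    move=> j; rewrite inE => /existsPn h; rewrite big1// => i _.
    by rewrite (negbTE (h i)).
  apply: eq_bigr => j _; rewrite -sum1_card big_mkcond [RHS]big_mkcond/=.
  by apply: eq_bigr => i _; rewrite inE; case: ifP.
have hJ : #|J|%:R <= 2 * e2 * K%:R + 1.
  apply: (card_interval (c := y0) e20) => j; rewrite inE => /existsP[i /H[]] _.
  exact.
rewrite cA natr_sum; apply: le_trans (_ : \sum_(j in J) (2 * e1 * K%:R + 1) <= _).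
  apply: ler_sum => j _; apply: (card_interval (c := c j) e10) => i.
  by rewrite inE => /H[].
rewrite sumr_const -[X in X <= _]mulr_natr ler_wpM2l// addr_ge0// !mulr_ge0//.
Qed.

(** The strip is a graph over one axis or the other; [b] records which, so that only slopes of
    absolute value at most 1 occur later. *)
Lemma card_strip_or K (A : {set 'I_K * 'I_K}) (c : nat -> R) (b : bool) x0 y0 e1 e2 :
  0 <= e1 -> 0 <= e2 ->
  (forall i j, (i, j) \in A ->
     [/\ `|i%:R / K%:R - x0| <= e2, `|j%:R / K%:R - y0| <= e2 &
      if b then `|i%:R / K%:R - c j| <= e1 else `|j%:R / K%:R - c i| <= e1]) ->
  #|A|%:R <= (2 * e1 * K%:R + 1) * (2 * e2 * K%:R + 1).
Proof.
move=> e10 e20; case: b => H.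
  by apply: (card_strip (c := c) (y0 := y0)) => // i j /H[].
pose A' : {set 'I_K * 'I_K} := finset (fun p => (p.2, p.1) \in A).
have sw : injective (fun p : 'I_K * 'I_K => (p.2, p.1)) by move=> [i j] [i' j'] [-> ->].
have -> : #|A| = #|A'|.
  rewrite -(card_imset A sw); apply: eq_card => -[i j]; rewrite inE/=.
  apply/imsetP/idP => [[[i' j'] h [-> ->]]//|h].
  by exists (j, i).
by apply: (card_strip (c := c) (y0 := x0)) => // i j; rewrite inE => /H[].
Qed.

Lemma card_fibers (T U : finType) (f : T -> U) (b : R) :
  (forall u, #|finset (fun x => f x == u)|%:R <= b) -> #|T|%:R <= #|U|%:R * b.
Proof.
move=> h; rewrite -[#|T|]sum1_card (partition_big f predT)//= natr_sum.
rewrite mulrC mulr_natr -sumr_const; apply: ler_sum => u _; apply: le_trans (h u).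
by rewrite -sum1_card ler_nat; apply/eq_leq/eq_bigl => x; rewrite inE.
Qed.

End counting.

Section sard.
Context {R : realType} (g d : curve R) (L : R).
Context (sg : smooth g) (sd : smooth d) (L0 : 0 < L).
Context (r_gt0 : forall s t, 0 < rho (rx g d s t) (ry g d s t) (rz g d s t)).

Definition volume s t :=
  rx g d s t * (vy g s * vz d t - vz g s * vy d t)
  - ry g d s t * (vx g s * vz d t - vz g s * vx d t)
  + rz g d s t * (vx g s * vy d t - vy g s * vx d t).

(** Two dependent vectors of the plane are killed by a common nonzero linear form, normalized so
    that one coefficient is 1 and the other at most 1 in absolute value; [b] tells whether the first
    one is 1. *)
Lemma common_form (a1 a2 b1 b2 : R) : a1 * b2 - a2 * b1 = 0 ->
  exists b l, [/\ `|l| <= 1, if b : bool then a1 + l * a2 = 0 else l * a1 + a2 = 0 &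
    if b then b1 + l * b2 = 0 else l * b1 + b2 = 0].
Proof.
have main (u v x y : R) : u * y - v * x = 0 -> (u != 0) || (v != 0) ->
    exists b l, [/\ `|l| <= 1, if b : bool then u + l * v = 0 else l * u + v = 0 &
      if b then x + l * y = 0 else l * x + y = 0].
  move=> D0 uv0; have [uv|vu] := leP `|u| `|v|.
    have v0 : v != 0.
      by apply: contraTneq uv0 => v0; move: uv; rewrite v0 normr0 normr_le0 => /eqP->; rewrite eqxx.
    exists true, (- u / v); rewrite normrM normrN normfV ler_pdivrMr ?normr_gt0// mul1r.
    split=> //; first by field.
    have -> : x + - u / v * y = - (u * y - v * x) / v by field.
    by rewrite D0 oppr0 mul0r.
  have u0 : u != 0 by rewrite -normr_gt0 (le_lt_trans _ vu).
  exists false, (- v / u); rewrite normrM normrN normfV ler_pdivrMr ?normr_gt0// mul1r ltW//.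
  split=> //; first by field.
  have -> : - v / u * x + y = (u * y - v * x) / u by field.
  by rewrite D0 mul0r.
move=> D0; have [a0|] := boolP ((a1 != 0) || (a2 != 0)); first exact: main.
rewrite negb_or !negbK => /andP[/eqP a10 /eqP a20].
have [b0|] := boolP ((b1 != 0) || (b2 != 0)).
  have D0' : b1 * a2 - b2 * a1 = 0 by rewrite a10 a20 !mulr0 subrr.
  have [b [l [h1 h2 h3]]] := main _ _ _ _ D0' b0.
  by exists b, l; split.
rewrite negb_or !negbK => /andP[/eqP b10 /eqP b20].
exists true, 0; rewrite normr0 a10 a20 b10 b20 mulr0 addr0; split=> //.
Qed.

Lemma rho_min : exists2 m, 0 < m &
  forall s t, 0 <= s <= L -> 0 <= t <= L -> m <= rho (rx g d s t) (ry g d s t) (rz g d s t).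
Proof.
apply: (pos_min_square (f := fun s t => rho (rx g d s t) (ry g d s t) (rz g d s t))) => s t hs ht.
split; last exact: r_gt0.
by have [cX cY cZ _] := cont_curves sg sd s t; exact: cont_rho.
Qed.

Lemma norm_le1 (x : R) : 0 <= x <= 1 -> `|x| <= 1.
Proof. by move=> /andP[x0 x1]; rewrite ger0_norm. Qed.

(** For slopes in the unit square [m^2 <= 3 z^2]; the bound [m / 2] is weaker and avoids a square
    root. *)
Lemma rho_le_rz (x y z m : R) : 0 < m -> m <= rho x y z -> `|x| <= `|z| -> `|y| <= `|z| -> m / 2 <= `|z|.
Proof.
move=> m0 mr xz yz; have h : m ^+ 2 <= x ^+ 2 + y ^+ 2 + z ^+ 2.
  by rewrite -sqr_rho ler_pXn2r// nnegrE ?rho_ge0// ltW.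
have {}xz : x ^+ 2 <= z ^+ 2 by rewrite -[_ ^+ 2]real_normK ?num_real// -[leRHS]real_normK ?num_real// ler_pXn2r ?nnegrE.
have {}yz : y ^+ 2 <= z ^+ 2 by rewrite -[_ ^+ 2]real_normK ?num_real// -[leRHS]real_normK ?num_real// ler_pXn2r ?nnegrE.
rewrite leNgt; apply/negP => zm.
have : `|z| ^+ 2 < (m / 2) ^+ 2 by rewrite ltr_pXn2r ?nnegrE ?divr_ge0 ?(ltW m0).
rewrite real_normK ?num_real// expr_div_n; have : 0 < m ^+ 2 by rewrite exprn_gt0.
lra.
Qed.

Lemma component_bound (B h s s' : R) (c v : R -> R) :
  (forall t : R, is_derive t 1 c (v t)) -> (forall t, 0 <= t <= L -> `|v t| <= B) -> 0 <= B ->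
  0 <= s <= L -> 0 <= s' <= L -> `|s' - s| <= h -> `|c s' - c s| <= B * h.
Proof.
move=> dc vB B0 hs hs' hh.
have := @derive_mean_bound R c v s s' 0 B B0; rewrite mul0r subr0 => H.
apply: le_trans (H _) _; last by rewrite ler_wpM2l.
move=> z; rewrite ge_min le_max => hz; split; first exact: dc.
rewrite subr0; apply: vB.
by move: hz => /andP[/orP[h1|h1] /orP[h2|h2]]; lra.
Qed.

(** A linear form that kills the velocity at [s] has small derivative along the whole arc, so its
    increments are [o(h)]; the factor 4 is the sum of the bounds 1, 1, 2 of the coefficients. *)
Lemma cell_form (f : curve R) (l1 l2 l3 e h s s' : R) : smooth f ->
  `|l1| <= 1 -> `|l2| <= 1 -> `|l3| <= 2 -> 0 <= e ->
  (forall t, `|t - s| <= h -> [/\ `|vx f t - vx f s| <= e, `|vy f t - vy f s| <= e & `|vz f t - vz f s| <= e]) ->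
  l1 * vx f s + l2 * vy f s + l3 * vz f s = 0 -> `|s' - s| <= h ->
  `|l1 * (cx f s' - cx f s) + l2 * (cy f s' - cy f s) + l3 * (cz f s' - cz f s)| <= 4 * e * h.
Proof.
move=> [d1 d2 d3 _] n1 n2 n3 e0 He l0 hs.
have e4 : 0 <= 4 * e by rewrite mulr_ge0.
have := @derive_mean_bound R (fun t => l1 * cx f t + l2 * cy f t + l3 * cz f t)
  (fun t => l1 * vx f t + l2 * vy f t + l3 * vz f t) s s' 0 (4 * e) e4.
rewrite mul0r subr0 => H.
rewrite (_ : _ + _ = l1 * cx f s' + l2 * cy f s' + l3 * cz f s' - (l1 * cx f s + l2 * cy f s + l3 * cz f s)); last by ring.
apply: le_trans (H _) _; last by rewrite ler_wpM2l.
move=> z hz; split.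
  exact: (deriveA (deriveA (deriveK l1 (d1 z)) (deriveK l2 (d2 z))) (deriveK l3 (d3 z))).
have zs : `|z - s| <= h.
  by rewrite distrC; apply: le_trans (dist_between hz) _; rewrite distrC.
have [h1 h2 h3] := He _ zs.
rewrite subr0 (_ : _ + _ = l1 * (vx f z - vx f s) + l2 * (vy f z - vy f s) + l3 * (vz f z - vz f s)
  + (l1 * vx f s + l2 * vy f s + l3 * vz f s)); last by ring.
rewrite l0 addr0; apply: le_trans (ler_normD _ _) _.
apply: (@le_trans _ _ (1 * e + 1 * e + 2 * e)); last by lra.
apply: lerD; last by rewrite normrM ler_pM.
by apply: le_trans (ler_normD _ _) _; apply: lerD; rewrite normrM ler_pM.
Qed.

(** The pair [(x, y)] stands for the direction [(x, y, 1)]; the equations are multiplied out so as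
    not to divide by [rz]. At a solution, nonzero [volume] says that the map from [(s, t)] to the
    direction is regular. *)
Definition regular_value x y := forall s t, 0 <= s <= L -> 0 <= t <= L ->
  rx g d s t = x * rz g d s t -> ry g d s t = y * rz g d s t -> volume s t != 0.

(* Sard's theorem by counting: over a pair of arcs of length h, the critical values lie in a strip
   of width o(h) and length O(h). If all values were critical, these O(1 / h^2) strips would
   contain all the points of a fine grid of the unit square. *)
Lemma exists_regular_value : exists x y, regular_value x y.
Proof.
apply: contrapT => nex; have l0 := L0.
have crit x y : exists st : R * R, [/\ 0 <= st.1 <= L, 0 <= st.2 <= L,
    rx g d st.1 st.2 = x * rz g d st.1 st.2, ry g d st.1 st.2 = y * rz g d st.1 st.2 &
    volume st.1 st.2 = 0].
  apply: contrapT => h; apply: nex; exists x, y => s t hs ht e1 e2; apply/eqP => v0.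
  by apply: h; exists (s, t).
have [m m0 hm] := rho_min.
have [x1 y1 z1 [cx1 cy1 cz1]] := sg; have [x2 y2 z2 [cx2 cy2 cz2]] := sd.
have [B B0 hB] : exists2 B, 0 < B & forall t, 0 <= t <= L ->
    [/\ `|vx g t| <= B, `|vy g t| <= B & `|vz g t| <= B] /\
    [/\ `|vx d t| <= B, `|vy d t| <= B & `|vz d t| <= B].
  have [b1 p1 h1] := bounded_segment 0 L cx1; have [b2 p2 h2] := bounded_segment 0 L cy1.
  have [b3 p3 h3] := bounded_segment 0 L cz1; have [b4 p4 h4] := bounded_segment 0 L cx2.
  have [b5 p5 h5] := bounded_segment 0 L cy2; have [b6 p6 h6] := bounded_segment 0 L cz2.
  exists (b1 + b2 + b3 + b4 + b5 + b6); first by lra.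
  move=> t ht; have := h1 t ht; have := h2 t ht; have := h3 t ht; have := h4 t ht.
  have := h5 t ht; have := h6 t ht.
  by move=> *; split; split; lra.
(* Over a cell of side [h] the slopes vary by at most [C * h]. With [N * h = 2 * L], the lengths of
   the strips add up to the factor [bet] and their widths, by the choice of [eps], to the factor
   [gam]. Finally [gam * (bet + 1) = 1 / 4] leaves room for at most half of the [K^2] grid
   points. *)
pose C := 4 * B / (m / 2).
have C0 : 0 < C by rewrite !divr_gt0// mulr_gt0.
pose bet := 4 * C * L.
have bet0 : 0 < bet by apply: mulr_gt0 => //; exact: mulr_gt0.
pose gam := (4 * (bet + 1))^-1.
have gam0 : 0 < gam by rewrite invr_gt0 mulr_gt0//; lra.
pose eps := gam * (m / 2) / (32 * L).
have m20 : 0 < m / 2 by rewrite divr_gt0.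
have eps0 : 0 < eps by rewrite divr_gt0 ?mulr_gt0.
have U f (cf : continuous f) := unif_continuous_segment 0 L cf eps0.
have [h0 h00 hh0] : exists2 h0, 0 < h0 & forall s, 0 <= s <= L -> forall s', `|s' - s| <= h0 ->
    [/\ `|vx g s' - vx g s| <= eps, `|vy g s' - vy g s| <= eps & `|vz g s' - vz g s| <= eps] /\
    [/\ `|vx d s' - vx d s| <= eps, `|vy d s' - vy d s| <= eps & `|vz d s' - vz d s| <= eps].
  have u1 := U _ cx1; have u2 := U _ cy1; have u3 := U _ cz1.
  have u4 := U _ cx2; have u5 := U _ cy2; have u6 := U _ cz2.
  near (0 : R)^'+ => h0; exists h0; first by near: h0; exact: nbhs_right_gt.
  move=> s hs s' hs'; split; split; move: s hs s' hs'; near: h0; [exact: u1|exact: u2|exact: u3|exact: u4|exact: u5|exact: u6].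
(* The factor 2 in [h = 2 * L / N] keeps the index of the endpoint [L] below [N]. *)
pose N := (Num.trunc (2 * L / h0)).+1.
have N0 : 0 < N%:R :> R by rewrite ltr0n.
pose h := 2 * L / N%:R.
have hp : 0 < h by rewrite divr_gt0// mulr_gt0.
have hN0 : 2 * L / h0 < (Num.trunc (2 * L / h0)).+1%:R by rewrite truncnS_gt.
have hh : h <= h0.
  by rewrite ler_pdivrMr// [leRHS]mulrC -ler_pdivrMr// ltW.
have hN : h * N%:R = 2 * L by rewrite divfK// gt_eqF.
pose K := (Num.trunc (N%:R / gam)).+1.
have K0 : 0 < K%:R :> R by rewrite ltr0n.
have NK : N%:R <= gam * K%:R by rewrite [leRHS]mulrC -ler_pdivrMr// ltW// truncnS_gt.
have [f hf] := choice (fun p : 'I_K * 'I_K => crit (p.1%:R / K%:R) (p.2%:R / K%:R)).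
pose cell (x : R) : 'I_N := inord (Num.trunc (x / h)).
have cellP x y : 0 <= x <= L -> 0 <= y <= L -> cell x = cell y -> `|x - y| <= h.
  move=> hx hy; have N2 z : 0 <= z <= L -> (Num.trunc (z / h) < N)%N.
    move=> /andP[z0 zL]; have zh0 : 0 <= z / h by rewrite divr_ge0// ltW.
    rewrite (truncn_lt_nat N zh0) ltr_pdivrMr// [ltRHS]mulrC hN; lra.
  move/(congr1 (@nat_of_ord N)); rewrite !inordK ?N2// => E.
  have [x0' y0'] : 0 <= x / h /\ 0 <= y / h.
    by move: hx hy => /andP[hx _] /andP[hy _]; split; apply: divr_ge0 => //; exact: ltW.
  have := truncn_itv x0'; have := truncn_itv y0'; rewrite E -natr1 => /andP[q1 q2] /andP[q3 q4].
  have : `|x / h - y / h| <= 1 by rewrite ler_norml; lra.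
  by rewrite -mulrBl normrM normfV (gtr0_norm hp) ler_pdivrMr// mul1r.
pose phi (p : 'I_K * 'I_K) := (cell (f p).1, cell (f p).2).
pose eta := 8 * eps * h / (m / 2).
have eta0 : 0 <= eta.
  by apply: divr_ge0; [apply: mulr_ge0; [apply: mulr_ge0|]|] => //; exact: ltW.
have grid (i : 'I_K) : 0 <= (i%:R / K%:R : R) <= 1.
  by rewrite divr_ge0//= ler_pdivrMr// mul1r ler_nat ltnW.
have fib cl : #|finset (fun p => phi p == cl)|%:R <= (2 * eta * K%:R + 1) * (2 * (C * h) * K%:R + 1).
  have Ch0 : 0 <= C * h by apply: mulr_ge0; exact: ltW.
  have [->|[p0]] := set_0Vmem (finset (fun p => phi p == cl)).
    by rewrite cards0; apply: mulr_ge0; apply: addr_ge0 => //; apply: mulr_ge0 => //; apply: mulr_ge0.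
  rewrite inE => /eqP pu.
  have [hs0 ht0 X0 Y0 V0] := hf p0.
  have gx0 := grid p0.1; have gy0 := grid p0.2.
  move: X0 Y0 V0 gx0 gy0; set x0 := p0.1%:R / K%:R; set y0 := p0.2%:R / K%:R.
  set s0 := (f p0).1; set t0 := (f p0).2 => X0 Y0 V0 gx0 gy0.
  have rzm s t x y : 0 <= s <= L -> 0 <= t <= L -> 0 <= x <= 1 -> 0 <= y <= 1 ->
      rx g d s t = x * rz g d s t -> ry g d s t = y * rz g d s t -> m / 2 <= `|rz g d s t|.
    move=> hs ht hx hy ex ey; apply: (rho_le_rz m0 (hm _ _ hs ht)).
      by rewrite ex normrM ler_piMl// norm_le1.
    by rewrite ey normrM ler_piMl// norm_le1.
  have rz0m := rzm _ _ _ _ hs0 ht0 gx0 gy0 X0 Y0.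
  have rz00 : rz g d s0 t0 != 0 by rewrite -normr_gt0 (lt_le_trans m20).
  (* When [r] is parallel to [(x0, y0, 1)], the volume is [rz] times the determinant of the
     velocities projected along that direction. *)
  have D0 : (vx g s0 - x0 * vz g s0) * (vy d t0 - y0 * vz d t0) -
            (vy g s0 - y0 * vz g s0) * (vx d t0 - x0 * vz d t0) = 0.
    apply/eqP; rewrite -(mulrI_eq0 _ (mulfI rz00)) -V0 /volume X0 Y0; apply/eqP; ring.
  have [b [l [l1 lg ld]]] := common_form D0.
  (* Coefficients of a linear form on space that kills [(x0, y0, 1)] and both velocities. *)
  pose l_1 := if b then 1 else l; pose l_2 := if b then l else 1.
  pose l_3 := - (l_1 * x0 + l_2 * y0).
  have n1 : `|l_1| <= 1 by rewrite /l_1; case: (b); rewrite ?normr1.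
  have n2 : `|l_2| <= 1 by rewrite /l_2; case: (b); rewrite ?normr1.
  have n3 : `|l_3| <= 2.
    rewrite normrN; apply: le_trans (ler_normD _ _) _.
    rewrite -[2]/(1 + 1) -[X in _ <= X + X]mulr1.
    by apply: lerD; rewrite normrM ler_pM// norm_le1.
  have lg' : l_1 * vx g s0 + l_2 * vy g s0 + l_3 * vz g s0 = 0.
    by move: lg; rewrite /l_3 /l_1 /l_2; case: (b) => <-; ring.
  have ld' : l_1 * vx d t0 + l_2 * vy d t0 + l_3 * vz d t0 = 0.
    by move: ld; rewrite /l_3 /l_1 /l_2; case: (b) => <-; ring.
  apply: (@card_strip_or _ K _ (fun k => if b then x0 + l * y0 - l * (k%:R / K%:R)
    else y0 + l * x0 - l * (k%:R / K%:R)) b x0 y0) => // i j.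
  rewrite inE -pu => /eqP pij.
  have [hs ht X Y V] := hf (i, j); have gx := grid i; have gy := grid j.
  move: hs ht X Y V gx gy; rewrite /=; set x := i%:R / K%:R; set y := j%:R / K%:R.
  set s := (f (i, j)).1; set t := (f (i, j)).2 => hs ht X Y V gx gy.
  have ss : `|s - s0| <= h by apply: cellP => //; exact: (congr1 fst pij).
  have tt : `|t - t0| <= h by apply: cellP => //; exact: (congr1 snd pij).
  have rzm' := rzm _ _ _ _ hs ht gx gy X Y.
  have bd (c1 v1 c2 v2 : R -> R) : (forall t : R, is_derive t 1 c1 (v1 t)) ->
      (forall t : R, is_derive t 1 c2 (v2 t)) -> (forall t, 0 <= t <= L -> `|v1 t| <= B) ->
      (forall t, 0 <= t <= L -> `|v2 t| <= B) ->
      `|(c1 s - c2 t) - (c1 s0 - c2 t0)| <= 2 * B * h.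
    move=> dc1 dc2 b1 b2.
    have q1 := component_bound dc1 b1 (ltW B0) hs0 hs ss.
    have q2 := component_bound dc2 b2 (ltW B0) ht0 ht tt.
    rewrite (_ : _ - _ = (c1 s - c1 s0) - (c2 t - c2 t0)); last by ring.
    by apply: le_trans (ler_normB _ _) _; lra.
  have bX : `|rx g d s t - rx g d s0 t0| <= 2 * B * h.
    by apply: (bd _ _ _ _ x1 x2) => z /hB[[? _ _] [? _ _]].
  have bY : `|ry g d s t - ry g d s0 t0| <= 2 * B * h.
    by apply: (bd _ _ _ _ y1 y2) => z /hB[[_ ? _] [_ ? _]].
  have bZ : `|rz g d s t - rz g d s0 t0| <= 2 * B * h.
    by apply: (bd _ _ _ _ z1 z2) => z /hB[[_ _ ?] [_ _ ?]].
  have slope (u u0 w w0 : R) : 0 <= u0 <= 1 -> w = u * rz g d s t -> w0 = u0 * rz g d s0 t0 ->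
      `|w - w0| <= 2 * B * h -> `|u - u0| <= C * h.
    move=> hu0 ew ew0 bw.
    have : `|u - u0| * `|rz g d s t| <= 4 * B * h.
      rewrite -normrM (_ : _ * _ = (w - w0) - u0 * (rz g d s t - rz g d s0 t0)); last by rewrite ew ew0; ring.
      apply: le_trans (ler_normB _ _) _.
      have : `|u0 * (rz g d s t - rz g d s0 t0)| <= 2 * B * h.
        by rewrite normrM -[leRHS]mul1r ler_pM// norm_le1.
      lra.
    move=> H; rewrite (_ : C * h = 4 * B * h / (m / 2)); last by rewrite /C; ring.
    rewrite ler_pdivlMr//; apply: le_trans H.
    by rewrite ler_wpM2l.
  split.
  - exact: (slope _ _ _ _ gx0 X X0).
  - exact: (slope _ _ _ _ gy0 Y Y0).
  have Hg z : `|z - s0| <= h -> [/\ `|vx g z - vx g s0| <= eps, `|vy g z - vy g s0| <= eps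
      & `|vz g z - vz g s0| <= eps].
    by move=> q; have [] := hh0 _ hs0 z (le_trans q hh).
  have Hd z : `|z - t0| <= h -> [/\ `|vx d z - vx d t0| <= eps, `|vy d z - vy d t0| <= eps
      & `|vz d z - vz d t0| <= eps].
    by move=> q; have [] := hh0 _ ht0 z (le_trans q hh).
  have Fg := cell_form sg n1 n2 n3 (ltW eps0) Hg lg' ss.
  have Fd := cell_form sd n1 n2 n3 (ltW eps0) Hd ld' tt.
  (* Since the form kills [(x0, y0, 1)], its value on the increment of [r] is [rz] times its value
     on the increment of the slopes; [cell_form] bounds the former. *)
  have F : `|(l_1 * (x - x0) + l_2 * (y - y0)) * rz g d s t| <= 8 * eps * h.
    have -> : (l_1 * (x - x0) + l_2 * (y - y0)) * rz g d s t =
      (l_1 * (cx g s - cx g s0) + l_2 * (cy g s - cy g s0) + l_3 * (cz g s - cz g s0)) -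
      (l_1 * (cx d t - cx d t0) + l_2 * (cy d t - cy d t0) + l_3 * (cz d t - cz d t0)).
      transitivity (l_1 * (rx g d s t - rx g d s0 t0) + l_2 * (ry g d s t - ry g d s0 t0)
        + l_3 * (rz g d s t - rz g d s0 t0)); last by rewrite /rx /ry /rz; ring.
      by rewrite X Y X0 Y0 /l_3; ring.
    by apply: le_trans (ler_normB _ _) _; lra.
  have {}F : `|l_1 * (x - x0) + l_2 * (y - y0)| <= eta.
    rewrite /eta ler_pdivlMr//; apply: le_trans F.
    by rewrite normrM ler_wpM2l.
  move: F; rewrite /l_1 /l_2; case: (b) => F.
    by rewrite (_ : _ - _ = 1 * (x - x0) + l * (y - y0)); last by rewrite /y; ring.
  by rewrite (_ : _ - _ = l * (x - x0) + 1 * (y - y0)); last by rewrite /x; ring.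
have := card_fibers fib; rewrite !card_prod !card_ord !natrM => H.
have E : N%:R * N%:R * ((2 * eta * K%:R + 1) * (2 * (C * h) * K%:R + 1)) =
    (gam * K%:R + N%:R) * (bet * K%:R + N%:R).
  transitivity ((16 * eps * (h * N%:R) / (m / 2) * K%:R + N%:R) * (2 * C * (h * N%:R) * K%:R + N%:R)).
    by rewrite /eta; ring.
  rewrite hN /bet; congr (_ * _); last by ring.
  congr (_ * _ + _); rewrite /eps; field.
  by rewrite !gt_eqF.
move: H; rewrite E => H.
have g1 : gam * (bet + 1) = 4^-1.
  by rewrite /gam invfM mulrAC -mulrA mulfV ?mulr1// gt_eqF//; lra.
have : (gam * K%:R + N%:R) * (bet * K%:R + N%:R) <= (2 * gam * K%:R) * ((bet + 1) * K%:R).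
  apply: ler_pM.
  - by rewrite addr_ge0// mulr_ge0// ltW.
  - by rewrite addr_ge0// mulr_ge0// ltW.
  - by lra.
  rewrite mulrDl mul1r lerD2l; apply: le_trans NK _; rewrite ler_piMl//.
  rewrite /gam invf_le1; [lra|lra].
have -> : 2 * gam * K%:R * ((bet + 1) * K%:R) = 2 * (gam * (bet + 1)) * (K%:R * K%:R) by ring.
rewrite g1; have : 0 < (K%:R : R) * K%:R by rewrite mulr_gt0.
lra.
Unshelve. all: by end_near. Qed.

End sard.

(** * Curves in space *)

Section vectors.
Context {R : realType}.
Implicit Types (x y z u w p q : 'rV[R]_3) (a b : R).

Lemma ord3_cases (P : 'I_3 -> Prop) : P 0 -> P 1 -> P 2 -> forall i, P i.
Proof.
move=> P0 P1 P2 i.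
have : i \in [:: 0; 1; 2] by case: i => -[|[|[|]]].
by rewrite !inE => /or3P[] /eqP->.
Qed.

Lemma dotE x y : dot x y = x 0 0 * y 0 0 + x 0 1 * y 0 1 + x 0 2 * y 0 2.
Proof.
rewrite /dot !big_ord_recr big_ord0 /= add0r.
by congr (_ * _ + _ * _ + _ * _); congr (_ _ _); apply: val_inj.
Qed.

Lemma cross0 x y : cross x y 0 0 = x 0 1 * y 0 2 - x 0 2 * y 0 1.
Proof. by rewrite mxE !add0r. Qed.

Lemma cross1 x y : cross x y 0 1 = x 0 2 * y 0 0 - x 0 0 * y 0 2.
Proof.
rewrite mxE (_ : 1 + 1 = 2 :> 'I_3); last exact: val_inj.
by rewrite (_ : 1 + 2 = 0 :> 'I_3); last exact: val_inj.
Qed.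

Lemma cross2 x y : cross x y 0 2 = x 0 0 * y 0 1 - x 0 1 * y 0 0.
Proof.
rewrite mxE (_ : 2 + 1 = 0 :> 'I_3); last exact: val_inj.
by rewrite (_ : 2 + 2 = 1 :> 'I_3); last exact: val_inj.
Qed.

Lemma rv3P x y : x 0 0 = y 0 0 -> x 0 1 = y 0 1 -> x 0 2 = y 0 2 -> x = y.
Proof. by move=> h0 h1 h2; apply/rowP; apply: ord3_cases. Qed.

Lemma addE x y i : (x + y) 0 i = x 0 i + y 0 i. Proof. by rewrite mxE. Qed.
Lemma oppE x i : (- x) 0 i = - x 0 i. Proof. by rewrite mxE. Qed.
Lemma scaleE a x i : (a *: x) 0 i = a * x 0 i. Proof. by rewrite mxE. Qed.
Lemma zeroE i : (0 : 'rV[R]_3) 0 i = 0. Proof. by rewrite mxE. Qed.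

Definition vecE := (dotE, cross0, cross1, cross2, addE, oppE, scaleE, zeroE).

Lemma dotC x y : dot x y = dot y x. Proof. rewrite !vecE; ring. Qed.
Lemma dotDl x y z : dot (x + y) z = dot x z + dot y z. Proof. rewrite !vecE; ring. Qed.
Lemma dotBl x y z : dot (x - y) z = dot x z - dot y z. Proof. rewrite !vecE; ring. Qed.
Lemma dotDr x y z : dot x (y + z) = dot x y + dot x z. Proof. rewrite !vecE; ring. Qed.
Lemma dotBr x y z : dot x (y - z) = dot x y - dot x z. Proof. rewrite !vecE; ring. Qed.
Lemma dotZl a x y : dot (a *: x) y = a * dot x y. Proof. rewrite !vecE; ring. Qed.
Lemma dotZr a x y : dot x (a *: y) = a * dot x y. Proof. rewrite !vecE; ring. Qed.
Lemma dot0l x : dot 0 x = 0. Proof. rewrite !vecE; ring. Qed.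

Lemma dot_ge0 x : 0 <= dot x x.
Proof. by rewrite dotE !addr_ge0// -expr2 sqr_ge0. Qed.

Lemma dot_eq0 x : (dot x x == 0) = (x == 0).
Proof.
apply/eqP/eqP => [|->]; last by rewrite dot0l.
rewrite dotE -!expr2 => /eqP; rewrite !paddr_eq0 ?addr_ge0 ?sqr_ge0// !sqrf_eq0.
by move=> /andP[/andP[/eqP h0 /eqP h1] /eqP h2]; apply: rv3P; rewrite ?vecE.
Qed.

Lemma dot_gt0 x : (0 < dot x x) = (x != 0).
Proof. by rewrite lt_def dot_ge0 andbT dot_eq0. Qed.

Definition frame p q w := [/\ dot p p = 1, dot q q = 1, dot p q = 0 & cross p q = w].

Lemma frameP p q w : frame p q w ->
  [/\ dot w w = 1, dot p w = 0, dot q w = 0, dot q p = 0 & dot w p = 0 /\ dot w q = 0].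
Proof.
move=> [pp qq pq <-].
have dpw : dot p (cross p q) = 0 by rewrite !vecE; ring.
have dqw : dot q (cross p q) = 0 by rewrite !vecE; ring.
split=> //; last by rewrite ![dot (cross _ _) _]dotC.
- rewrite (_ : dot _ _ = dot p p * dot q q - dot p q ^+ 2); first by rewrite pp qq pq; ring.
  by rewrite !vecE; ring.
- by rewrite dotC.
Qed.

Lemma frame_norm p q w x : frame p q w ->
  dot x p ^+ 2 + dot x q ^+ 2 + dot x w ^+ 2 = dot x x.
Proof.
move=> [pp qq pq <-].
have : dot x (cross p q) ^+ 2 = dot x x * (dot p p * dot q q - dot p q ^+ 2)
   - dot x p * (dot x p * dot q q - dot p q * dot x q)
   + dot x q * (dot x p * dot p q - dot p p * dot x q) by rewrite !vecE; ring.
by rewrite pp qq pq => ->; ring.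
Qed.

Lemma frame_det p q w x y z : frame p q w ->
  dot x p * (dot y q * dot z w - dot y w * dot z q)
  - dot x q * (dot y p * dot z w - dot y w * dot z p)
  + dot x w * (dot y p * dot z q - dot y q * dot z p) = dot x (cross y z).
Proof.
move=> fr; have [ww _ _ _ _] := frameP fr; have [_ _ _ wE] := fr.
transitivity (dot x (cross y z) * dot w w); last by rewrite ww mulr1.
by rewrite -wE !vecE; ring.
Qed.

Lemma frame_decomp p q w x : frame p q w -> x = dot x p *: p + dot x q *: q + dot x w *: w.
Proof.
move=> fr; have [ww pw qw qp [wp wq]] := frameP fr; have [pp qq pq _] := fr.
apply/eqP; rewrite -subr_eq0 -dot_eq0 -(frame_norm _ fr).
have e v : dot (x - (dot x p *: p + dot x q *: q + dot x w *: w)) v =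
    dot x v - (dot x p * dot p v + dot x q * dot q v + dot x w * dot w v).
  by rewrite !vecE; ring.
by rewrite !e pp qq pq qp pw qw wp wq ww; apply/eqP; ring.
Qed.

Lemma proj_frame p q w x : frame p q w -> Defs.proj w x = dot x p *: p + dot x q *: q.
Proof. by move=> fr; rewrite /Defs.proj {1}(frame_decomp x fr) addrK. Qed.

Lemma proj_eq0 p q w x : frame p q w ->
  (Defs.proj w x == 0) = (dot x p ^+ 2 + dot x q ^+ 2 == 0).
Proof.
move=> fr; rewrite (proj_frame _ fr) -dot_eq0; have [pp qq pq _] := fr.
congr (_ == _); transitivity (dot x p ^+ 2 * dot p p + dot x q ^+ 2 * dot q q
  + 2 * dot x p * dot x q * dot p q); first by rewrite !vecE; ring.
by rewrite pp qq pq; ring.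
Qed.

Lemma cross_proj p q w x y : frame p q w ->
  cross (Defs.proj w x) (Defs.proj w y) = (dot x p * dot y q - dot x q * dot y p) *: w.
Proof.
move=> fr; rewrite !(proj_frame _ fr); have [_ _ _ <-] := fr.
by apply: rv3P; rewrite !vecE; ring.
Qed.

Lemma frame_exists w : dot w w = 1 -> exists p q, frame p q w.
Proof.
move=> ww.
have [v v0] : exists v, cross w v != 0.
  apply: contrapT => h.
  have e v : cross w v = 0 by apply/eqP/negPn/negP => c; apply: h; exists v.
  have : dot w w = 0.
    have h0 := congr1 (fun M : 'rV[R]_3 => M 0 1) (e (delta_mx 0 2)).
    have h1 := congr1 (fun M : 'rV[R]_3 => M 0 2) (e (delta_mx 0 1)).
    have h2 := congr1 (fun M : 'rV[R]_3 => M 0 1) (e (delta_mx 0 0)).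
    move: h0 h1 h2; rewrite !vecE !mxE/= !mulr0 ?mulr1 ?subr0 ?sub0r => /eqP.
    rewrite oppr_eq0 => /eqP w0 h1 w2; move: h1; rewrite ?w0 ?w2.
    have := congr1 (fun M : 'rV[R]_3 => M 0 0) (e (delta_mx 0 2)).
    rewrite !vecE !mxE/= !mulr0 ?mulr1 ?subr0 => w1 _.
    by rewrite w1; ring.
  by rewrite ww => /eqP; rewrite oner_eq0.
pose n := Num.sqrt (dot (cross w v) (cross w v)).
have n0 : 0 < n by rewrite sqrtr_gt0 dot_gt0.
have nE : n ^+ 2 = dot (cross w v) (cross w v) by rewrite sqr_sqrtr// dot_ge0.
pose p := n^-1 *: cross w v.
have pp : dot p p = 1.
  by rewrite /p dotZl dotZr -nE; field; rewrite gt_eqF.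
have pw : dot p w = 0 by rewrite /p dotZl (_ : dot (cross w v) w = 0) ?mulr0//; rewrite !vecE; ring.
exists p, (cross w p); split=> //.
- rewrite (_ : dot _ _ = dot w w * dot p p - dot p w ^+ 2); first by rewrite ww pp pw; ring.
  by rewrite !vecE; ring.
- by rewrite !vecE; ring.
- transitivity (dot p p *: w - dot p w *: p).
    by apply: rv3P; rewrite !vecE; ring.
  by rewrite pp pw scale1r scale0r subr0.
Qed.

End vectors.

Section vector_curves.
Context {R : realType}.
Implicit Types (G V D W : R -> 'rV[R]_3) (p q w v : 'rV[R]_3) (L t s : R).

(** Derivatives are taken coordinate by coordinate, which gives access to the scalar rules;
    [vderivP] and [is_derive_vderiv] translate to and from vector-valued derivatives. *)
Definition vderiv G t (l : 'rV[R]_3) := forall i, is_derive t 1 (fun t => G t 0 i) (l 0 i).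

Definition vsmooth G V := (forall t, vderiv G t (V t)) /\ (forall i, continuous (fun t => V t 0 i)).

Definition vperiodic L G V := forall t, G (t + L) = G t /\ V (t + L) = V t.

Lemma vderivP G t l : vderiv G t l -> is_derive t 1 G l.
Proof.
move=> h; have dG : derivable G t 1 by apply/derivable_mxP => i j; rewrite (ord1 i); apply: ex_derive.
apply: DeriveDef => //; rewrite derive_mx//; apply/matrixP => i j; rewrite mxE (ord1 i).
exact: derive_val.
Qed.

Lemma vderiv_derive1 G t l : vderiv G t l -> derive1 G t = l.
Proof. by move=> /vderivP h; rewrite derive1E; apply: derive_val. Qed.

Lemma vderiv_dot G t l v : vderiv G t l -> is_derive t 1 (fun t => dot (G t) v) (dot l v).
Proof.
move=> h; rewrite (_ : (fun t => _) =
  (fun t => v 0 0 * G t 0 0 + v 0 1 * G t 0 1 + v 0 2 * G t 0 2)); last first.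
  by apply/funext => x; rewrite dotE; ring.
apply: is_derive_eq (deriveA (deriveA (deriveK _ (h 0)) (deriveK _ (h 1))) (deriveK _ (h 2))) _.
by rewrite dotE; ring.
Qed.

Lemma vderiv_proj G t l w : vderiv G t l -> vderiv (Defs.proj w \o G) t (Defs.proj w l).
Proof.
move=> h i; rewrite (_ : (fun t => _) = (fun t => G t 0 i - w 0 i * dot (G t) w)); last first.
  by apply/funext => x; rewrite /= /Defs.proj !vecE; ring.
apply: is_derive_eq (deriveS (h i) (deriveK _ (vderiv_dot w h))) _.
by rewrite /Defs.proj !vecE; ring.
Qed.

Definition curve_in p q w G V : curve R :=
  Curve (fun t => dot (G t) p) (fun t => dot (G t) q) (fun t => dot (G t) w)
        (fun t => dot (V t) p) (fun t => dot (V t) q) (fun t => dot (V t) w).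

Lemma cont_dot (T : topologicalType) (F H : T -> 'rV[R]_3) (x : T) :
  (forall i, {for x, continuous (fun y : T => F y 0 i)}) ->
  (forall i, {for x, continuous (fun y : T => H y 0 i)}) ->
  {for x, continuous (fun y : T => dot (F y) (H y))}.
Proof.
move=> cF cH; have := cF 0; have := cF 1; have := cF 2; have := cH 0; have := cH 1; have := cH 2.
move=> ? ? ? ? ? ?.
rewrite (_ : (fun y => _) = (fun y => F y 0 0 * H y 0 0 + F y 0 1 * H y 0 1 + F y 0 2 * H y 0 2)).
  by cont.
by apply/funext => y; rewrite dotE.
Qed.

Lemma smooth_curve_in p q w G V : vsmooth G V -> smooth (curve_in p q w G V).
Proof.
move=> [dG cV]; have c v : continuous (fun t => dot (V t) v).
  by move=> t; apply: cont_dot => i; [exact: cV|exact: contC].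
by split; [move=> t; exact: vderiv_dot..|split; exact: c].
Qed.

Lemma periodic_curve_in p q w L G V : vperiodic L G V -> periodic_curve L (curve_in p q w G V).
Proof. by move=> h; split; split=> t /=; have [h1 h2] := h t; rewrite ?h1 ?h2. Qed.

Definition vsolid G V D W s t :=
  dot (G s - D t) (cross (V s) (W t)) / Num.sqrt (dot (G s - D t) (G s - D t)) ^+ 3.

Definition vtotal L G V D W := integ 0 L (fun s => integ 0 L (vsolid G V D W s)).

Section in_frame.
Context (p q w : 'rV[R]_3) (fr : frame p q w) (G V D W : R -> 'rV[R]_3).
Let g := curve_in p q w G V.
Let d := curve_in p q w D W.

Lemma rx_in s t : rx g d s t = dot (G s - D t) p. Proof. by rewrite dotBl. Qed.
Lemma ry_in s t : ry g d s t = dot (G s - D t) q. Proof. by rewrite dotBl. Qed.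
Lemma rz_in s t : rz g d s t = dot (G s - D t) w. Proof. by rewrite dotBl. Qed.

Lemma rho_in s t : rho (rx g d s t) (ry g d s t) (rz g d s t) =
  Num.sqrt (dot (G s - D t) (G s - D t)).
Proof. by rewrite /rho rx_in ry_in rz_in (frame_norm _ fr). Qed.

Lemma rho_in_gt0 : (forall s t, G s != D t) ->
  forall s t, 0 < rho (rx g d s t) (ry g d s t) (rz g d s t).
Proof. by move=> h s t; rewrite rho_in sqrtr_gt0 dot_gt0 subr_eq0. Qed.

(** The left side is computed in a frame adapted to a direction, the right side mentions none.
    Counts of crossings along different directions are compared through this equality. *)
Lemma total_angle_in L : total_angle g d L = vtotal L G V D W.
Proof.
apply: eq_int => s _; apply: eq_int => t _.
by rewrite /solid rho_in rx_in ry_in rz_in (frame_det _ _ _ fr).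
Qed.

Lemma planar_in s t : (planar g d s t == 0) = (Defs.proj w (G s) == Defs.proj w (D t)).
Proof.
rewrite /planar rx_in ry_in -(proj_eq0 _ fr) -[RHS]subr_eq0; congr (_ == _).
by rewrite /Defs.proj dotBl; apply: rv3P; rewrite !vecE; ring.
Qed.

Lemma planar_cross_in s t : planar_cross g d s t = dot (cross (V s) (W t)) w.
Proof. by rewrite /planar_cross/= !vecE; have [_ _ _ <-] := fr; rewrite !vecE; ring. Qed.

Lemma cross_proj_dot x y : dot (cross (Defs.proj w x) (Defs.proj w y)) w = dot (cross x y) w.
Proof.
rewrite (cross_proj _ _ fr) dotZl; have [-> _ _ _ _] := frameP fr.
by have [_ _ _ <-] := fr; rewrite !vecE; ring.
Qed.

Lemma cross_proj_neq0 x y :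
  (cross (Defs.proj w x) (Defs.proj w y) != 0) = (dot (cross x y) w != 0).
Proof.
have [ww _ _ _ _] := frameP fr.
have w0 : w != 0 by rewrite -dot_eq0 ww oner_eq0.
by rewrite -cross_proj_dot (cross_proj _ _ fr) dotZl ww mulr1 scaler_eq0 (negbTE w0) orbF.
Qed.

End in_frame.

(** The parameter 0 is always a cut, whether or not it belongs to [X], so only the positive
    parameters are sorted into [S]. *)
Lemma sorted_window L (X : seq R) : 0 < L -> (forall x, x \in X -> 0 <= x < L) ->
  exists S, path <%R 0 (rcons S L) /\ (forall x, x \in X -> x \in 0 :: S).
Proof.
move=> L0 h; exists (sort <=%R (undup [seq x <- X | 0 < x])); split.
  rewrite rcons_path path_sortedE; last exact: lt_trans.
  rewrite sort_lt_sorted undup_uniq andbT; apply/andP; split.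
    by apply/allP => x; rewrite mem_sort mem_undup mem_filter => /andP[].
  have := mem_last 0 (sort <=%R (undup [seq x <- X | 0 < x])).
  rewrite inE => /predU1P[->//|]; rewrite mem_sort mem_undup mem_filter => /andP[_ /h].
  by move=> /andP[].
move=> x xX; have /andP[x0 _] := h x xX.
rewrite inE mem_sort mem_undup mem_filter xX andbT.
by move: x0; rewrite le_eqVlt => /predU1P[<-|->]; rewrite ?eqxx// orbT.
Qed.

Lemma path_window L (S : seq R) x : path <%R 0 (rcons S L) -> x \in 0 :: S -> 0 <= x < L.
Proof.
move=> hp; have hpw : pairwise <%R (rcons (0 :: S) L).
  by rewrite -sorted_pairwise//; exact: lt_trans.
move: (hpw); rewrite pairwise_rcons => /andP[/allP SL _] xS; rewrite [x < L]SL// andbT.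
move: xS hpw; rewrite inE => /predU1P[->//|xS]; rewrite rcons_cons /= => /andP[/allP h _].
by apply/ltW/h; rewrite mem_rcons inE xS orbT.
Qed.

(** Brings the crossing sums to the form of the degree formula, a full double sum over the grid, so
    that the two can be compared term by term. *)
Lemma fsum_pairs (A : set (R * R)) (S : seq R) (f : R * R -> R) : uniq S ->
  (forall st, A st -> st.1 \in S /\ st.2 \in S) ->
  \sum_(st \in A) f st = \sum_(a <- S) \sum_(b <- S) (if `[< A (a, b) >] then f (a, b) else 0).
Proof.
move=> uS h.
pose g st := if `[< A st >] then f st else 0.
rewrite (eq_fsbigr g); last by move=> st; rewrite inE => Ast; rewrite /g asboolT.
rewrite (fsbig_widen A [set` [seq (a, b) | a <- S, b <- S]] g).
- rewrite -fsbig_seq; first by rewrite big_allpairs_dep.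
  by rewrite allpairs_uniq// => -[a b] [a' b'].
- by move=> [a b] /h/= [aS bS]; apply/allpairsP; exists (a, b).
- by move=> st [_ nA]; rewrite /= /g asboolF.
Qed.

Lemma sg_neq0_if (x y : R) : x != 0 ->
  Num.sg x * Num.sg y = (if 0 < x then Num.sg y else 0) + (if x < 0 then - Num.sg y else 0).
Proof. by case: sgrP => // _ _; rewrite ?mul1r ?mulN1r ?addr0 ?add0r. Qed.

(** A zero of the planar difference at [(a, b)] is a crossing with [G] above if [z > 0], and one
    with [D] above if [z < 0]. In the second case exchanging the strands reverses the cross product,
    which reproduces the sign of [z] in the degree formula. *)
Lemma crossing_total L G V D W w : 0 < L -> vsmooth G V -> vsmooth D W ->
  vperiodic L G V -> vperiodic L D W -> (forall s t, G s != D t) ->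
  generic_direction L G D w ->
  vtotal L G V D W = (signed_overcrossings L w G D + signed_overcrossings L w D G) * (2 * pi).
Proof.
move=> L0 sG sD pG pD GD [ww fin tr].
have [p [q fr]] := frame_exists ww.
set X := [set st : R * R | _] in fin tr.
have [|S [hp hS]] := @sorted_window L ([seq st.1 | st <- fset_set X] ++ [seq st.2 | st <- fset_set X]) L0.
  move=> x; rewrite mem_cat => /orP[] /mapP[st]; rewrite in_fset_set// inE => -[h1 h2 _] ->;
    by rewrite ?h1 ?h2.
have XS st : X st -> st.1 \in 0 :: S /\ st.2 \in 0 :: S.
  move=> Xst; have st' : st \in fset_set X by rewrite in_fset_set// inE.
  by split; apply: hS; rewrite mem_cat map_f ?orbT.
have uS : uniq (0 :: S).
  have : sorted <%R (0 :: S) by move: hp; rewrite rcons_path => /andP[].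
  exact: sorted_uniq lt_trans ltxx _.
pose g := curve_in p q w G V; pose d := curve_in p q w D W.
have dG s : derive1 (Defs.proj w \o G) s = Defs.proj w (V s).
  by apply: vderiv_derive1; apply: vderiv_proj; exact: sG.1.
have dD s : derive1 (Defs.proj w \o D) s = Defs.proj w (W s).
  by apply: vderiv_derive1; apply: vderiv_proj; exact: sD.1.
have r0 : forall s t, 0 < rho (rx g d s t) (ry g d s t) (rz g d s t).
  by move=> s t; exact: rho_in_gt0.
rewrite -(total_angle_in fr).
rewrite (generic_degree (smooth_curve_in p q w sG) (smooth_curve_in p q w sD)
  (periodic_curve_in p q w pG) (periodic_curve_in p q w pD) L0 r0 hp); last first.
  move=> s t hs ht q0.
  have Xst : X (s, t).
    by split=> //; apply/eqP; rewrite -(planar_in fr G V D W) q0.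
  have [sS tS] := XS _ Xst; split=> //.
  by have := tr _ Xst; rewrite /= dG dD (cross_proj_neq0 fr) (planar_cross_in fr).
have H1 st : overcrossings L w G D st -> st.1 \in 0 :: S /\ st.2 \in 0 :: S.
  by move=> [h1 h2 h3 _]; apply: XS.
have H2 st : overcrossings L w D G st -> st.1 \in 0 :: S /\ st.2 \in 0 :: S.
  by move=> [h1 h2 h3 _]; have [] := XS (st.2, st.1).
have O1 : signed_overcrossings L w G D = _ := fsum_pairs (crossing_sign w G D) uS H1.
have O2 : signed_overcrossings L w D G = _ := fsum_pairs (crossing_sign w D G) uS H2.
rewrite O1 O2.
rewrite [X in _ = (_ + X) * _]exchange_big/= -big_split/= mulr_suml.
apply: eq_big_seq => a aS; rewrite -big_split/= mulr_suml.
apply: eq_big_seq => b bS.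
have ha := path_window hp aS; have hb := path_window hp bS.
have E1 : `[< overcrossings L w G D (a, b) >] = (planar g d a b == 0) && (0 < rz g d a b).
  rewrite (planar_in fr) rz_in dotBl subr_gt0; apply/asboolP/andP => [[_ _ /= -> ->]|[/eqP e1 e2]].
    by rewrite eqxx.
  by split.
have E2 : `[< overcrossings L w D G (b, a) >] = (planar g d a b == 0) && (rz g d a b < 0).
  rewrite (planar_in fr) rz_in dotBl subr_lt0; apply/asboolP/andP => [[_ _ /= -> ->]|[/eqP e1 e2]].
    by rewrite eqxx.
  by split.
have C1 : crossing_sign w G D (a, b) = Num.sg (planar_cross g d a b).
  by rewrite /crossing_sign/= dG dD (cross_proj_dot fr) (planar_cross_in fr).
have C2 : crossing_sign w D G (b, a) = - Num.sg (planar_cross g d a b).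
  rewrite /crossing_sign/= dG dD (cross_proj_dot fr) (planar_cross_in fr) -sgrN; congr (Num.sg _).
  by rewrite !vecE; ring.
rewrite E1 E2 C1 C2; case: eqP => [q0|_]; last by rewrite !addr0 mul0r.
have z0 : rz g d a b != 0.
  have := r0 a b; rewrite rho_gt0 -/(planar g d a b) q0 add0r.
  by apply: contraTneq => ->; rewrite expr0n ltxx.
by rewrite sg_neq0_if.
Qed.

End vector_curves.

(** * Generic directions and homotopies *)

(* The finite sets, ordered by inclusion, form a filter base; compactness applied
   to this filter gives a finite set containing all the isolated points. *)
Lemma finite_isolated (T : topologicalType) (K Z : set T) : compact K ->
  (forall x, K x -> \forall y \near x, Z y -> y = x) -> finite_set (K `&` Z).
Proof.
move=> /compact_near_coveringP cK h.
pose F : set_system (seq T) := 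
  [set U | exists A0 : seq T, forall A : seq T, {subset A0 <= A} -> U A].
have FF : Filter F.
  split.
  - by exists [::].
  - move=> P Q [A hA] [B hB]; exists (A ++ B) => C hC.
    by split; [apply: hA|apply: hB] => x xA; apply: hC; rewrite mem_cat xA ?orbT.
  - by move=> P Q PQ [A hA]; exists A => C /hA; exact: PQ.
have H x : K x -> \forall x' \near x & A \near F, Z x' -> x' \in A.
  move=> Kx; exists ([set y | Z y -> y = x], [set A : seq T | x \in A]) => /=.
    split; first exact: h.
    by exists [:: x] => A; apply; rewrite mem_head.
  by move=> [y A]/= [h1 h2] /h1 ->.
have [A0 hA0] := cK _ F (fun A x => Z x -> x \in A) FF H.
apply: (@sub_finite_set _ _ [set` A0]); last exact: finite_seq.
by move=> x [Kx Zx] /=; apply: hA0.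
Qed.

Section generic_directions.
Context {R : realType}.
Implicit Types (g d : curve R) (G V D W : R -> 'rV[R]_3) (p q w : 'rV[R]_3) (L a b s t : R).

Lemma derive_near (f : R -> R) a l e : is_derive a 1 f l -> 0 < e ->
  \forall s \near a, `|f s - f a - l * (s - a)| <= e * `|s - a|.
Proof. by move=> /is_derive_epsP; apply. Qed.

(** At another zero close to [(a, b)], Cramer's rule applied to the linear approximation would bound
    each of [|s - a|] and [|t - b|] by a quarter of their sum. *)
Lemma isolated_zero g d a b : smooth g -> smooth d ->
  (planar g d a b = 0 -> planar_cross g d a b != 0) ->
  \forall p \near (a, b), planar g d p.1 p.2 = 0 -> p = (a, b).
Proof.
move=> sg sd tr; have [cX cY _ _] := cont_curves sg sd a b.
have [q0|q0] := eqVneq (planar g d a b) 0; last first.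
  have cq : continuous2_at (planar g d) a b.
    by rewrite /continuous2_at /planar in cX cY *; cont.
  have q0' : 0 < `|planar g d a b| / 2 by rewrite divr_gt0// normr_gt0.
  have /cvgrPdist_le/(_ _ q0') := cq; apply: filterS => -[s t]/= h h0.
  by exfalso; move: h q0'; rewrite h0 subr0; move: (Num.norm _) => m; clear; lra.
have c0 := tr q0.
have [X0 Y0] : rx g d a b = 0 /\ ry g d a b = 0.
  move: q0 => /eqP; rewrite /planar paddr_eq0 ?sqr_ge0// !sqrf_eq0.
  by move=> /andP[/eqP-> /eqP->].
have [x1 y1 _ _] := sg; have [x2 y2 _ _] := sd.
pose D := `|planar_cross g d a b|.
pose N := `|vx g a| + `|vy g a| + `|vx d b| + `|vy d b|.
have N0 : 0 <= N by rewrite !addr_ge0.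
have D0 : 0 < D by rewrite normr_gt0.
pose eta := D / 4 / (N + 1).
have Dp : 0 < D / 4 by rewrite divr_gt0.
have eta0 : 0 < eta by rewrite divr_gt0//; lra.
have etaN : eta * N <= D / 4 by exact: frac_le.
have h1 := derive_near (x1 a) eta0; have h2 := derive_near (y1 a) eta0.
have h3 := derive_near (x2 b) eta0; have h4 := derive_near (y2 b) eta0.
exists ([set s | `|cx g s - cx g a - vx g a * (s - a)| <= eta * `|s - a| /\
                 `|cy g s - cy g a - vy g a * (s - a)| <= eta * `|s - a|],
        [set t | `|cx d t - cx d b - vx d b * (t - b)| <= eta * `|t - b| /\
                 `|cy d t - cy d b - vy d b * (t - b)| <= eta * `|t - b|]).
  by split; [exact: filterI|exact: filterI].
move=> [s t]/= [[H1 H2] [H3 H4]] p0.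
have [X1 Y1] : rx g d s t = 0 /\ ry g d s t = 0.
  move: p0 => /eqP; rewrite /planar paddr_eq0 ?sqr_ge0// !sqrf_eq0.
  by move=> /andP[/eqP-> /eqP->].
pose sig := `|s - a| + `|t - b|.
pose ex := (cx d t - cx d b - vx d b * (t - b)) - (cx g s - cx g a - vx g a * (s - a)).
pose ey := (cy d t - cy d b - vy d b * (t - b)) - (cy g s - cy g a - vy g a * (s - a)).
have Ex : `|ex| <= eta * sig by apply: le_trans (ler_normB _ _) _; rewrite /sig [leRHS]mulrDr [leRHS]addrC; exact: lerD.
have Ey : `|ey| <= eta * sig by apply: le_trans (ler_normB _ _) _; rewrite /sig [leRHS]mulrDr [leRHS]addrC; exact: lerD.
have ex' : ex = vx g a * (s - a) - vx d b * (t - b).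
  move: X0 X1; rewrite /rx /ex => e0 e1.
  have -> : cx d t = cx g s by lra.
  have -> : cx d b = cx g a by lra.
  by ring.
have ey' : ey = vy g a * (s - a) - vy d b * (t - b).
  move: Y0 Y1; rewrite /ry /ey => e0 e1.
  have -> : cy d t = cy g s by lra.
  have -> : cy d b = cy g a by lra.
  by ring.
have bound (u v : R) : `|u| + `|v| <= N -> `|u * ex + v * ey| <= D / 4 * sig.
  move=> uv; apply: le_trans (ler_normD _ _) _; rewrite !normrM.
  apply: (@le_trans _ _ ((`|u| + `|v|) * (eta * sig))).
    by rewrite mulrDl; apply: lerD; rewrite ler_wpM2l.
  rewrite mulrA ler_wpM2r ?addr_ge0//; apply: le_trans etaN.
  by rewrite mulrC ler_wpM2l// ltW.
have Bs : D * `|s - a| <= D / 4 * sig.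
  rewrite /D -normrM (_ : _ * _ = vy d b * ex + - vx d b * ey); last first.
    by rewrite ex' ey' /planar_cross; ring.
  apply: bound; rewrite normrN /N; have := normr_ge0 (vx g a); have := normr_ge0 (vy g a); lra.
have Bt : D * `|t - b| <= D / 4 * sig.
  rewrite /D -normrM (_ : _ * _ = vy g a * ex + - vx g a * ey); last first.
    by rewrite ex' ey' /planar_cross; ring.
  apply: bound; rewrite normrN /N; have := normr_ge0 (vx d b); have := normr_ge0 (vy d b); lra.
have : D * sig <= D / 2 * sig by rewrite {1}/sig mulrDr; lra.
rewrite -subr_ge0 -mulrBl (_ : D / 2 - D = - (D / 2)); last by lra.
rewrite mulNr oppr_ge0 pmulr_rle0; last by rewrite divr_gt0.
move=> s0; have : sig = 0 by apply/eqP; rewrite eq_le s0 addr_ge0.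
move/eqP; rewrite paddr_eq0// !normr_eq0 !subr_eq0.
by move=> /andP[/eqP-> /eqP->].
Qed.

(** A regular value [(x, y)] gives the direction [(x, y, 1)], here normalized. Regularity is
    transversality of every crossing along it, so the zeros are isolated, hence finite in number on
    the compact square. *)
Lemma generic_direction_exists L G V D W : 0 < L -> vsmooth G V -> vsmooth D W ->
  (forall s t, G s != D t) -> exists w, generic_direction L G D w.
Proof.
move=> L0 sG sD GD.
pose e0 : 'rV[R]_3 := delta_mx 0 0; pose e1 : 'rV[R]_3 := delta_mx 0 1.
pose e2 : 'rV[R]_3 := delta_mx 0 2.
have fr0 : frame e0 e1 e2.
  split; rewrite /e0 /e1 /e2 ?dotE ?mxE/= ?mulr0 ?mulr1 ?addr0 ?add0r//.
  by apply: rv3P; rewrite !vecE !mxE/= ?mulr0 ?mulr1 ?subr0 ?oppr0.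
have [x [y hxy]] := exists_regular_value (smooth_curve_in e0 e1 e2 sG)
  (smooth_curve_in e0 e1 e2 sD) L0 (rho_in_gt0 fr0 V W GD).
pose u := x *: e0 + y *: e1 + e2.
have [e00 e11 e01 _] := fr0; have [e22 e02 e12 e10 [e20 e21]] := frameP fr0.
have u0 : u != 0.
  apply/eqP => uz; have := congr1 (dot e2) uz.
  rewrite /u !dotDr !dotZr e20 e21 e22 [RHS]dotC dot0l => /eqP.
  by rewrite !mulr0 !add0r oner_eq0.
pose n := Num.sqrt (dot u u).
have n0 : 0 < n by rewrite sqrtr_gt0 dot_gt0.
have nE : n ^+ 2 = dot u u by rewrite sqr_sqrtr// dot_ge0.
pose w := n^-1 *: u.
have ww : dot w w = 1.
  by rewrite /w dotZl dotZr -nE; field; rewrite gt_eqF.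
have [p [q fr]] := frame_exists ww.
pose g := curve_in p q w G V; pose d := curve_in p q w D W.
have tr s t : 0 <= s <= L -> 0 <= t <= L -> planar g d s t = 0 -> planar_cross g d s t != 0.
  move=> hs ht /eqP; rewrite (planar_in fr) => /eqP pE.
  have rE : G s - D t = dot (G s - D t) w *: w.
    have e : G s = Defs.proj w (D t) + dot (G s) w *: w by rewrite -pE /Defs.proj subrK.
    rewrite dotBl scalerBl {1}e /Defs.proj; move: (dot _ _ *: _) (dot _ _ *: _) => x1 x2.
    by apply: rv3P; rewrite !vecE; ring.
  rewrite (planar_cross_in fr).
  have ru : G s - D t = (dot (G s - D t) w / n) *: u by rewrite {1}rE /w scalerA.
  have ue : [/\ dot u e0 = x, dot u e1 = y & dot u e2 = 1].
    by rewrite /u !dotDl !dotZl e00 e11 e22 e01 e02 e12 e10 e20 e21; split; ring.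
  have [ue0 ue1 ue2] := ue.
  have := hxy s t hs ht; rewrite !rx_in !ry_in !rz_in /volume !rx_in !ry_in !rz_in.
  rewrite (frame_det _ _ _ fr0) {1 2 3 4 5}ru !dotZl ue0 ue1 ue2 mulr1.
  rewrite [_ * x]mulrC [_ * y]mulrC => /(_ erefl erefl).
  rewrite mulf_eq0 negb_or => /andP[_]; apply: contra_neq => h.
  by move: h; rewrite dotC /w dotZl => /eqP; rewrite mulf_eq0 invr_eq0 gt_eqF//= => /eqP.
exists w; split=> //.
- pose K : set (R * R) := (`[0, L] `*` `[0, L])%classic.
  have cK : compact K by apply: compact_setX; exact: segment_compact.
  apply: (@sub_finite_set _ _ (K `&` [set st | planar g d st.1 st.2 = 0])).
    move=> [s t]/= [/andP[s0 /ltW sL] /andP[t0 /ltW tL] pE]; split.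
      by split; rewrite /= in_itv/= ?s0 ?t0.
    by apply/eqP; rewrite (planar_in fr) pE.
  apply: (finite_isolated cK) => -[a b] [/=]; rewrite !in_itv/= => ha hb.
  exact: isolated_zero (smooth_curve_in p q w sG) (smooth_curve_in p q w sD) (tr _ _ ha hb).
- move=> [s t]/= [/andP[s0 /ltW sL] /andP[t0 /ltW tL] pE].
  rewrite (vderiv_derive1 (vderiv_proj w (sG.1 s))) (vderiv_derive1 (vderiv_proj w (sD.1 t))).
  rewrite (cross_proj_neq0 fr) -(planar_cross_in fr G V D W); apply: tr; rewrite ?s0 ?t0//.
  by apply/eqP; rewrite (planar_in fr) pE.
Qed.

End generic_directions.

(** * Integrality and homotopy invariance of the integral *)

Section homotopies.
Context {R : realType}.
Implicit Types (L l s t : R) (G V : R -> 'rV[R]_3) (D W : R -> R -> 'rV[R]_3).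

Lemma cont_cross (T : topologicalType) (F H : T -> 'rV[R]_3) (x : T) :
  (forall i, {for x, continuous (fun y : T => F y 0 i)}) ->
  (forall i, {for x, continuous (fun y : T => H y 0 i)}) ->
  forall i, {for x, continuous (fun y : T => cross (F y) (H y) 0 i)}.
Proof.
move=> cF cH; have := cF 0; have := cF 1; have := cF 2; have := cH 0; have := cH 1; have := cH 2.
move=> ? ? ? ? ? ?; apply: ord3_cases.
- have -> : (fun y => cross (F y) (H y) 0 0) =
    (fun y => F y 0 1 * H y 0 2 - F y 0 2 * H y 0 1) by apply/funext => y; rewrite cross0.
  by cont.
- have -> : (fun y => cross (F y) (H y) 0 1) =
    (fun y => F y 0 2 * H y 0 0 - F y 0 0 * H y 0 2) by apply/funext => y; rewrite cross1.
  by cont.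
- have -> : (fun y => cross (F y) (H y) 0 2) =
    (fun y => F y 0 0 * H y 0 1 - F y 0 1 * H y 0 0) by apply/funext => y; rewrite cross2.
  by cont.
Qed.

Lemma signed_overcrossings_int L w (g d : R -> 'rV[R]_3) :
  signed_overcrossings L w g d \is a Num.int.
Proof.
rewrite /signed_overcrossings; apply: rpred_sum => st _.
by rewrite /crossing_sign; case: sgrP => _; rewrite ?rpredN ?rpred0 ?rpred1.
Qed.

(** Otherwise the intermediate value theorem would produce a half-integral value, [F a + 1 / 2]. *)
Lemma integral_constant (F : R -> R) (a b : R) : a <= b -> continuous F ->
  (forall x, F x \is a Num.int) -> F a = F b.
Proof.
move=> ab cF iF.
wlog Fab : F cF iF / F a <= F b.
  move=> h; have [/h-> //|/ltW ba] := leP (F a) (F b).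
  apply: oppr_inj; apply: (h (fun x => - F x)) => [x|x|]; rewrite ?rpredN ?lerN2//.
  by apply: contN; exact: cF.
apply/eqP; rewrite eq_le Fab/= leNgt; apply/negP => lt.
have gap : F a + 1 <= F b.
  move: (iF a) (iF b) lt => /intrP[m ->] /intrP[k ->].
  by rewrite ltr_int -(rmorphD _ m 1) ler_int -lezD1.
have [||c _ Fc] := @IVT R F a b (F a + 2^-1) ab.
- exact: continuous_subspaceT.
- by rewrite min_l// max_r//; apply/andP; split; lra.
have : (2^-1 : R) \is a Num.int.
  by rewrite (_ : 2^-1 = F c - F a) ?rpredB//; rewrite Fc; ring.
move=> /intrP[k hk].
have [|] := lerP k 0; first by rewrite -(lerz0 R) -hk; lra.
by rewrite gtz0_ge1 -(ler1z R) -hk; lra.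
Qed.

Lemma integral_multiple_constant (F : R -> R) (k a b : R) : k != 0 -> a <= b ->
  continuous F -> (forall x, exists2 z, z \is a Num.int & F x = z * k) -> F a = F b.
Proof.
move=> k0 ab cF iF; apply: (mulIf (invr_neq0 k0)).
apply: (@integral_constant (fun x => F x / k)) => // x.
  by apply: (@contM _ _ F (fun=> k^-1) x (cF x)); exact: contC.
by have [z iz ->] := iF x; rewrite mulfK.
Qed.

(** For each [l] some generic direction, which may change with [l], shows the integral to be an
    integral multiple of [2 * pi]; continuity in [l] does the rest. No crossing is followed during
    the homotopy. *)
Lemma vtotal_homotopy L G V D W : 0 < L -> vsmooth G V -> vperiodic L G V ->
  (forall l, vsmooth (D l) (W l)) -> (forall l, vperiodic L (D l) (W l)) ->
  (forall i, continuous (fun u : R * R => D u.1 u.2 0 i)) ->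
  (forall i, continuous (fun u : R * R => W u.1 u.2 0 i)) ->
  (forall l s t, G s != D l t) ->
  forall a b, vtotal L G V (D a) (W a) = vtotal L G V (D b) (W b).
Proof.
move=> L0 sG pG sD pD cD cW GD a b.
have L0' := ltW L0.
wlog ab : a b / a <= b.
  move=> h; have [ab|/ltW ba] := leP a b; first exact: h.
  exact (esym (h b a ba)).
have p0 : (2 * pi : R) != 0 by rewrite mulf_neq0// gt_eqF ?pi_gt0.
have step l : exists2 z, z \is a Num.int & vtotal L G V (D l) (W l) = z * (2 * pi).
  have [w gw] := generic_direction_exists L0 sG (sD l) (GD l).
  have E := crossing_total L0 sG (sD l) pG (pD l) (GD l) gw.
  exists (signed_overcrossings L w G (D l) + signed_overcrossings L w (D l) G) => //.
  by rewrite rpredD ?signed_overcrossings_int.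
apply: (@integral_multiple_constant (fun l => vtotal L G V (D l) (W l)) _ a b p0 ab _ step).
have cG i : continuous (fun s => G s 0 i) by move=> s; apply: derive_continuous (sG.1 s i).
move=> l.
apply: (int_continuous (f := fun l s => integ 0 L (vsolid G V (D l) (W l) s))) => //.
apply: (int_continuous (f := fun u t => vsolid G V (D u.1) (W u.1) u.2 t)) => //.
move=> [[{}l s] t].
have cF i : {for (l, s, t), continuous (fun u : R * R * R => (G u.1.2 - D u.1.1 u.2) 0 i)}.
  rewrite (_ : (fun u => _) = (fun u : R * R * R => G u.1.2 0 i - D u.1.1 u.2 0 i)); last first.
    by apply/funext => u; rewrite !mxE.
  apply: contA; [|apply: contN].
    apply: (@cont_comp_fst _ _ _ (fun v : R * R => G v.2 0 i)).
    by apply: (@cont_comp_snd _ _ _ (fun v : R => G v 0 i)); exact: cG.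
  apply: (@cont_comp2 _ _ _ _ (fun l t => D l t 0 i) (fun u : R * R * R => u.1.1) snd).
  - exact: cD.
  - by apply: (@cont_comp_fst _ _ _ fst); exact: cont_fst.
  - exact: cont_snd.
apply: (@contM _ _ (fun u : R * R * R => dot (G u.1.2 - D u.1.1 u.2) (cross (V u.1.2) (W u.1.1 u.2)))
  (fun u : R * R * R => (Num.sqrt (dot (G u.1.2 - D u.1.1 u.2) (G u.1.2 - D u.1.1 u.2)) ^+ 3)^-1)).
  apply: cont_dot => // i; apply: cont_cross => {}i.
  - apply: (@cont_comp_fst _ _ _ (fun v : R * R => V v.2 0 i)).
    by apply: (@cont_comp_snd _ _ _ (fun v : R => V v 0 i)); exact: sG.2.
  - apply: (@cont_comp2 _ _ _ _ (fun l t => W l t 0 i) (fun u : R * R * R => u.1.1) snd).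
    + exact: cW.
    + by apply: (@cont_comp_fst _ _ _ fst); exact: cont_fst.
    + exact: cont_snd.
apply: contI; first by rewrite expf_neq0// gt_eqF// sqrtr_gt0 dot_gt0 subr_eq0.
by apply: contX; apply: contR; apply: cont_dot.
Qed.

End homotopies.

(** * Charts *)

Section maps_of_the_plane.
Context {R : realType}.
Implicit Types (F : 'rV[R]_2 -> 'rV[R]_3) (q : R -> 'rV[R]_2) (c : R -> 'rV[R]_3) (t : R).

Definition dx F x := 'D_(delta_mx 0 0) F x.
Definition dy F x := 'D_(delta_mx 0 1) F x.

Lemma ord2_cases (P : 'I_2 -> Prop) : P 0 -> P 1 -> forall i, P i.
Proof.
move=> P0 P1; case=> -[|[|//]] hi; first by rewrite (_ : Ordinal hi = 0) //; exact/val_inj.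
by rewrite (_ : Ordinal hi = 1) //; exact/val_inj.
Qed.

Lemma row2E (v : 'rV[R]_2) : v = v 0 0 *: delta_mx 0 0 + v 0 1 *: delta_mx 0 1.
Proof.
by apply/rowP; apply: ord2_cases; rewrite !mxE/= ?mulr1 ?mulr0 ?addr0 ?add0r.
Qed.

Lemma diff_row2 F x v : differentiable F x -> 'd F x v = v 0 0 *: dx F x + v 0 1 *: dy F x.
Proof. by move=> dF; rewrite /dx /dy !deriveE// {1}(row2E v) linearD !linearZ. Qed.

Lemma vderiv_comp F q t l1 l2 : differentiable F (q t) ->
  is_derive t 1 (fun s => q s 0 0) l1 -> is_derive t 1 (fun s => q s 0 1) l2 ->
  vderiv (F \o q) t (l1 *: dx F (q t) + l2 *: dy F (q t)).
Proof.
move=> dF q1 q2.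
have dq : derivable q t 1.
  apply/derivable_mxP => i j; rewrite (ord1 i); move: j.
  by apply: ord2_cases; exact: ex_derive.
have dq' : differentiable q t by exact/derivable1_diffP.
have dFq : differentiable (F \o q) t by exact: differentiable_comp.
have qE : 'D_1 q t = \row_j (if j == 0 then l1 else l2).
  rewrite derive_mx//; apply/matrixP => i j; rewrite !mxE (ord1 i); move: j.
  by apply: ord2_cases => /=; exact: derive_val.
have FqE : 'D_1 (F \o q) t = l1 *: dx F (q t) + l2 *: dy F (q t).
  by rewrite deriveE// diff_comp//= -(deriveE _ dq') qE diff_row2// !mxE.
have dFq1 : derivable (F \o q) t 1 by exact/derivable1_diffP.
move=> i; apply: DeriveDef; first by move: (dFq1) => /derivable_mxP; apply.
by rewrite -FqE derive_mx// mxE.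
Qed.

Lemma diff_near (V W : normedModType R) (f : V -> W) x e : differentiable f x -> 0 < e ->
  \forall y \near x, `|f y - f x - 'd f x (y - x)| <= e * `|y - x|.
Proof.
move=> df e0; have /eqaddoP/(_ e e0) h := diff_locally df.
have : (fun y => y - x) @ x --> (0 : V).
  by rewrite -[X in _ --> X](subrr x); apply: cvgB; [exact: cvg_id|exact: cvg_cst].
move=> /(_ _ h); rewrite !near_simpl/=; apply: filterS => y /=.
have -> : (f \o shift x - (cst (f x) + 'd f x)) (y - x) =
  f (y - x + x) - (f x + 'd f x (y - x)) by [].
by rewrite subrK opprD addrA.
Qed.

Lemma norm_row2_le (v : 'rV[R]_2) : `|v| <= `|v 0 0| + `|v 0 1|.
Proof.
rewrite {1}(row2E v); apply: le_trans (ler_normD _ _) _; rewrite !normrZ.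
have h i : `|delta_mx 0 i : 'rV[R]_2| <= 1.
  rewrite [leLHS]mx_normrE; apply: bigmax_le => // j _.
  by rewrite mxE; case: (_ && _); rewrite ?normr1 ?normr0.
by apply: lerD; rewrite ler_piMr.
Qed.

Lemma norm_row_entry n (v : 'rV[R]_n.+1) i : `|v 0 i| <= `|v|.
Proof.
rewrite [leRHS]mx_normrE.
by have := @le_bigmax _ _ _ 0 (fun ij : 'I_1 * 'I_n.+1 => `|v ij.1 ij.2|) (0, i).
Qed.

Lemma dot_le (v b : 'rV[R]_3) : `|dot v b| <= (`|b 0 0| + `|b 0 1| + `|b 0 2|) * `|v|.
Proof.
rewrite dotE !mulrDl; apply: le_trans (ler_normD _ _) _; apply: lerD.
  by apply: le_trans (ler_normD _ _) _; apply: lerD; rewrite normrM mulrC ler_wpM2l// norm_row_entry.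
by rewrite normrM mulrC ler_wpM2l// norm_row_entry.
Qed.

(** The basis dual to [v, w] inside the plane they span. *)
Definition dual1 (v w : 'rV[R]_3) :=
  (dot (cross v w) (cross v w))^-1 *: cross w (cross v w).
Definition dual2 (v w : 'rV[R]_3) :=
  (dot (cross v w) (cross v w))^-1 *: cross (cross v w) v.

Lemma dualP (v w : 'rV[R]_3) : cross v w != 0 ->
  [/\ dot v (dual1 v w) = 1, dot w (dual1 v w) = 0,
      dot v (dual2 v w) = 0 & dot w (dual2 v w) = 1].
Proof.
rewrite -dot_eq0 => mm; rewrite /dual1 /dual2 !(dotC v) !(dotC w) !dotZl.
have -> : dot (cross w (cross v w)) v = dot (cross v w) (cross v w) by rewrite !vecE; ring.
have -> : dot (cross (cross v w) v) w = dot (cross v w) (cross v w) by rewrite !vecE; ring.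
have -> : dot (cross w (cross v w)) w = 0 by rewrite !vecE; ring.
have -> : dot (cross (cross v w) v) v = 0 by rewrite !vecE; ring.
by rewrite mulVf// mulr0.
Qed.

Lemma dual_decomp (v w x : 'rV[R]_3) : cross v w != 0 -> dot x (cross v w) = 0 ->
  x = dot x (dual1 v w) *: v + dot x (dual2 v w) *: w.
Proof.
rewrite -dot_eq0 => mm vm; apply: (scalerI mm); rewrite scalerDr !scalerA.
rewrite /dual1 /dual2 ![dot x (_ *: _)]dotC !dotZl !mulrA divff// !mul1r.
transitivity (dot (cross w (cross v w)) x *: v + dot (cross (cross v w) v) x *: w
   + dot x (cross v w) *: cross v w).
  by apply: rv3P; rewrite !vecE; ring.
by rewrite vm scale0r addr0.
Qed.

(** [tilt] is the normal of the chart, not normalized; [coeff1] and [coeff2] read the coordinates of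
    a tangent vector in the basis of the partial derivatives. *)
Definition tilt F x := cross (dx F x) (dy F x).
Definition coeff1 F x := dual1 (dx F x) (dy F x).
Definition coeff2 F x := dual2 (dx F x) (dy F x).

Lemma tilt_neq0 F x : differentiable F x -> injective ('d F x) -> tilt F x != 0.
Proof.
move=> dF iF; apply/eqP => m0.
have main a b : a *: dx F x + b *: dy F x = 0 -> a = 0 /\ b = 0.
  move=> ab; have E : 'd F x (\row_j (if j == 0 then a else b)) = 'd F x 0.
    by rewrite (diff_row2 _ dF) !mxE/= ab linear0.
  by have /rowP v0 := iF _ _ E; have := v0 0; have := v0 1; rewrite !mxE/=.
have [] := main (dot (dx F x) (dy F x)) (- dot (dx F x) (dx F x)).
  transitivity (cross (dx F x) (tilt F x)); last first.
    by rewrite m0; move: (dx F x) => v; apply: rv3P; rewrite !vecE; ring.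
  by rewrite /tilt; move: (dx F x) (dy F x) => v w; apply: rv3P; rewrite !vecE; ring.
move=> _ /eqP; rewrite oppr_eq0 dot_eq0 => /eqP x0.
have [] := main 1 0; first by rewrite x0 scaler0 scale0r addr0.
by move/eqP; rewrite oner_eq0.
Qed.

Lemma norm_absorb (x y a b : R) : `|x - a| <= 4^-1 * (`|x| + `|y|) ->
  `|y - b| <= 4^-1 * (`|x| + `|y|) -> `|x| + `|y| <= 2 * (`|a| + `|b|).
Proof.
move=> h1 h2; have := ler_normD (x - a) a; have := ler_normD (y - b) b.
by rewrite !subrK; lra.
Qed.

Lemma norm_chain (d x y a b h : R) : d <= 2 * (`|x| + `|y|) ->
  `|x - a * h| <= 1 * `|h| -> `|y - b * h| <= 1 * `|h| ->
  d <= 2 * (`|a| + 1 + (`|b| + 1)) * `|h|.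
Proof.
move=> h0 h1 h2; have := ler_normD (x - a * h) (a * h).
have := ler_normD (y - b * h) (b * h); rewrite !subrK !normrM => k2 k1.
rewrite -mulrA; apply: le_trans h0 _; rewrite ler_pM2l// !mulrDl.
by move: h1 h2; rewrite !mul1r; lra.
Qed.

(* The dual basis gives a left inverse of the differential, so that the increments of
   [q] are bounded by those of [F \o q]. *)
Lemma lift_derive F q c t X : differentiable F (q t) -> tilt F (q t) != 0 ->
  {for t, continuous q} -> (\forall s \near t, F (q s) = c s) -> vderiv c t X ->
  is_derive t 1 (fun s => q s 0 0) (dot X (coeff1 F (q t))) /\
  is_derive t 1 (fun s => q s 0 1) (dot X (coeff2 F (q t))).
Proof.
move=> dF m0 cq qc cX; set x := q t.
have [b11 b12 b21 b22] := dualP m0.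
pose K1 := `|coeff1 F x 0 0| + `|coeff1 F x 0 1| + `|coeff1 F x 0 2|.
pose K2 := `|coeff2 F x 0 0| + `|coeff2 F x 0 1| + `|coeff2 F x 0 2|.
pose K := K1 + K2 + 1.
have [k1 k2] : 0 <= K1 /\ 0 <= K2 by split; rewrite !addr_ge0.
have [K0 K1K K2K] : [/\ 0 < K, K1 <= K & K2 <= K].
  by rewrite /K; split; [rewrite ltr_wpDl ?addr_ge0|rewrite -addrA lerDl addr_ge0|rewrite (addrC K1) -addrA lerDl addr_ge0].
pose B1 s := dot (c s) (coeff1 F x); pose B2 s := dot (c s) (coeff2 F x).
pose l1 := dot X (coeff1 F x); pose l2 := dot X (coeff2 F x).
have D1 : is_derive t 1 B1 l1 by exact: vderiv_dot.
have D2 : is_derive t 1 B2 l2 by exact: vderiv_dot.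
pose del s := `|q s 0 0 - x 0 0| + `|q s 0 1 - x 0 1|.
have ctq : c t = F x by rewrite (nbhs_singleton qc).
have approx e : 0 < e -> \forall s \near t,
    `|q s 0 0 - x 0 0 - (B1 s - B1 t)| <= e * del s /\
    `|q s 0 1 - x 0 1 - (B2 s - B2 t)| <= e * del s.
  move=> e0; have eK : 0 < e / K by rewrite divr_gt0.
  have := cq _ (diff_near dF eK); rewrite near_simpl/=.
  apply: filterS2 qc => s qs h.
  have est b j : dot (dx F x) b = (j == 0)%:R -> dot (dy F x) b = (j == 1)%:R ->
      (`|b 0 0| + `|b 0 1| + `|b 0 2|) <= K ->
      `|q s 0 j - x 0 j - (dot (c s) b - dot (c t) b)| <= e * del s.
    move=> h1 h2 bK.
    have -> : q s 0 j - x 0 j - (dot (c s) b - dot (c t) b) =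
        - dot (F (q s) - F x - 'd F x (q s - x)) b.
      have dE : dot ('d F x (q s - x)) b = q s 0 j - x 0 j.
        rewrite (diff_row2 _ dF); move: (dx F x) (dy F x) h1 h2 => v w h1 h2.
        rewrite dotDl (dotZl _ v) (dotZl _ w) h1 h2 !mxE.
        by move: (j); apply: ord2_cases; rewrite /= ?mulr1 ?mulr0 ?addr0 ?add0r.
      rewrite (dotBl _ ('d F x (q s - x))) dE (dotBl (F (q s))) qs ctq.
      by move: (dot _ _) (dot _ _) (q s 0 j) (x 0 j) => y1 y2 y3 y4; ring.
    rewrite normrN; apply: le_trans (dot_le _ _) _.
    apply: (@le_trans _ _ (K * (e / K * del s))); last by rewrite mulrA [K * _]mulrC divfK ?gt_eqF.
    apply: ler_pM => //.
    apply: le_trans h _; apply: ler_wpM2l; first exact: ltW.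
    by apply: le_trans (norm_row2_le _) _; rewrite !mxE.
  by split; [exact: (est _ 0 b11 b12 K1K)|exact: (est _ 1 b21 b22 K2K)].
(* With error factor 1/4 the error is absorbed in the left side: the increments of [q] are
   controlled by those of [c] before [q] is known to be differentiable. *)
have lip : \forall s \near t, del s <= 2 * (`|B1 s - B1 t| + `|B2 s - B2 t|).
  have e4 : 0 < (4^-1 : R) by rewrite invr_gt0.
  apply: filterS (approx _ e4) => s [h1 h2].
  exact: norm_absorb h1 h2.
pose C := 2 * (`|l1| + 1 + (`|l2| + 1)).
have C0 : 0 < C by rewrite /C mulr_gt0// !addr_gt0// ltr_wpDl.
have bnd : \forall s \near t, del s <= C * `|s - t|.
  have h1 := derive_near D1 ltr01; have h2 := derive_near D2 ltr01.
  apply: filterS3 lip h1 h2 => s h0 h1 h2.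
  exact: norm_chain h0 h1 h2.
have fin (f B : R -> R) (l : R) : is_derive t 1 B l ->
    (forall e, 0 < e -> \forall s \near t, `|f s - f t - (B s - B t)| <= e * del s) ->
    is_derive t 1 f l.
  move=> DB h; apply/is_derive_epsP => e e0.
  have e2 : 0 < e / 2 by rewrite divr_gt0.
  have eC : 0 < e / 2 / C by rewrite divr_gt0.
  have n1 := derive_near DB e2; have n2 := h _ eC.
  apply: filterS3 bnd n1 n2 => s m1 m2 m3.
  have -> : f s - f t - l * (s - t) = f s - f t - (B s - B t) + (B s - B t - l * (s - t)) by ring.
  apply: le_trans (ler_normD _ _) _.
  have : e / 2 / C * del s <= e / 2 * `|s - t|.
    apply: (@le_trans _ _ (e / 2 / C * (C * `|s - t|))); first by rewrite ler_wpM2l// ltW.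
    by rewrite mulrA divfK// gt_eqF.
  by move=> m4; rewrite [in leRHS](splitr e) mulrDl; exact: lerD (le_trans m3 m4) m2.
split; [apply: (fin _ B1)|apply: (fin _ B2)] => // e /approx; apply: filterS => s [] //.
Qed.

Lemma Ck_dx k (D : set 'rV[R]_2) F : Ck k.+1 D F -> Ck k D (dx F).
Proof. by case=> _; exact. Qed.

Lemma Ck_dy k (D : set 'rV[R]_2) F : Ck k.+1 D F -> Ck k D (dy F).
Proof. by case=> _; exact. Qed.

Lemma Ck_differentiable k (D : set 'rV[R]_2) F x : Ck k.+1 D F -> D x -> differentiable F x.
Proof. by case=> + _; exact. Qed.

Lemma Ck_continuous k (D : set 'rV[R]_2) F x i : Ck k D F -> D x ->
  {for x, continuous (fun y => F y 0 i)}.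
Proof.
move=> cF Dx; have c : {for x, continuous F}.
  case: k cF => [|k] cF; first exact: cF.
  exact: differentiable_continuous (Ck_differentiable cF Dx).
exact: (@cont_comp _ _ _ (fun v : 'rV[R]_3 => v 0 i) F x (@coord_continuous _ _ _ _ _ _) c).
Qed.

End maps_of_the_plane.

#[global] Opaque dx dy.

(** * Functions of class C^1 near a point *)

Section local_regularity.
Context {R : realType}.
Implicit Types (f g a b : R -> R) (F H : R -> 'rV[R]_3) (t s : R).

(** The derivative is given as a function on the whole line, of which only the values near [t] are
    constrained; this keeps the property stable under local equality and algebraic operations. *)
Definition C1at f t :=
  exists f' : R -> R, \forall s \near t, is_derive (s : R) 1 f (f' s) /\ {for s, continuous f'}.

Lemma C1at_eq f g t : (\forall s \near t, f s = g s) -> C1at f t -> C1at g t.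
Proof.
move=> /near_join fg [f' h]; exists f'; apply: filterS2 fg h => s fg [h1 h2].
by split=> //; apply: near_eq_is_derive h1.
Qed.

Lemma C1at_cst k t : C1at (fun=> k) t.
Proof. by exists (fun=> 0); near=> s; split; [exact: deriveC|exact: contC]. Unshelve. all: by end_near. Qed.

Lemma C1at_cont f t : C1at f t -> \forall s \near t, {for s, continuous f}.
Proof. by move=> [f']; apply: filterS => s [/derive_continuous]. Qed.

Lemma C1atD f g t : C1at f t -> C1at g t -> C1at (fun s => f s + g s) t.
Proof.
move=> [f' hf] [g' hg]; exists (fun s => f' s + g' s); apply: filterS2 hf hg => s [h1 h2] [k1 k2].
by split; [exact: (deriveA h1 k1)|exact: contA].
Qed.

Lemma C1atM f g t : C1at f t -> C1at g t -> C1at (fun s => f s * g s) t.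
Proof.
move=> [f' hf] [g' hg]; exists (fun s => f' s * g s + f s * g' s).
apply: filterS2 hf hg => s [h1 h2] [k1 k2].
split; first exact: (deriveP h1 k1).
have := derive_continuous h1; have := derive_continuous k1 => ? ?.
by cont.
Qed.

Lemma C1atN f t : C1at f t -> C1at (fun s => - f s) t.
Proof.
move=> /(C1atM (C1at_cst (-1) t)); apply: C1at_eq.
by near=> s; rewrite mulN1r.
Unshelve. all: by end_near. Qed.

Lemma C1atB f g t : C1at f t -> C1at g t -> C1at (fun s => f s - g s) t.
Proof. by move=> hf /C1atN hg; exact: C1atD. Qed.

Lemma C1atV f t : C1at f t -> f t != 0 -> C1at (fun s => (f s)^-1) t.
Proof.
move=> [f' hf] f0; exists (fun s => - f' s / f s ^+ 2).
have [/derive_continuous cf _] := nbhs_singleton hf.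
have n0 : \forall s \near t, f s != 0 by exact: (@cvgr_neq0 R R _ (nbhs t) _ f (f t) cf f0).
apply: filterS2 hf n0 => s [h1 h2] s0.
split; first exact: (deriveI s0 h1).
have := derive_continuous h1 => ?.
by cont; rewrite expf_neq0.
Qed.

Lemma C1at_sqrt f t : C1at f t -> 0 < f t -> C1at (fun s => Num.sqrt (f s)) t.
Proof.
move=> [f' hf] f0; exists (fun s => f' s / (2 * Num.sqrt (f s))).
have [/derive_continuous cf _] := nbhs_singleton hf.
have n0 : \forall s \near t, 0 < f s by exact: (@cvgr_gt R _ (nbhs t) _ f (f t) cf 0 f0).
apply: filterS2 hf n0 => s [h1 h2] s0.
split; first exact: (deriveR s0 h1).
have := derive_continuous h1 => ?.
by cont; rewrite mulf_neq0// gt_eqF// sqrtr_gt0.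
Qed.

Definition vC1at F t := forall i, C1at (fun s => F s 0 i) t.

Lemma vC1at_eq F H t : (\forall s \near t, F s = H s) -> vC1at F t -> vC1at H t.
Proof. by move=> FH h i; apply: C1at_eq (h i); apply: filterS FH => s ->. Qed.

Lemma C1at_dot F H t : vC1at F t -> vC1at H t -> C1at (fun s => dot (F s) (H s)) t.
Proof.
move=> hF hH; apply: (@C1at_eq (fun s => F s 0 0 * H s 0 0 + F s 0 1 * H s 0 1 + F s 0 2 * H s 0 2)).
  by near=> s; rewrite dotE.
by do ! apply: C1atD; apply: C1atM.
Unshelve. all: by end_near. Qed.

Lemma vC1at_cross F H t : vC1at F t -> vC1at H t -> vC1at (fun s => cross (F s) (H s)) t.
Proof.
move=> hF hH; apply: ord3_cases.
- apply: (@C1at_eq (fun s => F s 0 1 * H s 0 2 - F s 0 2 * H s 0 1)).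
    by near=> s; rewrite cross0.
  by apply: C1atB; apply: C1atM.
- apply: (@C1at_eq (fun s => F s 0 2 * H s 0 0 - F s 0 0 * H s 0 2)).
    by near=> s; rewrite cross1.
  by apply: C1atB; apply: C1atM.
- apply: (@C1at_eq (fun s => F s 0 0 * H s 0 1 - F s 0 1 * H s 0 0)).
    by near=> s; rewrite cross2.
  by apply: C1atB; apply: C1atM.
Unshelve. all: by end_near. Qed.

Lemma vC1atZ f F t : C1at f t -> vC1at F t -> vC1at (fun s => f s *: F s) t.
Proof.
move=> hf hF i; apply: (@C1at_eq (fun s => f s * F s 0 i)); last exact: C1atM.
by near=> s; rewrite mxE.
Unshelve. all: by end_near. Qed.

Lemma vC1atD F H t : vC1at F t -> vC1at H t -> vC1at (fun s => F s + H s) t.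
Proof.
move=> hF hH i; apply: (@C1at_eq (fun s => F s 0 i + H s 0 i)); last exact: C1atD.
by near=> s; rewrite mxE.
Unshelve. all: by end_near. Qed.

Lemma vC1at_smooth F : (forall t, vC1at F t) -> vsmooth F (derive1 F).
Proof.
move=> h; have hd t : vderiv F t (derive1 F t).
  have /choice[l hl] : forall i, exists x, is_derive t 1 (fun s => F s 0 i) x.
    by move=> i; have [f' /nbhs_singleton[? _]] := h t i; exists (f' t).
  have hv : vderiv F t (\row_i l i) by move=> i; rewrite mxE.
  by rewrite (vderiv_derive1 hv).
split=> // i t; have [f' hf] := h t i.
have [_ cf] := nbhs_singleton hf.
have eqf : \forall s \near t, f' s = derive1 F s 0 i.
  apply: filterS hf => s [h1 _].
  by rewrite -(@derive_val _ _ _ _ _ _ _ h1) -(@derive_val _ _ _ _ _ _ _ (hd s i)).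
rewrite /continuous_at -(nbhs_singleton eqf).
apply: cvg_trans cf; exact: near_eq_cvg.
Qed.

Lemma vC1at_comp (P : 'rV[R]_2 -> 'rV[R]_3) (q : R -> 'rV[R]_2) t :
  (\forall s \near t, differentiable P (q s)) ->
  (forall i, \forall s \near t, {for q s, continuous (fun x => dx P x 0 i)}) ->
  (forall i, \forall s \near t, {for q s, continuous (fun x => dy P x 0 i)}) ->
  (\forall s \near t, {for s, continuous q}) ->
  C1at (fun s => q s 0 0) t -> C1at (fun s => q s 0 1) t -> vC1at (P \o q) t.
Proof.
move=> dP cx cy cq [q1 h1] [q2 h2] i.
exists (fun s => q1 s * dx P (q s) 0 i + q2 s * dy P (q s) 0 i).
apply: filterS (filterI (filterI (filterI h1 h2) (filterI dP cq)) (filterI (cx i) (cy i))) =>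
  s [[[[d1 c1] [d2 c2]] [dPs cqs]] [cxs cys]].
have dPq := vderiv_comp dPs d1 d2.
have E (v w : 'rV[R]_3) : q1 s * v 0 i + q2 s * w 0 i = (q1 s *: v + q2 s *: w) 0 i.
  by rewrite !mxE.
split; first by rewrite E; exact (dPq i).
have cx' : {for s, continuous (fun u => dx P (q u) 0 i)}.
  exact: (@cont_comp _ _ _ (fun x => dx P x 0 i) q s cxs cqs).
have cy' : {for s, continuous (fun u => dy P (q u) 0 i)}.
  exact: (@cont_comp _ _ _ (fun x => dy P x 0 i) q s cys cqs).
exact (contA (contM c1 cx') (contM c2 cy')).
Qed.

(* Increments of the two equations form a linear system in the increments of [a] and [b],
   whose determinant is continuous: this is the implicit function theorem along a curve. *)
Lemma C1at_conic (A B C E F H a b : R -> R) t :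
  C1at A t -> C1at B t -> C1at C t -> C1at E t -> C1at F t -> C1at H t ->
  (\forall s \near t, {for s, continuous a} /\ {for s, continuous b}) ->
  (\forall s \near t, A s * a s ^+ 2 + B s * (a s * b s) + C s * b s ^+ 2 = 0 /\
                      E s * a s ^+ 2 + F s * (a s * b s) + H s * b s ^+ 2 = 1) ->
  (\forall s \near t, (2 * A s * a s + B s * b s) * (F s * a s + 2 * H s * b s)
     - (B s * a s + 2 * C s * b s) * (2 * E s * a s + F s * b s) != 0) ->
  C1at a t /\ C1at b t.
Proof.
move=> [A' hA] [B' hB] [C' hC] [E' hE] [F' hF] [H' hH] cab /near_join eqn det.
pose D s := (2 * A s * a s + B s * b s) * (F s * a s + 2 * H s * b s)
     - (B s * a s + 2 * C s * b s) * (2 * E s * a s + F s * b s).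
pose r1 s := A' s * a s ^+ 2 + B' s * (a s * b s) + C' s * b s ^+ 2.
pose r2 s := E' s * a s ^+ 2 + F' s * (a s * b s) + H' s * b s ^+ 2.
pose a' s := (r2 s * (B s * a s + 2 * C s * b s) - r1 s * (F s * a s + 2 * H s * b s)) / D s.
pose b' s := (r1 s * (2 * E s * a s + F s * b s) - r2 s * (2 * A s * a s + B s * b s)) / D s.
suff main : \forall s \near t, [/\ is_derive (s : R) 1 a (a' s), is_derive (s : R) 1 b (b' s),
    {for s, continuous a'} & {for s, continuous b'}].
  by split; [exists a'|exists b']; apply: filterS main => s [].
near=> s.
have [dA cA'] : is_derive s 1 A (A' s) /\ {for s, continuous A'} by near: s.
have [dB cB'] : is_derive s 1 B (B' s) /\ {for s, continuous B'} by near: s.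
have [dC cC'] : is_derive s 1 C (C' s) /\ {for s, continuous C'} by near: s.
have [dE cE'] : is_derive s 1 E (E' s) /\ {for s, continuous E'} by near: s.
have [dF cF'] : is_derive s 1 F (F' s) /\ {for s, continuous F'} by near: s.
have [dH cH'] : is_derive s 1 H (H' s) /\ {for s, continuous H'} by near: s.
have [ca cb] : {for s, continuous a} /\ {for s, continuous b} by near: s.
have D0 : D s != 0 by near: s.
have eqs : \forall r \near s, A r * a r ^+ 2 + B r * (a r * b r) + C r * b r ^+ 2 = 0 /\
                      E r * a r ^+ 2 + F r * (a r * b r) + H r * b r ^+ 2 = 1 by near: s.
have cA := derive_continuous dA; have cB := derive_continuous dB.
have cC := derive_continuous dC; have cE := derive_continuous dE.
have cF := derive_continuous dF; have cH := derive_continuous dH.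
have [e1 e2] := nbhs_singleton eqs.
(* Slope functions of the coefficients: [A r - A s = gA r * (r - s)] with [gA] continuous at [s],
   and likewise below. *)
have /is_derive1_caratheodory[gA [gA1 gA2 gA3]] := dA.
have /is_derive1_caratheodory[gB [gB1 gB2 gB3]] := dB.
have /is_derive1_caratheodory[gC [gC1 gC2 gC3]] := dC.
have /is_derive1_caratheodory[gE [gE1 gE2 gE3]] := dE.
have /is_derive1_caratheodory[gF [gF1 gF2 gF3]] := dF.
have /is_derive1_caratheodory[gH [gH1 gH2 gH3]] := dH.
(* [P] and [Q] are the factors of [a r - a s] and [b r - b s] in the increments of the two
   equations, and [S] collects the slopes of the coefficients. At [r = s] the determinant of the
   system is [D s]. *)
pose P1 r := A s * (a r + a s) + B s * b s.
pose Q1 r := B s * a r + C s * (b r + b s).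
pose P2 r := E s * (a r + a s) + F s * b s.
pose Q2 r := F s * a r + H s * (b r + b s).
pose S1 r := gA r * a r ^+ 2 + gB r * (a r * b r) + gC r * b r ^+ 2.
pose S2 r := gE r * a r ^+ 2 + gF r * (a r * b r) + gH r * b r ^+ 2.
pose Dr r := P1 r * Q2 r - Q1 r * P2 r.
have cP1 : {for s, continuous P1} by rewrite /P1; cont.
have cQ1 : {for s, continuous Q1} by rewrite /Q1; cont.
have cP2 : {for s, continuous P2} by rewrite /P2; cont.
have cQ2 : {for s, continuous Q2} by rewrite /Q2; cont.
have cS1 : {for s, continuous S1} by rewrite /S1; cont.
have cS2 : {for s, continuous S2} by rewrite /S2; cont.
have cDr : {for s, continuous Dr} by rewrite /Dr; cont.
have DrE : Dr s = D s by rewrite /Dr /D /P1 /P2 /Q1 /Q2; ring.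
have Dr0 : \forall r \near s, Dr r != 0 by apply: (@cvgr_neq0 R R _ (nbhs s) _ Dr (Dr s) cDr); rewrite DrE.
have cramer : \forall r \near s,
    a r - a s = (S2 r * Q1 r - S1 r * Q2 r) / Dr r * (r - s) /\
    b r - b s = (S1 r * P2 r - S2 r * P1 r) / Dr r * (r - s).
  apply: filterS2 eqs Dr0 => r [k1 k2] d0.
  have i1 : P1 r * (a r - a s) + Q1 r * (b r - b s) = - (S1 r * (r - s)).
    have := gA1 r; have := gB1 r; have := gC1 r => w3 w2 w1.
    transitivity ((A s * a r ^+ 2 + B s * (a r * b r) + C s * b r ^+ 2)
       - (A s * a s ^+ 2 + B s * (a s * b s) + C s * b s ^+ 2)); first by rewrite /P1 /Q1; ring.
    transitivity ((A s * a r ^+ 2 + B s * (a r * b r) + C s * b r ^+ 2)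
       - (A r * a r ^+ 2 + B r * (a r * b r) + C r * b r ^+ 2)); first by rewrite e1 k1.
    transitivity (- ((A r - A s) * a r ^+ 2 + (B r - B s) * (a r * b r) + (C r - C s) * b r ^+ 2));
      first by ring.
    by rewrite w1 w2 w3 /S1; ring.
  have i2 : P2 r * (a r - a s) + Q2 r * (b r - b s) = - (S2 r * (r - s)).
    have := gE1 r; have := gF1 r; have := gH1 r => w3 w2 w1.
    transitivity ((E s * a r ^+ 2 + F s * (a r * b r) + H s * b r ^+ 2)
       - (E s * a s ^+ 2 + F s * (a s * b s) + H s * b s ^+ 2)); first by rewrite /P2 /Q2; ring.
    transitivity ((E s * a r ^+ 2 + F s * (a r * b r) + H s * b r ^+ 2)
       - (E r * a r ^+ 2 + F r * (a r * b r) + H r * b r ^+ 2)); first by rewrite e2 k2.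
    transitivity (- ((E r - E s) * a r ^+ 2 + (F r - F s) * (a r * b r) + (H r - H s) * b r ^+ 2));
      first by ring.
    by rewrite w1 w2 w3 /S2; ring.
  split; apply: (mulIf d0); rewrite mulrAC divfK//.
    transitivity ((P1 r * (a r - a s) + Q1 r * (b r - b s)) * Q2 r
      - (P2 r * (a r - a s) + Q2 r * (b r - b s)) * Q1 r); first by rewrite /Dr; ring.
    by rewrite i1 i2; ring.
  transitivity ((P2 r * (a r - a s) + Q2 r * (b r - b s)) * P1 r
    - (P1 r * (a r - a s) + Q1 r * (b r - b s)) * P2 r); first by rewrite /Dr; ring.
  by rewrite i1 i2; ring.
have car (f h : R -> R) : {for s, continuous h} ->
    (\forall r \near s, f r - f s = h r * (r - s)) -> is_derive s 1 f (h s).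
  move=> ch hf; apply: (@near_eq_is_derive _ _ _ (fun r => f s + h r * (r - s))).
    by apply: filterS hf => r hr; rewrite -hr addrC subrK.
  apply/is_derive1_caratheodory; exists h; split=> // r.
  by rewrite subrr mulr0 addr0 addrC addKr.
have s1E : S1 s = r1 s by rewrite /S1 gA3 gB3 gC3.
have s2E : S2 s = r2 s by rewrite /S2 gE3 gF3 gH3.
split.
- rewrite (_ : a' s = (S2 s * Q1 s - S1 s * Q2 s) / Dr s); last first.
    by rewrite /a' s1E s2E DrE /Q1 /Q2; congr (_ / _); ring.
  apply: (car a (fun r => (S2 r * Q1 r - S1 r * Q2 r) / Dr r)).
    by cont; rewrite DrE.
  by apply: filterS cramer => r [].
- rewrite (_ : b' s = (S1 s * P2 s - S2 s * P1 s) / Dr s); last first.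
    by rewrite /b' s1E s2E DrE /P1 /P2; congr (_ / _); ring.
  apply: (car b (fun r => (S1 r * P2 r - S2 r * P1 r) / Dr r)).
    by cont; rewrite DrE.
  by apply: filterS cramer => r [].
- by rewrite /a' /r1 /r2 /D; cont.
- by rewrite /b' /r1 /r2 /D; cont.
Unshelve. all: by end_near. Qed.

End local_regularity.

#[global] Opaque dot cross.

Section charts.
Context {R : realType}.
Implicit Types (c : R -> 'rV[R]_3) (t s : R) (X Y W p : 'rV[R]_3).

Lemma within_comp (T X Y : topologicalType) (A : set X) (f : X -> Y) (g : T -> X) (z : T) :
  {within A, continuous f} -> (\forall y \near z, A (g y)) -> {for z, continuous g} ->
  {for z, continuous (f \o g)}.
Proof.
move=> /subspace_continuousP cf Ag cg B hB.
have := cf _ (nbhs_singleton Ag) B hB; rewrite /= => hB'.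
have := cg _ hB'; rewrite !near_simpl/= => h.
by apply: filterS2 Ag h => y Ay /(_ Ay).
Qed.

Lemma vderiv_continuous c t X : vderiv c t X -> {for t, continuous c}.
Proof.
move=> /vderivP h; apply: differentiable_continuous; apply/derivable1_diffP.
exact: ex_derive.
Qed.

Lemma vderiv_dot2 (F H : R -> 'rV[R]_3) t X Y : vderiv F t X -> vderiv H t Y ->
  is_derive t 1 (fun s => dot (F s) (H s)) (dot X (H t) + dot (F t) Y).
Proof.
move=> dF dH; rewrite (_ : (fun s => _) =
  (fun s => F s 0 0 * H s 0 0 + F s 0 1 * H s 0 1 + F s 0 2 * H s 0 2)); last first.
  by apply/funext => s; rewrite dotE.
apply: is_derive_eq (deriveA (deriveA (deriveP (dF 0) (dH 0)) (deriveP (dF 1) (dH 1)))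
  (deriveP (dF 2) (dH 2))) _.
by rewrite !dotE; ring.
Qed.

Lemma vC1at_vderiv c t : vC1at c t -> \forall s \near t, vderiv c s (derive1 c s).
Proof.
move=> h; have [f0 h0] := h 0; have [f1 h1] := h 1; have [f2 h2] := h 2.
apply: filterS3 h0 h1 h2 => s [k0 _] [k1 _] [k2 _].
have hv : vderiv c s (\row_i (if i == 0 then f0 s else if i == 1 then f1 s else f2 s)).
  by apply: ord3_cases; rewrite mxE.
by rewrite (vderiv_derive1 hv).
Qed.

Lemma derive_eq0 (f : R -> R) t l k : (\forall s \near t, f s = k) -> is_derive t 1 f l -> l = 0.
Proof.
move=> fk h; have e : \forall s \near t, (fun=> k) s = f s by apply: filterS fk => s ->.
rewrite -(@derive_val _ _ _ _ _ _ _ h).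
exact: (@derive_val _ _ _ _ _ _ _ (near_eq_is_derive e (deriveC k t))).
Qed.

Lemma sgr_sqrt (x y m : R) : 0 < x * y -> x ^+ 2 = m -> x = Num.sg y * Num.sqrt m.
Proof.
move=> xy <-; rewrite sqrtr_sqr.
have y0 : y != 0 by apply: contraTneq xy => ->; rewrite mulr0 ltxx.
have -> : Num.sg y = Num.sg x.
  have := gtr0_sg xy; rewrite sgrM => e; rewrite -[LHS]mul1r -e -mulrA.
  by rewrite -expr2 sqr_sg y0 mulr1.
by rewrite -numEsg.
Qed.

Definition bform (h11 h21 h12 h22 : R) (u v X Y : 'rV[R]_3) : R :=
  (dot X u * h11 + dot X v * h21) * dot Y u + (dot X u * h12 + dot X v * h22) * dot Y v.

Lemma bform_bilinear h11 h21 h12 h22 u v X Y (a b a' b' : R) :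
  let h := bform h11 h21 h12 h22 u v in
  h (a *: X + b *: Y) (a' *: X + b' *: Y) =
  a * a' * h X X + a * b' * h X Y + b * a' * h Y X + b * b' * h Y Y.
Proof. by rewrite /bform !dotDl !dotZl; ring. Qed.

(** Minus the second fundamental form in the chart: the second derivatives paired with the normal
    [N], evaluated on the coordinates of the two vectors. *)
Definition hessian (F : 'rV[R]_2 -> 'rV[R]_3) x N : 'rV[R]_3 -> 'rV[R]_3 -> R :=
  bform (dot N (dx (dx F) x)) (dot N (dy (dx F) x)) (dot N (dx (dy F) x)) (dot N (dy (dy F) x))
    (coeff1 F x) (coeff2 F x).

Lemma dot_solve (k a b : R) (N v w : 'rV[R]_3) :
  k + dot N (a *: v + b *: w) = 0 -> k = - (a * dot N v + b * dot N w).
Proof. by rewrite dotDr !dotZr; move: (dot N v) (dot N w) => y z; lra. Qed.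

Lemma dot_bform h11 h21 h12 h22 u v X Y W (e1 e2 : 'rV[R]_3) :
  dot W e1 = - (dot X u * h11 + dot X v * h21) ->
  dot W e2 = - (dot X u * h12 + dot X v * h22) ->
  dot W (dot Y u *: e1 + dot Y v *: e2) = - bform h11 h21 h12 h22 u v X Y.
Proof. by move=> h1 h2; rewrite dotDr !dotZr h1 h2 /bform; ring. Qed.

Variables (M : set 'rV[R]_3) (n : 'rV[R]_3 -> 'rV[R]_3).
Variables (D : set 'rV[R]_2) (F : 'rV[R]_2 -> 'rV[R]_3).
Hypotheses (hc : chart M D F) (hn : gauss_map M n).

Let oD : open D. Proof. by case: hc. Qed.
Let C3 : Ck 3 D F. Proof. by case: hc. Qed.
Let C21 := Ck_dx C3. Let C22 := Ck_dy C3.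

Lemma chart_mem x : D x -> M (F x).
Proof.
by move=> Dx; have [_ _ _ [U _ /seteqP[h _]] _] := hc; have [] := h (F x) (imageP F Dx).
Qed.

Lemma chart_tilt x : D x -> tilt F x != 0.
Proof.
move=> Dx; have [_ _ iF _ _] := hc.
exact (tilt_neq0 (Ck_differentiable C3 Dx) (iF x Dx)).
Qed.

Lemma chart_lift : exists psi : 'rV[R]_3 -> 'rV[R]_2,
  (forall x, D x -> psi (F x) = x) /\
  forall c t, (\forall s \near t, M (c s)) -> {for t, continuous c} -> (F @` D) (c t) ->
    (\forall s \near t, D (psi (c s)) /\ F (psi (c s)) = c s) /\ {for t, continuous (psi \o c)}.
Proof.
have [_ _ _ [U oU MU] [psi cpsi hpsi]] := hc.
exists psi; split; [exact: hpsi|move=> c t Mc cc Ft].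
have Ut : U (c t) by move: Ft; rewrite MU => -[].
have Uc : \forall s \near t, U (c s) by apply: cc; apply: open_nbhs_nbhs.
have Fc : \forall s \near t, (F @` D) (c s).
  by apply: filterS2 Mc Uc => s h1 h2; rewrite MU.
split; last exact: within_comp cpsi Fc cc.
by apply: filterS Fc => s [y Dy yc]; rewrite -yc hpsi.
Qed.

(** Straight lines of the parameter plane; their images realize every tangent vector as the velocity
    of a curve in [M]. *)
Definition ray (x : 'rV[R]_2) (a b : R) t : 'rV[R]_2 :=
  \row_j (if j == 0 then x 0 0 + t * a else x 0 1 + t * b).

Lemma ray0 x a b : ray x a b 0 = x.
Proof. by apply/rowP; apply: ord2_cases; rewrite mxE/= mul0r addr0. Qed.

Lemma ray_derive x a b t : is_derive t 1 (fun s => ray x a b s 0 0) a /\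
  is_derive t 1 (fun s => ray x a b s 0 1) b.
Proof.
have d (y k : R) : is_derive t 1 (fun s => y + s * k) k.
  by apply: is_derive_eq (deriveA (deriveC y t) (deriveP (is_derive_id t 1) (deriveC k t))) _;
    rewrite mulr0 addr0 add0r mul1r.
split; [rewrite (_ : (fun s => _) = (fun s => x 0 0 + s * a))|
        rewrite (_ : (fun s => _) = (fun s => x 0 1 + s * b))] => //;
  by apply/funext => s; rewrite mxE.
Qed.

Lemma ray_continuous x a b : continuous (ray x a b).
Proof.
move=> t; apply: differentiable_continuous; apply/derivable1_diffP/derivable_mxP => i j.
by rewrite (ord1 i); move: j; have [h1 h2] := ray_derive x a b t;
  apply: ord2_cases; exact: ex_derive.
Qed.

Lemma ray_near x a b : D x -> \forall t \near (0 : R), D (ray x a b t).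
Proof.
by move=> Dx; apply: (@ray_continuous x a b 0); rewrite ray0; apply: open_nbhs_nbhs.
Qed.

Lemma ray_vderiv x a b t : D (ray x a b t) ->
  vderiv (F \o ray x a b) t (a *: dx F (ray x a b t) + b *: dy F (ray x a b t)).
Proof.
move=> Dt; have [h1 h2] := ray_derive x a b t.
by apply: vderiv_comp => //; exact: (Ck_differentiable C3).
Qed.

Lemma ray_curve x a b : D x -> curve_at M (F x) (a *: dx F x + b *: dy F x) (F \o ray x a b).
Proof.
move=> Dx; split; first by apply: filterS (ray_near a b Dx) => t; exact: chart_mem.
  by rewrite /= ray0.
have := @ray_vderiv x a b 0; rewrite ray0 => h.
exact: vderivP (h Dx).
Qed.

Lemma chart_normal x : D x -> dot (n (F x)) (dx F x) = 0 /\ dot (n (F x)) (dy F x) = 0.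
Proof.
move=> Dx; have [_ _ h] := hn; have Mx := chart_mem Dx; split.
  by rewrite -[dx F x]addr0 -[dx F x]scale1r -(scale0r (dy F x)); apply: h => //;
    exists (F \o ray x 1 0); exact: ray_curve.
by rewrite -[dy F x]add0r -[dy F x]scale1r -(scale0r (dx F x)); apply: h => //;
  exists (F \o ray x 0 1); exact: ray_curve.
Qed.

(** A unit vector orthogonal to both partial derivatives is the normalized [tilt] up to sign. The
    second equality fixes its component up to that sign, left open at this point. *)
Lemma normal_tilt x : D x -> n (F x) =
    (dot (n (F x)) (tilt F x) / dot (tilt F x) (tilt F x)) *: tilt F x
  /\ dot (n (F x)) (tilt F x) ^+ 2 = dot (tilt F x) (tilt F x).
Proof.
move=> Dx; have [h1 h2] := chart_normal Dx.
have mm : dot (tilt F x) (tilt F x) != 0 by rewrite dot_eq0 chart_tilt.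
have [_ /(_ _ (chart_mem Dx)) nn _] := hn.
have e : n (F x) = (dot (n (F x)) (tilt F x) / dot (tilt F x) (tilt F x)) *: tilt F x.
  apply: (scalerI mm); rewrite scalerA mulrC divfK//.
  move: (n (F x)) h1 h2 => N h1 h2; rewrite /tilt; move: (dx F x) (dy F x) h1 h2 => v w h1 h2.
  transitivity (dot N v *: cross w (cross v w) + dot N w *: cross (cross v w) v
     + dot N (cross v w) *: cross v w); last by rewrite h1 h2 !scale0r !add0r.
  by apply: rv3P; rewrite !vecE; ring.
have aux (N T : 'rV[R]_3) k : N = k *: T -> dot N N = k ^+ 2 * dot T T.
  by move=> ->; rewrite dotZl dotC dotZl; ring.
split=> //; have := aux _ _ _ e; rewrite nn.
move: (dot (n _) _) (dot (tilt _ _) _) mm => y m mm h.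
transitivity ((y / m) ^+ 2 * m * m); first by field.
by rewrite -h mul1r.
Qed.

Lemma tangent_perp x X : D x -> dot X (n (F x)) = 0 -> dot X (tilt F x) = 0.
Proof.
move=> Dx; have [e1 e2] := normal_tilt Dx.
have mm : dot (tilt F x) (tilt F x) != 0 by rewrite dot_eq0 chart_tilt.
rewrite e1 dotC dotZl => /eqP; rewrite mulf_eq0 => /orP[|/eqP h]; last by rewrite dotC.
by rewrite mulf_eq0 invr_eq0 (negbTE mm) orbF -sqrf_eq0 e2 (negbTE mm).
Qed.

Lemma tangent_decomp x X : D x -> dot X (n (F x)) = 0 ->
  X = dot X (coeff1 F x) *: dx F x + dot X (coeff2 F x) *: dy F x.
Proof.
by move=> Dx /(tangent_perp Dx); apply: dual_decomp; exact: chart_tilt.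
Qed.

Lemma perp_tangent x X : D x -> dot X (n (F x)) = 0 -> tangent M (F x) X.
Proof.
move=> Dx Xn; exists (F \o ray x (dot X (coeff1 F x)) (dot X (coeff2 F x))).
by rewrite {1}(tangent_decomp Dx Xn); exact: ray_curve.
Qed.

(** Differentiate along the curve the orthogonality of the normal to the two partial derivatives of
    the chart. The result involves the curve only through its velocity [X], so it also shows that
    the differential of the Gauss map is well defined. *)
Lemma weingarten x c t X W Y : D x -> c t = F x -> (\forall s \near t, M (c s)) ->
  vderiv c t X -> vderiv (n \o c) t W ->
  dot W (n (F x)) = 0 /\
  (dot Y (n (F x)) = 0 -> dot W Y = - hessian F x (n (F x)) X Y).
Proof.
move=> Dx ct Mc cX nW; have cc := vderiv_continuous cX.
have [_ n1 _] := hn.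
split.
  have := derive_eq0 _ (vderiv_dot2 nW nW) => /(_ 1)/= h.
  have : dot W (n (c t)) + dot (n (c t)) W = 0 by apply: h; apply: filterS Mc => s; exact: n1.
  by rewrite (dotC (n _)) ct; lra.
move=> Yn; have [psi [psiF hpsi]] := chart_lift.
have [|lift cq] := hpsi c t Mc cc; first by rewrite ct; exact: imageP.
pose q := psi \o c; have qt : q t = x by rewrite /q/= ct psiF.
have [q1 q2] : is_derive t 1 (fun s => q s 0 0) (dot X (coeff1 F x)) /\
               is_derive t 1 (fun s => q s 0 1) (dot X (coeff2 F x)).
  rewrite -qt; apply: lift_derive cX => //; rewrite ?qt.
  - exact: (Ck_differentiable C3).
  - exact: chart_tilt.
  - by apply: filterS lift => s [].
have step (H : 'rV[R]_2 -> 'rV[R]_3) : Ck 1 D H ->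
    (forall y, D y -> dot (n (F y)) (H y) = 0) ->
    dot W (H x) = - (dot X (coeff1 F x) * dot (n (F x)) (dx H x)
                    + dot X (coeff2 F x) * dot (n (F x)) (dy H x)).
  move=> cH nH; have dH : differentiable H (q t) by rewrite qt; exact: (Ck_differentiable cH).
  have d1 := vderiv_comp dH q1 q2.
  have n0 : \forall s \near t, dot ((n \o c) s) ((H \o q) s) = 0.
    by apply: filterS lift => s [Ds /= <-]; exact: nH.
  have := derive_eq0 n0 (vderiv_dot2 nW d1).
  rewrite -[(H \o q) t]/(H (q t)) -[(n \o c) t]/(n (c t)) ct qt.
  exact: dot_solve.
have C2 (H : 'rV[R]_2 -> 'rV[R]_3) : Ck 2 D H -> Ck 1 D H.
  case=> h1 h2; split=> // v y Dy; have [h3 _] := h2 v.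
  exact: differentiable_continuous (h3 y Dy).
have e1 := step _ (C2 _ C21) (fun y Dy => (chart_normal Dy).1).
have e2 := step _ (C2 _ C22) (fun y Dy => (chart_normal Dy).2).
by rewrite {1}(tangent_decomp Dx Yn); exact: (dot_bform Y e1 e2).
Qed.

(** By [lift_derive] the parameters have derivatives that are expressions in the velocity of [c] and
    the first derivatives of the chart, hence continuous. *)
Lemma lift_C1 c t : vC1at c t -> (\forall s \near t, M (c s)) -> (F @` D) (c t) ->
  exists q : R -> 'rV[R]_2, [/\ \forall s \near t, [/\ D (q s), F (q s) = c s & {for s, continuous q}],
    C1at (fun s => q s 0 0) t, C1at (fun s => q s 0 1) t &
    \forall s \near t, is_derive (s : R) 1 (fun s => q s 0 0) (dot (derive1 c s) (coeff1 F (q s))) /\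
      is_derive (s : R) 1 (fun s => q s 0 1) (dot (derive1 c s) (coeff2 F (q s)))].
Proof.
move=> cC Mc ct; have [psi [psiF hpsi]] := chart_lift.
have dc := vC1at_vderiv cC.
have [lift _] := hpsi c t Mc (vderiv_continuous (nbhs_singleton dc)) ct.
pose q := psi \o c; exists q.
have good : \forall s \near t, [/\ D (q s), F (q s) = c s & {for s, continuous q}].
  apply: filterS3 (near_join Mc) lift dc => s Ms [Ds Fs] ds.
  have Fcs : (F @` D) (c s) by exists (psi (c s)).
  have [_ cs] := hpsi c s Ms (vderiv_continuous ds) Fcs.
  by split.
have dq : \forall s \near t, is_derive (s : R) 1 (fun s => q s 0 0) (dot (derive1 c s) (coeff1 F (q s))) /\
      is_derive (s : R) 1 (fun s => q s 0 1) (dot (derive1 c s) (coeff2 F (q s))).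
  apply: filterS3 good (near_join lift) dc => s [Ds _ cs] ls ds.
  apply: lift_derive ds => //; [exact: (Ck_differentiable C3)|exact: chart_tilt|].
  by apply: filterS ls => r [].
have cc' i : \forall s \near t, {for s, continuous (fun r => derive1 c r 0 i)}.
  have [f' hf] := cC i; have e : \forall s \near t, f' s = derive1 c s 0 i.
    apply: filterS2 hf dc => s [h1 _] h2.
    by rewrite -(@derive_val _ _ _ _ _ _ _ h1) -(@derive_val _ _ _ _ _ _ _ (h2 i)).
  apply: filterS2 (near_join e) hf => s es [_ cf].
  rewrite /prop_for /continuous_at -(nbhs_singleton es).
  by apply: cvg_trans cf; exact: near_eq_cvg.
have cq : \forall s \near t, [/\ {for s, continuous (fun r => dot (derive1 c r) (coeff1 F (q r)))} &
    {for s, continuous (fun r => dot (derive1 c r) (coeff2 F (q r)))}].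
  apply: filterS3 good dc (filterI (cc' 0) (filterI (cc' 1) (cc' 2))) => s [Ds _ cs] _ [c0 [c1 c2]].
  have cd i : {for s, continuous (fun r => derive1 c r 0 i)} by move: i; exact: ord3_cases.
  have cx i : {for s, continuous (fun r => dx F (q r) 0 i)}.
    exact (@cont_comp _ _ _ (fun x => dx F x 0 i) q s (Ck_continuous (i := i) C21 Ds) cs).
  have cy i : {for s, continuous (fun r => dy F (q r) 0 i)}.
    exact (@cont_comp _ _ _ (fun x => dy F x 0 i) q s (Ck_continuous (i := i) C22 Ds) cs).
  pose v r := dx F (q r); pose w r := dy F (q r); pose m r := cross (v r) (w r).
  pose mm (r : R) : R := dot (m r) (m r).
  have cm : forall i, {for s, continuous (fun r => m r 0 i)} := cont_cross cx cy.
  have cmm : {for s, continuous mm} := cont_dot cm cm.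
  have m0 : mm s != 0 by rewrite /mm dot_eq0; exact: chart_tilt.
  have cim : {for s, continuous (fun r : R => (mm r)^-1)} := contI m0 cmm.
  have k1 : {for s, continuous (fun r : R => dot (cross (w r) (m r)) (derive1 c r))} :=
    cont_dot (cont_cross cy cm) cd.
  have k2 : {for s, continuous (fun r : R => dot (cross (m r) (v r)) (derive1 c r))} :=
    cont_dot (cont_cross cm cx) cd.
  have l1 := contM cim k1; have l2 := contM cim k2.
  split.
    rewrite (_ : (fun r => _) = (fun r => (mm r)^-1 * dot (cross (w r) (m r)) (derive1 c r)));
      first exact: l1.
    by apply/funext => r; rewrite /coeff1 /dual1 dotC dotZl.
  rewrite (_ : (fun r => _) = (fun r => (mm r)^-1 * dot (cross (m r) (v r)) (derive1 c r)));
    first exact: l2.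
  by apply/funext => r; rewrite /coeff2 /dual2 dotC dotZl.
split=> //.
  exists (fun s => dot (derive1 c s) (coeff1 F (q s))).
  by apply: filterS2 dq cq => s [h1 _] [h2 _].
exists (fun s => dot (derive1 c s) (coeff2 F (q s))).
by apply: filterS2 dq cq => s [_ h1] [_ h2].
Qed.

Lemma chart_C1 (H : 'rV[R]_2 -> 'rV[R]_3) q t : Ck 1 D H ->
  (\forall s \near t, D (q s) /\ {for s, continuous q}) ->
  C1at (fun s => q s 0 0) t -> C1at (fun s => q s 0 1) t -> vC1at (H \o q) t.
Proof.
move=> cH hq q1 q2; apply: vC1at_comp => //.
- by apply: filterS hq => s [Ds _]; exact: (Ck_differentiable cH).
- by move=> i; apply: filterS hq => s [Ds _]; exact: (Ck_continuous (i := i) (Ck_dx cH) Ds).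
- by move=> i; apply: filterS hq => s [Ds _]; exact: (Ck_continuous (i := i) (Ck_dy cH) Ds).
- by apply: filterS hq => s [].
Qed.

(** The Gauss map is only assumed continuous. Along the curve it is plus or minus the normalized
    [tilt]; by continuity the sign is constant near [t], and [tilt] is C^1 along the lifted
    parameters. *)
Lemma gauss_C1 c t : vC1at c t -> (\forall s \near t, M (c s)) -> (F @` D) (c t) ->
  vC1at (n \o c) t.
Proof.
move=> cC Mc ct; have [q [good q1 q2 _]] := lift_C1 cC Mc ct.
have hq : \forall s \near t, D (q s) /\ {for s, continuous q} by apply: filterS good => s [].
have C2 (H : 'rV[R]_2 -> 'rV[R]_3) : Ck 2 D H -> Ck 1 D H.
  case=> h1 h2; split=> // v y Dy; have [h3 _] := h2 v.
  exact: differentiable_continuous (h3 y Dy).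
have h1 := chart_C1 (C2 _ C21) hq q1 q2; have h2 := chart_C1 (C2 _ C22) hq q1 q2.
have hm := vC1at_cross h1 h2.
pose m s := cross ((dx F \o q) s) ((dy F \o q) s).
have [Dt Ft _] := nbhs_singleton good.
have mt : 0 < dot (m t) (m t) by rewrite dot_gt0; exact: chart_tilt Dt.
pose sig s := dot (n (c s)) (m s).
have [ni _ _] := hn.
have cn : {for t, continuous (n \o c)}.
  by apply: within_comp ni Mc _; exact: vderiv_continuous (nbhs_singleton (vC1at_vderiv cC)).
have csig : {for t, continuous sig}.
  apply: cont_dot => i; last by have := nbhs_singleton (C1at_cont (hm i)).
  exact: (@cont_comp _ _ _ (fun v : 'rV[R]_3 => v 0 i) (n \o c) t (@coord_continuous _ _ _ _ _ _) cn).
have sigE s : D (q s) -> F (q s) = c s -> sig s ^+ 2 = dot (m s) (m s).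
  by move=> Ds Fs; rewrite /sig -Fs; exact: (normal_tilt Ds).2.
have sig0 : 0 < sig t * sig t by rewrite -expr2 sigE.
have sigs : \forall s \near t, 0 < sig s * sig t.
  have cs : {for t, continuous (fun s => sig s * sig t)}.
    by apply: contM csig _; exact: contC.
  exact: (@cvgr_gt R _ (nbhs t) _ _ _ cs 0 sig0).
apply: (@vC1at_eq _ (fun s => (Num.sg (sig t) * (Num.sqrt (dot (m s) (m s)) * (dot (m s) (m s))^-1)) *: m s)).
  apply: filterS2 good sigs => s [Ds Fs _] ss.
  rewrite mulrA -(sgr_sqrt ss (sigE s Ds Fs)) /= -Fs.
  by have [e _] := normal_tilt Ds; rewrite [RHS]e /sig -Fs.
have hmm := C1at_dot hm hm.
apply: vC1atZ hm; apply: C1atM (C1at_cst _ _) _; apply: C1atM (C1at_sqrt hmm mt) _.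
by apply: C1atV hmm _; rewrite gt_eqF.
Qed.

End charts.

(** * Asymptotic curves *)

Section second_fundamental_form.
Context {R : realType}.
Implicit Types (c G V : R -> 'rV[R]_3) (t s : R) (X Y W p : 'rV[R]_3).

Lemma derive_shift (f : R -> R) (t k l : R) : is_derive (t + k) 1 f l ->
  is_derive t 1 (fun s => f (s + k)) l.
Proof.
move=> /is_derive1_caratheodory[g [g1 g2 g3]]; apply/is_derive1_caratheodory.
exists (fun s => g (s + k)); split=> // [z|]; first by rewrite g1; congr (_ * _); ring.
apply: (@cont_comp _ _ _ g (fun s : R => s + k) t g2).
by apply: (@contA _ _ (fun s : R => s) (fun=> k) t); [exact: cvg_id|exact: contC].
Qed.

Lemma vderiv_shift c t k X : vderiv c (t + k) X -> vderiv (fun s => c (s + k)) t X.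
Proof. by move=> h i; exact: (derive_shift (h i)). Qed.

Lemma is_derive_vderiv c t X : is_derive t 1 c X -> vderiv c t X.
Proof.
move=> h; have d : derivable c t 1 by exact: ex_derive.
have e : 'D_1 c t = X by exact: derive_val.
move=> i; apply: DeriveDef; first by move: (d) => /derivable_mxP; apply.
by rewrite -e derive_mx// mxE.
Qed.

Lemma vperiodic_derive L G V : vsmooth G V -> (forall t, G (t + L) = G t) -> vperiodic L G V.
Proof.
move=> [dG _] pG t; split=> //; apply: etrans (vderiv_derive1 (dG t)).
have := vderiv_shift (dG (t + L)); rewrite (_ : (fun s => G (s + L)) = G); last exact/funext.
by move=> h; rewrite (vderiv_derive1 h).
Qed.

Lemma bform_polar h11 h21 h12 h22 (u v : 'rV[R]_3) X Y :
  bform h11 h21 h12 h22 u v X Y + bform h11 h21 h12 h22 u v Y X =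
  2 * h11 * (dot X u * dot Y u) + (h21 + h12) * (dot X u * dot Y v + dot X v * dot Y u)
  + 2 * h22 * (dot X v * dot Y v).
Proof. by rewrite /bform; ring. Qed.

Lemma dot_polar (x1 x2 y1 y2 : R) (v w : 'rV[R]_3) :
  2 * dot (x1 *: v + x2 *: w) (y1 *: v + y2 *: w) =
  2 * dot v v * (x1 * y1) + 2 * dot v w * (x1 * y2 + x2 * y1) + 2 * dot w w * (x2 * y2).
Proof. by rewrite !dotDl !dotDr !dotZl !dotZr (dotC w v); ring. Qed.

(** Here [(a, b)] are the coordinates of the tangent and [(x, y)] those of the conormal; the
    equations are the polarized forms of [II] and of the metric. If the gradients of the two forms
    were dependent at the tangent, the polarized [II] of tangent and conormal, called [k], would
    vanish. *)
Lemma conic_det (A B C E K H a b x y k : R) :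
  0 = 2 * A * (a * a) + B * (a * b + b * a) + 2 * C * (b * b) ->
  2 = 2 * E * (a * a) + K * (a * b + b * a) + 2 * H * (b * b) ->
  k = 2 * A * (a * x) + B * (a * y + b * x) + 2 * C * (b * y) ->
  0 = 2 * E * (a * x) + K * (a * y + b * x) + 2 * H * (b * y) ->
  (2 * A * a + B * b) * (K * a + 2 * H * b) - (B * a + 2 * C * b) * (2 * E * a + K * b) = 0 ->
  k = 0.
Proof.
move=> e1 e2 e3 e4 e5.
have : (2 * A * (a * x) + B * (a * y + b * x) + 2 * C * (b * y)) *
       (2 * E * (a * a) + K * (a * b + b * a) + 2 * H * (b * b)) =
       (2 * A * (a * a) + B * (a * b + b * a) + 2 * C * (b * b)) *
       (2 * E * (a * x) + K * (a * y + b * x) + 2 * H * (b * y)) -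
  ((2 * A * a + B * b) * (K * a + 2 * H * b) - (B * a + 2 * C * b) * (2 * E * a + K * b)) *
  (a * y - b * x) by ring.
by rewrite -e1 -e2 -e3 -e4 e5; lra.
Qed.

Lemma C1at_derive_cont (f g : R -> R) t : C1at f t ->
  (\forall s \near t, is_derive (s : R) 1 f (g s)) -> \forall s \near t, {for s, continuous g}.
Proof.
move=> [f' hf] hg; have e : \forall s \near t, f' s = g s.
  apply: filterS2 hf hg => s [h1 _] h2.
  by rewrite -(@derive_val _ _ _ _ _ _ _ h1) -(@derive_val _ _ _ _ _ _ _ h2).
apply: filterS2 (near_join e) hf => s es [_ cf].
rewrite /prop_for /continuous_at -(nbhs_singleton es).
by apply: cvg_trans cf; exact: near_eq_cvg.
Qed.

Variables (M : set 'rV[R]_3) (n : 'rV[R]_3 -> 'rV[R]_3).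
Variables (D : set 'rV[R]_2) (F : 'rV[R]_2 -> 'rV[R]_3).
Hypotheses (hc : chart M D F) (hn : gauss_map M n).

(** [dgauss] picks some admissible value. By [weingarten] two such values have tangent difference
    and pair equally with every tangent vector, so pairing the difference with itself gives 0. *)
Lemma dgauss_curve x c t X W : D x -> c t = F x -> (\forall s \near t, M (c s)) ->
  vderiv c t X -> vderiv (n \o c) t W -> dgauss M n (c t) X = W.
Proof.
move=> Dx ct Mc cX nW; rewrite /dgauss.
set A := [set W | _].
have AW : A W.
  exists (fun s => c (s + t)).
    split; last 2 first.
    - by rewrite add0r.
    - by apply: vderivP; apply: vderiv_shift; rewrite add0r.
    have ct0 : {for (0 : R), continuous (fun s : R => s + t)}.
      by apply: (@contA _ _ (fun s : R => s) (fun=> t) 0); [exact: cvg_id|exact: contC].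
    by have := ct0 _ _; rewrite /= add0r => /(_ _ Mc).
  by apply: vderivP; apply: (vderiv_shift (c := n \o c)); rewrite add0r.
have uniqA W' : A W' -> W' = W.
  move=> [c' [Mc' c0 /is_derive_vderiv c'X]] /is_derive_vderiv nW'.
  have c0' : c' 0 = F x by rewrite c0.
  have w1 Y := weingarten hc hn Y Dx c0' Mc' c'X nW'.
  have w2 Y := weingarten hc hn Y Dx ct Mc cX nW.
  apply/eqP; rewrite -subr_eq0 -dot_eq0 {1}dotBl.
  have Yn : dot (W' - W) (n (F x)) = 0 by rewrite dotBl (w1 0).1 (w2 0).1 subrr.
  by rewrite (w1 _).2// (w2 _).2// subrr.
by apply: uniqA; apply: (@xgetPex _ 0 A); exists W.
Qed.

(** A curve with velocity [X] along which [n] is differentiable must be exhibited, as otherwise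
    [dgauss] could be the default 0; the image of a ray serves. *)
Lemma second_formE x X Y : D x -> dot X (n (F x)) = 0 -> dot Y (n (F x)) = 0 ->
  second_form M n (F x) X Y = - hessian F x (n (F x)) X Y.
Proof.
move=> Dx Xn Yn; have [_ C3 _ _ _] := hc.
pose a := dot X (coeff1 F x); pose b := dot X (coeff2 F x).
pose c := F \o ray x a b.
have c0 : c 0 = F x by rewrite /c/= ray0.
have near0 := ray_near hc a b Dx.
have Mc : \forall s \near (0 : R), M (c s) by apply: filterS near0 => s; exact: (chart_mem hc).
have cX : vderiv c 0 X.
  have := @ray_vderiv _ _ _ _ hc x a b 0; rewrite ray0 => /(_ Dx).
  by rewrite /a /b -(tangent_decomp hc hn Dx Xn).
have cC : vC1at c 0.
  apply: (chart_C1 (D := D)) => //.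
  - by case: C3 => d1 d2; split=> // v y Dy; have [d3 _] := d2 v; exact: differentiable_continuous (d3 y Dy).
  - by apply: filterS near0 => s Ds; split=> //; exact: ray_continuous.
  - exists (fun=> a); near=> s; split; [exact: (ray_derive x a b s).1|exact: contC].
  - exists (fun=> b); near=> s; split; [exact: (ray_derive x a b s).2|exact: contC].
have nC : vC1at (n \o c) 0.
  by apply: (gauss_C1 hc hn) => //; rewrite c0; exact: imageP.
have nW := nbhs_singleton (vC1at_vderiv nC).
rewrite /second_form -c0 (dgauss_curve Dx c0 Mc cX nW) c0.
exact: (weingarten hc hn Y Dx c0 Mc cX nW).2.
Unshelve. all: by end_near. Qed.

End second_fundamental_form.

Lemma constant_sign (R : realType) (f : R -> R) : continuous f -> (forall t, f t != 0) ->
  forall s t, 0 < f s * f t.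
Proof.
move=> cf f0 s t.
wlog st : s t / s <= t.
  by move=> h; have [/h //|/ltW/h] := leP s t; rewrite mulrC.
rewrite lt_neqAle eq_sym mulf_neq0//= leNgt; apply/negP => neg.
have [||c _ fc] := @IVT R f s t 0 st.
- exact: continuous_subspaceT.
- have [fs|fs] := ltP (f s) 0.
    have ft : 0 < f t by rewrite -(nmulr_rlt0 _ fs).
    by rewrite min_l ?max_r ?(ltW fs) ?(ltW ft)// (le_trans (ltW fs) (ltW ft)).
  have fs' : 0 < f s by rewrite lt_neqAle eq_sym f0.
  have ft : f t < 0 by rewrite -(pmulr_rlt0 _ fs').
  by rewrite min_r ?max_l ?fs ?(ltW ft)// (le_trans (ltW ft) fs).
- by move/eqP: (f0 c).
Qed.

(* [P] is the conormal $n^\perp$ and [k] the geodesic curvature; the normal curvature vanishes. *)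
Definition darboux (R : realType) (L : R) (G T P N : R -> 'rV[R]_3) (k tau : R -> R) : Prop :=
  [/\ [/\ 0 < L, continuous k & continuous tau],
      forall t, frame (T t) (P t) (N t),
      [/\ vsmooth G T, vsmooth T (fun t => k t *: P t),
        vsmooth P (fun t => - k t *: T t + tau t *: N t) & vsmooth N (fun t => - tau t *: P t)],
      forall t, [/\ G (t + L) = G t, T (t + L) = T t, P (t + L) = P t & N (t + L) = N t] &
      (forall s t, 0 < tau s * tau t) /\ (forall s t, G s = G t -> cross (T s) (T t) = 0)].

Section asymptotic_curves.
Context {R : realType}.
Variables (M : set 'rV[R]_3) (n : 'rV[R]_3 -> 'rV[R]_3) (L : R) (G : R -> 'rV[R]_3).
Hypotheses (hM : embedded_C3_surface M) (hn : gauss_map M n).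
Hypotheses (hK : negatively_curved M n) (hG : closed_asymptotic_curve M n L G).
Implicit Types (t s : R).

Let T := derive1 G.
Let N := n \o G.
Let N' := derive1 N.
Let P t := cross (N t) (T t).

Let MG t : M (G t). Proof. by have [_ _ _ h _] := hG; have [] := h t. Qed.
Let MGn t : \forall s \near t, M (G s). Proof. by near=> s; exact: MG. Unshelve. all: by end_near. Qed.

Lemma asymptotic_smooth : vsmooth G T.
Proof.
have [_ [dG cT] _ _ _] := hG; split.
  move=> t; apply: is_derive_vderiv; rewrite /T derive1E; apply: DeriveDef => //; exact: dG.
move=> i t; exact: (@cont_comp _ _ _ (fun v : 'rV[R]_3 => v 0 i) T t (@coord_continuous _ _ _ _ _ _) (cT t)).
Qed.

Let sG := asymptotic_smooth.

Let GC1 t : vC1at G t.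
Proof.
move=> i; exists (fun s => T s 0 i); near=> s; split; [exact: sG.1|exact: sG.2].
Unshelve. all: by end_near. Qed.

Let NC1 t : vC1at N t.
Proof.
have [D [F [hc Ft]]] := hM (MG t).
exact: (gauss_C1 hc hn (GC1 t) (MGn t) Ft).
Qed.

Lemma normal_smooth : vsmooth N N'.
Proof. exact: vC1at_smooth NC1. Qed.

Let sN := normal_smooth.

Lemma asymptotic_unit t : [/\ dot (T t) (T t) = 1, dot (N t) (N t) = 1 & dot (N t) (T t) = 0].
Proof.
have [_ _ h _ _] := hG; have [_ n1 nt] := hn; split; [exact: h|exact: n1|].
apply: nt => //; exists (fun s => G (s + t)); split; last 2 first.
- by rewrite add0r.
- by apply: vderivP; apply: vderiv_shift; rewrite add0r; exact: sG.1.
- by near=> s; exact: MG.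
Unshelve. all: by end_near. Qed.

Lemma asymptotic_frame t : frame (T t) (P t) (N t).
Proof.
have [TT NN NT] := asymptotic_unit t; rewrite /P; split=> //.
- rewrite (_ : dot _ _ = dot (N t) (N t) * dot (T t) (T t) - dot (N t) (T t) ^+ 2).
    by rewrite TT NN NT; ring.
  by move: (N t) (T t) => v w; rewrite !vecE; ring.
- by move: (N t) (T t) => v w; rewrite !vecE; ring.
- transitivity (dot (T t) (T t) *: N t - dot (N t) (T t) *: T t).
    by move: (N t) (T t) => v w; apply: rv3P; rewrite !vecE; ring.
  by rewrite TT NT scale1r scale0r subr0.
Qed.

(** In the orthonormal basis of tangent and conormal [II(T, T) = 0], so the Gauss curvature is minus
    the product of the two mixed terms, and its negativity makes this product positive. *)
Lemma second_form_asymptotic D F x t : chart M D F -> D x -> F x = G t ->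
  let h := hessian F x (N t) in
  [/\ h (T t) (T t) = 0, 0 < h (T t) (P t) * h (P t) (T t),
      dot (N' t) (T t) = 0 & dot (N' t) (P t) = - h (T t) (P t)].
Proof.
move=> hc Dx Fx; have [TT PP TP fN] := asymptotic_frame t.
have [NN TN PN _ _] := frameP (asymptotic_frame t).
have [_ _ _ hh _] := hG; have [_ II0] := hh t.
have dg := dgauss_curve hc hn Dx (esym Fx) (MGn t) (sG.1 t) (sN.1 t).
have Tn : dot (T t) (n (F x)) = 0 by rewrite Fx.
have Pn : dot (P t) (n (F x)) = 0 by rewrite Fx.
have sf X Y : dot X (n (F x)) = 0 -> dot Y (n (F x)) = 0 ->
  second_form M n (G t) X Y = - hessian F x (N t) X Y.
  by move=> hX hY; rewrite /N /= -Fx; exact: (second_formE hc hn).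
have e1 : hessian F x (N t) (T t) (T t) = 0 by apply: oppr_inj; rewrite -sf// oppr0.
split=> //.
- have tT : tangent M (G t) (T t) by rewrite -Fx; exact: (perp_tangent hc hn).
  have tP : tangent M (G t) (P t) by rewrite -Fx; exact: (perp_tangent hc hn).
  have cN : cross (T t) (P t) != 0.
    by rewrite fN -dot_eq0 NN oner_eq0.
  have := hK (MG t) tT tP cN; rewrite /gauss_curvature II0 TT PP TP.
  rewrite (sf (T t) (P t))// (sf (P t) (T t))//.
  by rewrite mul0r sub0r mulrNN mulr1 expr0n subr0 divr1 oppr_lt0.
- by rewrite -[LHS]/(second_form _ _ _ _ _) in II0 *; move: II0; rewrite /second_form dg.
- by rewrite -(sf (T t) (P t))// /second_form dg.
Qed.

Lemma torsion_neq0 t : dot (N' t) (P t) != 0.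
Proof.
have [D [F [hc [x Dx Fx]]]] := hM (MG t).
have [_ h _ ->] := second_form_asymptotic hc Dx Fx.
by rewrite oppr_eq0; apply: contraTneq h => ->; rewrite mul0r ltxx.
Qed.

Lemma asymptotic_normal t : dot (N' t) (T t) = 0.
Proof.
have [D [F [hc [x Dx Fx]]]] := hM (MG t).
by have [_ _ h _] := second_form_asymptotic hc Dx Fx.
Qed.

Let TC1 t : vC1at T t.
Proof.
have [D [F [hc Ft]]] := hM (MG t); have [_ C3 _ _ _] := hc.
have [q [good q1 q2 dq]] := lift_C1 hc (GC1 t) (MGn t) Ft.
have hq : \forall s \near t, D (q s) /\ {for s, continuous q} by apply: filterS good => s [].
have C1 (k : nat) (H : 'rV[R]_2 -> 'rV[R]_3) : Ck k.+2 D H -> Ck 1 D H.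
  case=> h1 h2; split=> // v y Dy; have [h3 _] := h2 v.
  exact: differentiable_continuous (h3 y Dy).
have C21 := Ck_dx C3; have C22 := Ck_dy C3.
have d1 := chart_C1 (C1 _ _ C21) hq q1 q2; have d2 := chart_C1 (C1 _ _ C22) hq q1 q2.
have d11 := chart_C1 (Ck_dx C21) hq q1 q2; have d12 := chart_C1 (Ck_dy C21) hq q1 q2.
have d21 := chart_C1 (Ck_dx C22) hq q1 q2; have d22 := chart_C1 (Ck_dy C22) hq q1 q2.
pose a s := dot (T s) (coeff1 F (q s)); pose b s := dot (T s) (coeff2 F (q s)).
pose A s := dot (N s) ((dx (dx F) \o q) s).
pose B s := dot (N s) ((dy (dx F) \o q) s) + dot (N s) ((dx (dy F) \o q) s).
pose C s := dot (N s) ((dy (dy F) \o q) s).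
pose E s := dot ((dx F \o q) s) ((dx F \o q) s).
pose K s := 2 * dot ((dx F \o q) s) ((dy F \o q) s).
pose H s := dot ((dy F \o q) s) ((dy F \o q) s).
have hessE s X Y : hessian F (q s) (N s) X Y + hessian F (q s) (N s) Y X =
    2 * A s * (dot X (coeff1 F (q s)) * dot Y (coeff1 F (q s)))
    + B s * (dot X (coeff1 F (q s)) * dot Y (coeff2 F (q s)) +
             dot X (coeff2 F (q s)) * dot Y (coeff1 F (q s)))
    + 2 * C s * (dot X (coeff2 F (q s)) * dot Y (coeff2 F (q s))).
  exact: bform_polar.
have dotE2 s X Y : D (q s) -> F (q s) = G s -> dot X (N s) = 0 -> dot Y (N s) = 0 ->
    2 * dot X Y = 2 * E s * (dot X (coeff1 F (q s)) * dot Y (coeff1 F (q s)))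
    + K s * (dot X (coeff1 F (q s)) * dot Y (coeff2 F (q s)) +
             dot X (coeff2 F (q s)) * dot Y (coeff1 F (q s)))
    + 2 * H s * (dot X (coeff2 F (q s)) * dot Y (coeff2 F (q s))).
  rewrite /N /= => Ds Fs; rewrite -Fs => Xn Yn.
  rewrite {1}(tangent_decomp hc hn Ds Xn) {1}(tangent_decomp hc hn Ds Yn) /E /K /H /comp.
  exact: dot_polar.
have fr s := asymptotic_frame s.
have [aC bC] : C1at a t /\ C1at b t.
  apply: (C1at_conic (A := A) (B := B) (C := C) (E := E) (F := K) (H := H)).
  - exact: C1at_dot (NC1 t) d11.
  - exact: C1atD (C1at_dot (NC1 t) d12) (C1at_dot (NC1 t) d21).
  - exact: C1at_dot (NC1 t) d22.
  - exact (C1at_dot d1 d1).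
  - exact: C1atM (C1at_cst 2 t) (C1at_dot d1 d2).
  - exact (C1at_dot d2 d2).
  - apply: filterS2 (C1at_derive_cont q1 (filterS (fun s (h : _ /\ _) => h.1) dq))
      (C1at_derive_cont q2 (filterS (fun s (h : _ /\ _) => h.2) dq)) => s h1 h2; split.
      exact: h1.
    exact: h2.
  - apply: filterS good => s [Ds Fs _].
    have [h1 _ _ _] := second_form_asymptotic hc Ds Fs.
    have [TT _ NT] := asymptotic_unit s.
    have := hessE s (T s) (T s); have := dotE2 s (T s) (T s) Ds Fs; rewrite h1 TT (dotC (T s)) NT.
    move=> /(_ erefl erefl); rewrite -/(a s) -/(b s) addr0 => e1 e2.
    by split; lra.
  - apply: filterS good => s [Ds Fs _].
    have [h1 h2 _ _] := second_form_asymptotic hc Ds Fs.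
    have [TT PP TP _] := fr s; have [_ TN PN _ _] := frameP (fr s).
    have e1 := hessE s (T s) (T s); have e2 := dotE2 s (T s) (T s) Ds Fs TN TN.
    have e3 := hessE s (T s) (P s); have e4 := dotE2 s (T s) (P s) Ds Fs TN PN.
    rewrite h1 -/(a s) -/(b s) in e1; rewrite TT -/(a s) -/(b s) in e2.
    rewrite -/(a s) -/(b s) in e3; rewrite TP -/(a s) -/(b s) in e4.
    move: (dot (P s) (coeff1 F (q s))) (dot (P s) (coeff2 F (q s))) e3 e4 => w1 w2 e3 e4.
    (* Two numbers with positive product are not opposite; the symmetrized mixed term is therefore
       nonzero, and [conic_det] makes the system nondegenerate. *)
    have kap : hessian F (q s) (N s) (T s) (P s) + hessian F (q s) (N s) (P s) (T s) != 0.
      apply: contraTneq h2 => /eqP; rewrite addr_eq0 => /eqP ->.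
      by rewrite mulNr -expr2 oppr_gt0 ltNge sqr_ge0.
    apply: contraNneq kap => det0; apply/eqP.
    by apply: (conic_det _ _ e3 _ det0); rewrite -?e1 -?e2 -?e4 ?mulr0 ?mulr1 ?addr0.
apply: (@vC1at_eq _ (fun s => a s *: (dx F \o q) s + b s *: (dy F \o q) s)).
  apply: filterS good => s [Ds Fs _].
  have [_ TN PN _ _] := frameP (asymptotic_frame s).
  have Tn : dot (T s) (n (F (q s))) = 0 by rewrite Fs.
  by rewrite [RHS](tangent_decomp hc hn Ds Tn).
exact: vC1atD (vC1atZ aC d1) (vC1atZ bC d2).
Qed.

Lemma tangent_smooth : vsmooth T (derive1 T).
Proof. exact: vC1at_smooth TC1. Qed.

Let sT := tangent_smooth.
Let sP : vsmooth P (derive1 P).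
Proof. by apply: vC1at_smooth => t; exact: vC1at_cross (NC1 t) (TC1 t). Qed.

Let tau t := - dot (N' t) (P t).

Let tau_sign s t : 0 < tau s * tau t.
Proof.
move: s t; apply: constant_sign => t; last by rewrite oppr_eq0 torsion_neq0.
apply: (@contN _ _ (fun t => dot (N' t) (P t)) t); apply: cont_dot => i; first exact: sN.2.
exact: derive_continuous (sP.1 t i).
Qed.

(** At a point of the surface the two asymptotic directions have torsions of opposite signs. The
    torsion keeps its sign along the curve, so two passages through the same point follow the same
    direction. *)
Lemma asymptotic_contact s t : G s = G t -> cross (T s) (T t) = 0.
Proof.
move=> Gst; have [D [F [hc [x Dx Fx]]]] := hM (MG s).
have [b11 b12 _ e1] := second_form_asymptotic hc Dx Fx.
have [b11' _ _ e2] := second_form_asymptotic hc Dx (etrans Fx Gst).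
have NE : N t = N s by rewrite /N /= Gst.
move: b11 b11' b12 e1 e2; rewrite /= !NE; set h := hessian F x (N s) => b11 b11' b12 e1 e2.
have fr := asymptotic_frame s; have [TT PP TP fN] := fr.
have [NN TN PN PT _] := frameP fr.
have [TTt _ NTt] := asymptotic_unit t.
pose a := dot (T t) (T s); pose b := dot (T t) (P s).
have Tt : T t = a *: T s + b *: P s.
  rewrite {1}(frame_decomp (T t) fr) (_ : dot (T t) (N s) = 0) ?scale0r ?addr0//.
  by rewrite -NE dotC.
have Pt : P t = - b *: T s + a *: P s.
  have NTs : cross (N s) (T s) = P s by [].
  have NPs : cross (N s) (P s) = - T s.
    transitivity (dot (N s) (T s) *: N s - dot (N s) (N s) *: T s).
      by rewrite /P; move: (N s) (T s) => v w; apply: rv3P; rewrite !vecE; ring.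
    by rewrite NN (dotC (N s)) TN scale0r scale1r sub0r.
  rewrite {1}/P NE Tt (_ : cross _ _ = a *: cross (N s) (T s) + b *: cross (N s) (P s)).
    by rewrite NTs NPs scalerN scaleNr addrC.
  by move: (N s) (T s) (P s) => v w z; apply: rv3P; rewrite !vecE; ring.
have : 0 < h (T s) (P s) * h (T t) (P t).
  have tt : 0 < - dot (N' s) (P s) * - dot (N' t) (P t) := tau_sign s t.
  have sub (y1 y2 z1 z2 : R) : y1 = - z1 -> y2 = - z2 -> 0 < - y1 * - y2 -> 0 < z1 * z2.
    by move=> -> ->; rewrite !opprK.
  exact (sub _ _ _ _ e1 e2 tt).
move: b11'; rewrite Tt Pt /h /hessian !bform_bilinear -/(hessian F x (N s)) -/h.
rewrite -/(h (T s) (T s)) -/(h (T s) (P s)) -/(h (P s) (T s)) -/(h (P s) (P s)) b11.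
move: b12; move: (h (T s) (P s)) (h (P s) (T s)) (h (P s) (P s)) => y z u yz q1 q2.
have [b0|b0] := eqVneq b 0.
  by rewrite b0 scale0r addr0; move: (T s) => v; apply: rv3P; rewrite !vecE; ring.
exfalso.
have q3 : a * (y + z) + b * u = 0.
  by apply: (mulfI b0); rewrite mulr0 -q1; ring.
have ab : a ^+ 2 + b ^+ 2 = 1.
  by rewrite -TTt Tt !dotDl !dotDr !dotZl !dotZr TT PP TP PT; ring.
(* With [b != 0] the vector [T t] is the other asymptotic direction; [q3] and the unit length turn
   its torsion into [- z], while [y * z > 0]. *)
have q4 : a * - b * 0 + a * a * y + b * - b * z + b * a * u = - z.
  have -> : - z = - (a ^+ 2 + b ^+ 2) * z by rewrite ab mulN1r.
  have -> : b * a * u = a * (b * u) by ring.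
  have q5 : b * u = - (a * (y + z)) by apply/eqP; rewrite -addr_eq0 addrC q3.
  by rewrite q5; ring.
by move: q2; rewrite q4 mulrN oppr_gt0 ltNge (ltW yz).
Qed.

(** Differentiating the constant scalar products of the frame makes its derivative antisymmetric;
    the entry between tangent and normal is the normal curvature, which is 0 here. *)
Lemma asymptotic_darboux : exists P T N k tau, [/\ darboux L G T P N k tau,
  N = n \o G, T = derive1 G & forall t, tau t = geodesic_torsion n G t].
Proof.
have [[L0 pG] _ _ _ _] := hG.
have fr := asymptotic_frame.
pose k t := dot (derive1 T t) (P t).
have zero (H V : R -> 'rV[R]_3) A B t c : vsmooth H A -> vsmooth V B ->
    (forall t, dot (H t) (V t) = c) -> dot (A t) (V t) + dot (H t) (B t) = 0.
  move=> sH sV hHV; apply: derive_eq0 (vderiv_dot2 (sH.1 t) (sV.1 t)).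
  by near=> s; exact: hHV.
have half (x : R) : x + x = 0 -> x = 0 by lra.
have neg (x y : R) : x + y = 0 -> x = - y by lra.
have TT t : dot (derive1 T t) (T t) = 0.
  have hTT t' : dot (T t') (T t') = 1 by have [] := asymptotic_unit t'.
  by have := zero _ _ _ _ t 1 sT sT hTT; rewrite (dotC (T t)) => /half.
have NN t : dot (N' t) (N t) = 0.
  have hNN t' : dot (N t') (N t') = 1 by have [] := asymptotic_unit t'.
  by have := zero _ _ _ _ t 1 sN sN hNN; rewrite (dotC (N t)) => /half.
have PP t : dot (derive1 P t) (P t) = 0.
  have hPP t' : dot (P t') (P t') = 1 by have [] := fr t'.
  by have := zero _ _ _ _ t 1 sP sP hPP; rewrite (dotC (P t)) => /half.
have TN t : dot (derive1 T t) (N t) = 0.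
  have hTN t' : dot (T t') (N t') = 0 by have [] := frameP (fr t').
  by have := zero _ _ _ _ t 0 sT sN hTN; rewrite (dotC (T t)) asymptotic_normal addr0.
have PT t : dot (derive1 P t) (T t) = - k t.
  have hPT t' : dot (P t') (T t') = 0 by have [] := frameP (fr t').
  by have := zero _ _ _ _ t 0 sP sT hPT; rewrite (dotC (P t)) => /neg.
have PN t : dot (derive1 P t) (N t) = tau t.
  have hPN t' : dot (P t') (N t') = 0 by have [] := frameP (fr t').
  by have := zero _ _ _ _ t 0 sP sN hPN; rewrite (dotC (P t)) => /neg.
have eT : derive1 T = (fun t => k t *: P t).
  by apply/funext => t; rewrite [LHS](frame_decomp _ (fr t)) TT TN !scale0r add0r addr0.
have eP : derive1 P = (fun t => - k t *: T t + tau t *: N t).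
  by apply/funext => t; rewrite [LHS](frame_decomp _ (fr t)) PT PP PN scale0r addr0.
have eN : N' = (fun t => - tau t *: P t).
  apply/funext => t; rewrite [LHS](frame_decomp _ (fr t)) NN asymptotic_normal !scale0r add0r addr0.
  by rewrite /tau opprK.
have ck : continuous k.
  move=> t; apply: cont_dot => i; first exact: sT.2.
  exact: derive_continuous (sP.1 t i).
have ct : continuous tau.
  move=> t; apply: (@contN _ _ (fun t => dot (N' t) (P t)) t); apply: cont_dot => i; first exact: sN.2.
  exact: derive_continuous (sP.1 t i).
exists P, T, N, k, tau; split; [|exact erefl|exact erefl|move=> t; exact (esym (PN t))].
split; [by split|exact: fr| | |by split; [exact: tau_sign|exact: asymptotic_contact]].
  split; [exact: sG|by move: sT; rewrite eT|by move: sP; rewrite eP|by move: sN; rewrite eN].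
move=> t; have [_ pT] := vperiodic_derive sG pG t.
have pN : N (t + L) = N t by rewrite /N /= pG.
by split; [exact: pG|exact: pT|rewrite /P pN; congr cross; exact: pT|exact: pN].
Unshelve. all: by end_near. Qed.

End asymptotic_curves.

(** * Local analysis of the tangential push-off *)

Section estimates.
Context {R : realType}.
Implicit Types (F f : R -> R) (a b s t r e eps del : R).

Lemma near_rightP (Q : R -> Prop) : (\forall r \near 0^'+, Q r) ->
  exists2 r, 0 < r & forall e, 0 < e < r -> Q e.
Proof.
move=> /nbhs_ballP[r /= r0 h]; exists r => // e /andP[e0 er].
by apply: (h e) => //; rewrite /ball/= sub0r normrN gtr0_norm.
Qed.

Lemma value_near f a eps : {for a, continuous f} -> 0 < eps ->
  \forall del \near 0^'+, forall t, `|t - a| <= del -> `|f t - f a| <= eps.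
Proof.
move=> cf e0; have := near_right_ball (x := a) (P := fun t => `|f t - f a| <= eps).
apply; have /cvgrPdist_le/(_ _ e0) := cf; apply: filterS => t.
by rewrite distrC.
Qed.

Lemma between_ball a del s t z : `|s - a| <= del -> `|t - a| <= del ->
  Num.min s t <= z <= Num.max s t -> `|z - a| <= del.
Proof.
rewrite !ler_distl => /andP[h1 h2] /andP[h3 h4] /andP[]; rewrite ge_min le_max.
by move=> /orP[] h5 /orP[] h6; lra.
Qed.

Lemma chord_near F f a eps : (forall t, is_derive (t : R) 1 F (f t)) -> {for a, continuous f} -> 0 < eps ->
  \forall del \near 0^'+, forall s t, `|s - a| <= del -> `|t - a| <= del ->
    `|F s - F t - f a * (s - t)| <= eps * `|s - t|.
Proof.
move=> dF cf e0; apply: filterS (value_near cf e0) => del h s t hs ht.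
apply: (derive_mean_bound (f := f)); first exact: ltW.
move=> z hz; split; first exact: dF.
by apply: h; exact: between_ball ht hs hz.
Qed.

Lemma norm_absorb8 (x d e : R) : `|x - d| <= 8^-1 * `|d| -> `|x| <= e / 4 -> `|d| <= 2 / 7 * e.
Proof. by have := ler_normB x (x - d); rewrite subKr; lra. Qed.

Lemma norm_dot_le (v m : 'rV[R]_3) : dot v v = 1 -> `|dot v m| <= dot m m + 1.
Proof.
move=> vv; have := dot_ge0 (v - m); have := dot_ge0 (v + m).
rewrite !(dotBl, dotBr, dotDl, dotDr) vv (dotC m v) ler_norml.
by have := dot_ge0 m; move: (dot v m) (dot m m) => x y; lra.
Qed.

(** Reads [e * x + z * u], close to [h T], in the frame at [a], where [x] is the conormal at [t].
    The normal components bound [|z| * g] by [g / 8 * (|h| + e)]; the other two bound [|h| + e] by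
    [2 * |z|] up to a small part of itself. Multiplying by [g] gives a contradiction. *)
Lemma oblique_absurd (g z h e uT uP uN xT xP xN : R) : 0 < g -> g <= 1 -> 0 < e ->
  `|uN| = g -> `|uT| <= 1 -> `|uP| <= 1 ->
  `|e * xT + z * uT - h| <= g / 8 * `|h| -> `|e * xP + z * uP| <= g / 8 * `|h| ->
  `|e * xN + z * uN| <= g / 8 * `|h| ->
  `|xT| <= g / 8 -> `|xP - 1| <= g / 8 -> `|xN| <= g / 8 -> False.
Proof.
move=> g1 gl e_gt0 hN hT hP k1 k2 k3 k4 k5 k6.
have ab (x y : R) : `|y| <= 1 -> - `|x| <= x * y <= `|x|.
  by move=> hy; rewrite -ler_norml normrM ler_piMr.
have := ab z _ hT; have := ab z _ hP => b2 b1.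
have me x : `|x| <= g / 8 -> `|e * x| <= g / 8 * e.
  by move=> hx; rewrite normrM gtr0_norm// mulrC ler_wpM2r// ltW.
have m4 := me _ k4; have m6 := me _ k6.
have m5 : `|e * xP - e| <= g / 8 * e by rewrite -[X in _ - X]mulr1 -mulrBr me.
have zg : `|z| * g <= g / 8 * `|h| + g / 8 * e.
  rewrite -{1}hN -normrM -[z * uN](addKr (e * xN)) addrC.
  by apply: le_trans (ler_normB _ _) _; exact: lerD.
have st1 : `|h| <= `|z| + g / 8 * `|h| + g / 8 * e.
  have t1 := ler_normB (e * xT + z * uT) (e * xT + z * uT - h).
  have t2 := ler_normD (e * xT) (z * uT).
  have t3 : `|z * uT| <= `|z| by rewrite normrM ler_piMr.
  by move: t1 t2 t3 k1 m4; rewrite subKr; lra.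
have e1 : e <= `|z| + g / 8 * `|h| + g / 8 * e.
  by move: k2 m5 b2; rewrite !ler_norml; lra.
have he : 0 < `|h| + e by rewrite ltr_wpDl.
have q0 : `|h| + e <= 2 * `|z| + 2 * (g / 8) * (`|h| + e) by lra.
have q1 := ler_wpM2l (ltW g1) q0.
have q2 : g * (2 * (g / 8) * (`|h| + e)) <= 2 * (g / 8) * (`|h| + e).
  by rewrite ler_piMl// mulr_ge0 ?(ltW he)// mulr_ge0// divr_ge0// ltW.
have q3 : 0 < g * (`|h| + e) by rewrite mulr_gt0.
by move: zg q1 q2 q3; rewrite mulrDr; lra.
Qed.

(** Compactness of the square turns the local thresholds for [e] into a single one. *)
Lemma uniform_square (c d : R) (Q : R -> R -> R -> Prop) :
  (forall a b, c <= a <= d -> c <= b <= d -> exists2 r, 0 < r & forall s t e,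
     `|s - a| < r -> `|t - b| < r -> 0 < e < r -> Q e s t) ->
  exists2 e0, 0 < e0 & forall e s t, 0 < e < e0 -> c <= s <= d -> c <= t <= d -> Q e s t.
Proof.
move=> h; pose K : set (R * R) := (`[c, d] `*` `[c, d])%classic.
have /compact_near_coveringP cK : compact K.
  by apply: compact_setX; exact: segment_compact.
have /near_rightP[e0 e00 he] : \forall e \near 0^'+, K `<=` (fun p => 0 < e -> Q e p.1 p.2).
  apply: cK => -[a b] [/=]; rewrite !in_itv/= => ha hb; have [r r0 hr] := h a b ha hb.
  exists ((ball a r `*` ball b r)%classic, [set e | e < r]) => /=.
    split; last exact: nbhs_right_lt.
    by exists (ball a r, ball b r) => //=; split; exact: nbhsx_ballx.
  move=> [[s t] e] [[/= hs ht] er] e0; apply: hr; rewrite ?e0//.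
    by rewrite distrC.
  by rewrite distrC.
exists e0 => // e s t e_lt hs ht; have /andP[e1 _] := e_lt.
by apply: (he e e_lt (s, t)) => //; split; rewrite /= in_itv.
Qed.

End estimates.

Section strands.
Context {R : realType} (L : R) (G T P N : R -> 'rV[R]_3) (k tau : R -> R).
Hypothesis dbx : darboux L G T P N k tau.
Implicit Types (a b s t r e eps del l : R) (u v : 'rV[R]_3).

Let L0 : 0 < L. Proof. by have [[]] := dbx. Qed.
Let fr t : frame (T t) (P t) (N t). Proof. by have [_ h _ _ _] := dbx. Qed.
Let sG : vsmooth G T. Proof. by have [_ _ [] ] := dbx. Qed.
Let sT : vsmooth T (fun t => k t *: P t). Proof. by have [_ _ [] ] := dbx. Qed.
Let sP : vsmooth P (fun t => - k t *: T t + tau t *: N t). Proof. by have [_ _ [] ] := dbx. Qed.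
Let sN : vsmooth N (fun t => - tau t *: P t). Proof. by have [_ _ [] ] := dbx. Qed.
Let pG t : G (t + L) = G t. Proof. by have [_ _ _ h _] := dbx; have [] := h t. Qed.
Let pT t : T (t + L) = T t. Proof. by have [_ _ _ h _] := dbx; have [] := h t. Qed.
Let pP t : P (t + L) = P t. Proof. by have [_ _ _ h _] := dbx; have [] := h t. Qed.
Let pN t : N (t + L) = N t. Proof. by have [_ _ _ h _] := dbx; have [] := h t. Qed.

(** Rotates the normal, at [l = 0], to the conormal, at [l = pi / 2], around the curve. *)
Definition tilted l t := cos l *: N t + sin l *: P t.
Definition ribbon e t := G t + e *: P t.
Definition ribbon' e t := T t + e *: (- k t *: T t + tau t *: N t).

Lemma smooth_dot_cont (H V : R -> 'rV[R]_3) v t : vsmooth H V ->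
  {for t, continuous (fun s => dot (H s) v)}.
Proof. by move=> sH; exact: derive_continuous (vderiv_dot v (sH.1 t)). Qed.

Lemma strand_chord v a eps : 0 < eps ->
  \forall del \near 0^'+, forall s t, `|s - a| <= del -> `|t - a| <= del ->
    `|dot (G s - G t) v - dot (T a) v * (s - t)| <= eps * `|s - t|.
Proof.
move=> e0; apply: filterS (chord_near (F := fun s => dot (G s) v) (f := fun s => dot (T s) v)
    (a := a) _ _ e0) => [del h s t hs ht|t|]; first by rewrite dotBl; exact: h.
- exact: vderiv_dot (sG.1 t).
- exact: smooth_dot_cont sT.
Qed.

Lemma strand_side v a eps : 0 < eps ->
  \forall del \near 0^'+, forall t, `|t - a| <= del -> `|dot (P t) v - dot (P a) v| <= eps.
Proof. by move=> e0; apply: value_near => //; exact: smooth_dot_cont sP. Qed.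

Lemma dot_unit v w : dot v v = 1 -> dot w w = 1 -> `|dot v w| <= 1.
Proof.
move=> vv ww; rewrite -(ler_pXn2r (_ : 0 < 2)%N) ?nnegrE// expr1n real_normK ?num_real//.
have := dot_ge0 (v - dot v w *: w).
by rewrite dotBl !dotBr !dotZl !dotZr (dotC w v) vv ww; lra.
Qed.

(* A zero of the projected difference would be a multiple [z u]; its component along [N a] is
   small compared with its length. *)
Lemma diagonal_free u a : dot u u = 1 -> dot u (N a) != 0 ->
  \forall del \near 0^'+, forall s t e, `|s - a| <= del -> `|t - a| <= del -> 0 < e ->
    Defs.proj u (G s) != Defs.proj u (ribbon e t).
Proof.
move=> uu g0; pose g := `|dot u (N a)|.
have g1 : 0 < g by rewrite normr_gt0.
have gl : g <= 1 by apply: dot_unit => //; have [] := frameP (fr a).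
pose eps := g / 8; have e0 : 0 < eps by rewrite divr_gt0.
have [TT PP TP _] := fr a; have [NN TN PN PT _] := frameP (fr a).
have c1 := strand_chord (T a) a e0; have c2 := strand_chord (P a) a e0.
have c3 := strand_chord (N a) a e0; have c4 := strand_side (T a) a e0.
have c5 := strand_side (P a) a e0; have c6 := strand_side (N a) a e0.
apply: filterS3 (filterI c1 c2) (filterI c3 c4) (filterI c5 c6) =>
  del [h1 h2] [h3 h4] [h5 h6] s t e hs ht e_gt0.
apply/eqP => pE.
have := h1 _ _ hs ht; have := h2 _ _ hs ht; have := h3 _ _ hs ht.
have := h4 _ ht; have := h5 _ ht; have := h6 _ ht.
rewrite TT PP TP TN PN PT !mul0r !subr0 mul1r => k6 k5 k4 k3 k2 k1.
pose z := dot (G s - ribbon e t) u.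
have FE : G s - G t = e *: P t + z *: u.
  have : G s - ribbon e t = z *: u.
    have eG : G s = Defs.proj u (ribbon e t) + dot (G s) u *: u by rewrite -pE /Defs.proj subrK.
    rewrite /z dotBl scalerBl {1}eG /Defs.proj; move: (dot _ _ *: _) (dot _ _ *: _) => x1 x2.
    by apply: rv3P; rewrite !vecE; ring.
  move=> <-; rewrite /ribbon; move: (G s) (G t) (P t) => x1 x2 x3.
  by apply: rv3P; rewrite !vecE; ring.
have uT : `|dot u (T a)| <= 1 by apply: dot_unit.
have uP : `|dot u (P a)| <= 1 by apply: dot_unit.
move: k1 k2 k3; rewrite FE !dotDl !dotZl => k1 k2 k3.
exact: (oblique_absurd g1 gl e_gt0 (erefl g) uT uP k1 k2 k3 k4 k5 k6).
Qed.

(** The scalar product with the difference [m] of the two projections separates the strands; moving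
    the parameters and adding the push-off change it by too little. *)
Lemma apart_free u a b : Defs.proj u (G a) != Defs.proj u (G b) -> dot u u = 1 ->
  \forall del \near 0^'+, forall s t e, `|s - a| <= del -> `|t - b| <= del -> 0 < e <= del ->
    Defs.proj u (G s) != Defs.proj u (ribbon e t).
Proof.
move=> nab uu; pose m := Defs.proj u (G a) - Defs.proj u (G b).
have m0 : 0 < dot m m by rewrite dot_gt0 subr_eq0.
have mu : dot m u = 0.
  by rewrite /m /Defs.proj !dotBl !dotZl uu; ring.
have mE x : dot (Defs.proj u x) m = dot x m.
  by rewrite /Defs.proj dotBl dotZl (dotC u) mu mulr0 subr0.
pose c := dot m m; have c4 : 0 < c / 4 by rewrite divr_gt0.
pose K := `|dot (P b) m| + 1.
have K0 : 0 < K by rewrite ltr_wpDl.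
have h1 := value_near (@smooth_dot_cont _ _ m a sG) c4.
have h2 := value_near (@smooth_dot_cont _ _ m b sG) c4.
have h3 := strand_side m b ltr01.
have cK : 0 < c / 4 / K by rewrite divr_gt0.
have h4 := nbhs_right_le cK.
apply: filterS3 (filterI h1 h2) h3 h4 => del [k1 k2] k3 k4 s t e hs ht /andP[e0 ed].
apply/eqP => /(congr1 (fun x => dot x m)); rewrite !mE /ribbon dotDl dotZl => eq1.
have := k1 _ hs; have := k2 _ ht; have := k3 _ ht => q3 q2 q1.
have q4 : `|e * dot (P t) m| <= c / 4.
  rewrite normrM gtr0_norm//; apply: le_trans (_ : c / 4 / K * K <= _); last by rewrite divfK ?gt_eqF.
  apply: ler_pM => //; [exact: ltW|exact: le_trans k4|].
  have := ler_normD (dot (P t) m - dot (P b) m) (dot (P b) m); rewrite subrK /K; lra.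
have cE : c = dot (G a) m - dot (G b) m by rewrite /c {1}/m dotBl !mE.
move: q1 q2 q4 eq1 m0; rewrite -/c cE !ler_norml; lra.
Qed.

(** Near a point of the diagonal a chord of the curve is almost tangent, while a chord equal to [e]
    times a unit vector orthogonal to the tangent has tangential component at most [e / 4]. Then
    [|s - t| <= 2 / 7 * e], and the three components are too small for a vector of length [e]. Away
    from the diagonal the two points of the curve are distinct. *)
Lemma ribbon_disjoint (a b : R) : (G a = G b -> a = b) ->
  \forall del \near 0^'+, forall s t e l, `|s - a| <= del -> `|t - b| <= del -> 0 < e <= del ->
    G s != G t + e *: tilted l t.
Proof.
move=> hab.
have tl1 l t : dot (tilted l t) (tilted l t) = 1 /\ dot (tilted l t) (T t) = 0.
  have [TT PP TP _] := fr t; have [NN TN PN PT [NT NP]] := frameP (fr t).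
  rewrite /tilted !dotDl !dotDr !dotZl !dotZr NN PP NT NP PN PT.
  by split; [rewrite -[RHS](cos2Dsin2 l)|]; ring.
have [Gab|Gab] := eqVneq (G a) (G b).
  rewrite -(hab Gab); have e8 : 0 < (8^-1 : R) by rewrite invr_gt0.
  have [TT PP TP _] := fr a; have [NN TN PN PT [NT _]] := frameP (fr a).
  have c1 := strand_chord (T a) a e8; have c2 := strand_chord (P a) a e8.
  have c3 := strand_chord (N a) a e8; have c4 := strand_side (T a) a e8.
  have c5 := value_near (@smooth_dot_cont _ _ (T a) a sN) e8.
  apply: filterS3 (filterI c1 c2) (filterI c3 c4) c5 => del [h1 h2] [h3 h4] h5 s t e l hs ht /andP[e0 _].
  apply/eqP => Gs; have GE : G s - G t = e *: tilted l t by rewrite Gs addrAC subrr add0r.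
  have := h1 _ _ hs ht; have := h2 _ _ hs ht; have := h3 _ _ hs ht.
  have := h4 _ ht; have := h5 _ ht; rewrite TT PT NT TP TN !mul0r !subr0 mul1r => k5 k4 k3 k2 k1.
  have ve : dot (G s - G t) (G s - G t) = e ^+ 2.
    by rewrite GE dotZl dotZr (tl1 l t).1 mulr1 expr2.
  have va : `|dot (G s - G t) (T a)| <= e / 4.
    rewrite GE dotZl normrM gtr0_norm// ler_pM2l// /tilted dotDl !dotZl.
    apply: le_trans (ler_normD _ _) _; rewrite !normrM.
    have := cos_max l; have := sin_max l => m1 m2.
    have : `|cos l| * `|dot (N t) (T a)| <= 1 * 8^-1 by exact: ler_pM.
    have : `|sin l| * `|dot (P t) (T a)| <= 1 * 8^-1 by exact: ler_pM.
    lra.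
  have st : `|s - t| <= 2 / 7 * e.
    exact: norm_absorb8 k1 va.
  have := frame_norm (G s - G t) (fr a); rewrite ve => f2.
  have sq (x y : R) : `|x| <= y -> x ^+ 2 <= y ^+ 2.
    by move=> xy; rewrite -real_normK ?num_real// ler_pXn2r// ?nnegrE// (le_trans _ xy).
  have s1 := sq _ _ va.
  have s2 : dot (G s - G t) (P a) ^+ 2 <= (e / 4) ^+ 2 by apply: sq; apply: le_trans k2 _; lra.
  have s3 : dot (G s - G t) (N a) ^+ 2 <= (e / 4) ^+ 2 by apply: sq; apply: le_trans k3 _; lra.
  have e2 : 0 < e ^+ 2 by rewrite exprn_gt0.
  by move: s1 s2 s3; rewrite !expr_div_n; lra.
pose m := G a - G b; have m0 : 0 < dot m m by rewrite dot_gt0 subr_eq0.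
pose c := dot m m; have c4 : 0 < c / 4 by rewrite divr_gt0.
have h1 := value_near (@smooth_dot_cont _ _ m a sG) c4.
have h2 := value_near (@smooth_dot_cont _ _ m b sG) c4.
have K0 : 0 < c + 1 by rewrite ltr_wpDr.
have cK : 0 < c / 4 / (c + 1) by rewrite divr_gt0.
have h4 := nbhs_right_le cK.
apply: filterS3 h1 h2 h4 => del k1 k2 k4 s t e l hs ht /andP[e0 ed].
apply/eqP => /(congr1 (fun x => dot x m)); rewrite dotDl dotZl => eq1.
have := k1 _ hs; have := k2 _ ht => q2 q1.
have q3 : `|dot (tilted l t) m| <= c + 1.
  exact: norm_dot_le (tl1 l t).1.
have q4 : `|e * dot (tilted l t) m| <= c / 4.
  rewrite normrM gtr0_norm//; apply: le_trans (_ : c / 4 / (c + 1) * (c + 1) <= _); last by rewrite divfK ?gt_eqF.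
  by apply: ler_pM => //; [exact: ltW|exact: le_trans k4].
have cE : c = dot (G a) m - dot (G b) m by rewrite /c {1}/m dotBl.
move: q1 q2 q4 eq1 m0; rewrite -/c cE !ler_norml; lra.
Qed.

End strands.

(** * Sign estimates for the components of the projected difference *)

Section inequalities.
Context {R : realType}.
Implicit Types (b X Y Z W h e tau x del eps C : R).

(** [X] is a component of the chord, with slope [b] in [h = s - t], and [e * Y] that of the
    push-off. The chord wins once [h >= 4 / |b| * e]. *)
Lemma steep_gt0 b X Y h e : b != 0 -> 0 < e -> `|X - b * h| <= `|b| / 2 * `|h| -> `|Y| <= 1 ->
  4 / `|b| * e <= h -> 0 < Num.sg b * (X - e * Y).
Proof.
move=> b0 e0 hX hY hh; have nb : 0 < `|b| by rewrite normr_gt0.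
have c0 : 0 < 4 / `|b| by rewrite divr_gt0.
have h0 : 0 <= h by apply: le_trans hh; rewrite mulr_ge0// ltW.
have bh : 4 * e <= `|b| * h.
  by have := ler_wpM2l (ltW nb) hh; rewrite mulrA (mulrC `|b|) divfK ?gt_eqF.
have s1 : `|Num.sg b| = 1 by rewrite normr_sg b0.
have h1 : `|Num.sg b * X - `|b| * h| <= `|b| / 2 * h.
  have -> : Num.sg b * X - `|b| * h = Num.sg b * (X - b * h).
    by rewrite (normrEsg b); ring.
  by move: hX; rewrite normrM s1 mul1r (ger0_norm h0).
have h2 : `|Num.sg b * (e * Y)| <= e.
  by rewrite normrM s1 mul1r normrM gtr0_norm// ler_piMr// ltW.
move: h1 h2; rewrite mulrBr !ler_norml; move: bh; rewrite -mulrA (mulrCA _ 2^-1).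
by move: (`|b| * h) (Num.sg b * X) (Num.sg b * (e * Y)) => y z w; lra.
Qed.

Lemma steep_lt0 b X Y h e : b != 0 -> 0 < e -> `|X - b * h| <= `|b| / 2 * `|h| -> `|Y| <= 1 ->
  h <= - (4 / `|b| * e) -> Num.sg b * (X - e * Y) < 0.
Proof.
move=> b0 e0 hX hY hh; rewrite -oppr_gt0.
have -> : - (Num.sg b * (X - e * Y)) = Num.sg b * (- X - e * - Y) by ring.
apply: (steep_gt0 (h := - h)); rewrite ?normrN//; last by lra.
by rewrite (_ : _ - _ = - (X - b * h)) ?normrN//; ring.
Qed.

(** [Z] is the normal component of the chord, of order [del * h], and [W] that of the conormal,
    close to [tau * x] with [x = t - a]. When [|h| <= C * e], both [Z] and the error of [e * W] are
    small compared with [e * |tau| * del / 2]. *)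
Lemma flat_gt0 tau Z W x del eps C h e : tau != 0 -> 0 < e -> 0 < del -> 0 <= eps ->
  `|Z| <= eps * del * `|h| -> `|h| <= C * e -> `|W - tau * x| <= eps * `|x| ->
  del / 2 <= x <= del -> eps * (C + 1) <= `|tau| / 8 -> 0 < - Num.sg tau * (Z - e * W).
Proof.
move=> t0 e0 d0 ep hZ hh hW /andP[x1 x2] hC; have nt : 0 < `|tau| by rewrite normr_gt0.
have s1 : `|Num.sg tau| = 1 by rewrite normr_sg t0.
have x0 : 0 < x by apply: lt_le_trans x1; rewrite divr_gt0.
have h1 : `|Num.sg tau * W - `|tau| * x| <= eps * del.
  have -> : Num.sg tau * W - `|tau| * x = Num.sg tau * (W - tau * x).
    by rewrite (normrEsg tau); ring.
  rewrite normrM s1 mul1r; apply: le_trans hW _.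
  by rewrite ler_wpM2l// gtr0_norm.
have h2 : `|Num.sg tau * Z| <= e * (eps * del * C).
  rewrite normrM s1 mul1r; apply: le_trans hZ _.
  rewrite (_ : e * _ = eps * del * (C * e)); last by ring.
  by rewrite ler_wpM2l// mulr_ge0// ltW.
have h3 : `|tau| * (del / 2) <= `|tau| * x by rewrite ler_wpM2l// ltW.
have h4 : del * (eps * (C + 1)) <= del * (`|tau| / 8) by rewrite ler_wpM2l// ltW.
have key : eps * del * C < Num.sg tau * W.
  move: h1 h3 h4; rewrite ler_norml; have : 0 < `|tau| * del by rewrite mulr_gt0.
  rewrite (_ : del * (eps * (C + 1)) = eps * del * C + eps * del); last by ring.
  rewrite (_ : `|tau| * (del / 2) = `|tau| * del / 2); last by ring.
  rewrite (_ : del * (`|tau| / 8) = `|tau| * del / 8); last by ring.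
  by move: (eps * del * C) (eps * del) (`|tau| * del) (`|tau| * x) (Num.sg tau * W) => *; lra.
have : e * (eps * del * C) < e * (Num.sg tau * W) by rewrite ltr_pM2l.
have -> : - Num.sg tau * (Z - e * W) = e * (Num.sg tau * W) - Num.sg tau * Z by ring.
move: h2; rewrite ler_norml.
by move: (e * (eps * del * C)) (e * (Num.sg tau * W)) (Num.sg tau * Z) => *; lra.
Qed.

Lemma flat_lt0 tau Z W x del eps C h e : tau != 0 -> 0 < e -> 0 < del -> 0 <= eps ->
  `|Z| <= eps * del * `|h| -> `|h| <= C * e -> `|W - tau * x| <= eps * `|x| ->
  - del <= x <= - (del / 2) -> eps * (C + 1) <= `|tau| / 8 -> - Num.sg tau * (Z - e * W) < 0.
Proof.
move=> t0 e0 d0 ep hZ hh hW hx hC; rewrite -oppr_gt0.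
have -> : - (- Num.sg tau * (Z - e * W)) = - Num.sg tau * (- Z - e * - W) by ring.
apply: (flat_gt0 (h := h) (x := - x) (del := del) (eps := eps) (C := C)) => //.
- by rewrite normrN.
- by rewrite (_ : _ - _ = - (W - tau * x)) ?normrN//; ring.
- lra.
Qed.

Lemma sign_persist z e Y (x x' y y' : R) : z != 0 -> z = x - y -> e <= `|z| / 4 -> `|Y| <= e ->
  `|x' - x| <= `|z| / 4 -> `|y' - y| <= `|z| / 4 -> 0 < Num.sg z * (x' - y' - Y).
Proof.
move=> z0 zE; rewrite !ler_norml; have [zn|zp|zz] := ltrgtP z 0; last by rewrite zz eqxx in z0.
  by rewrite (ltr0_sg zn) (ltr0_norm zn); lra.
by rewrite (gtr0_sg zp) (gtr0_norm zp); lra.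
Qed.

Lemma sg_opp_gt0 b z : b * z < 0 -> 0 < - Num.sg b * z.
Proof.
move=> bz; have b0 : b != 0 by apply: contraTneq bz => ->; rewrite mul0r ltxx.
have nb : 0 < `|b| by rewrite normr_gt0.
rewrite -(pmulr_rgt0 _ nb) (_ : `|b| * _ = - (b * z)) ?oppr_gt0//.
by rewrite [in RHS](numEsg b); ring.
Qed.

Lemma ler_wDD (x y : R) : 0 < y -> x - y <= x + y.
Proof. by lra. Qed.

Lemma sum_le3 (x y z eta del : R) : x <= eta / 4 * del -> y <= eta / 4 * del ->
  z <= eta / 4 * del -> 0 <= eta * del -> x + y + z <= eta * del.
Proof. by rewrite (mulrAC eta); move: (eta * del) => w; lra. Qed.

(** [X] is the conormal component of the chord, at most [e / 4]; the push-off subtracts at least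
    [e / 2]. *)
Lemma dip_lt0 X Y e h eps C : `|X| <= eps * `|h| -> `|h| <= C * e -> 0 <= eps -> eps * (C * e) <= e / 4 ->
  `|Y - 1| <= 2^-1 -> 0 < e -> X - e * Y < 0.
Proof.
move=> hX hh e0 hC hY ep; have h1 := ler_wpM2l e0 hh.
have : e * 2^-1 <= e * Y by rewrite ler_wpM2l ?(ltW ep)//; move: hY; rewrite ler_norml; lra.
move: hX; rewrite ler_norml; move: (eps * `|h|) (eps * (C * e)) (e * Y) h1 hC => *; lra.
Qed.

End inequalities.

Section planar_forms.
Context {R : realType} (p q u : 'rV[R]_3) (fpq : frame p q u).

Lemma frame_dot (F v : 'rV[R]_3) : dot v u = 0 -> dot v p * dot F p + dot v q * dot F q = dot F v.
Proof.
by move=> vu; rewrite {3}(frame_decomp v fpq) vu scale0r addr0 dotDr !dotZr.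
Qed.

Lemma frame_cross (v w : 'rV[R]_3) : dot v p * dot w q - dot v q * dot w p = dot (cross v w) u.
Proof. by have [_ _ _ <-] := fpq; rewrite !vecE; ring. Qed.

End planar_forms.

Lemma vsmooth_add (R : realType) (F A H B : R -> 'rV[R]_3) a : vsmooth F A -> vsmooth H B ->
  vsmooth (fun t => F t + a *: H t) (fun t => A t + a *: B t).
Proof.
move=> sF sH; split.
  move=> t i; rewrite (_ : (fun s => _) = (fun s => F s 0 i + a * H s 0 i)); last first.
    by apply/funext => s; rewrite !mxE.
  by apply: is_derive_eq (deriveA (sF.1 t i) (deriveK a (sH.1 t i))) _; rewrite !mxE.
move=> i t; rewrite (_ : (fun s => _) = (fun s => A s 0 i + a * B s 0 i)); last first.
  by apply/funext => s; rewrite !mxE.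
apply: (@contA _ _ (fun s => A s 0 i) (fun s => a * B s 0 i) t); first exact: sF.2.
by apply: (@contM _ _ (fun=> a) (fun s => B s 0 i) t); [exact: contC|exact: sH.2].
Qed.

Section diagonal_boxes.
Context {R : realType} (g d : curve R) (smg : smooth g) (smd : smooth d).

(** The border of the square meets the strip [|s - t| <= r] only around its two corners on the
    diagonal, where [t - a] is within [del / 2] of [del] or [- del]. The form [A] decides outside
    the strip and [B] at these corners; the four cutting points are those where the border leaves
    the strip. *)
Lemma diagonal_circulation (f A1 A2 B1 B2 a del r : R) : 0 < r -> r <= del / 2 ->
  f ^+ 2 = 1 -> 0 < f * (A1 * B2 - A2 * B1) ->
  (forall s t, a - del <= s <= a + del -> a - del <= t <= a + del -> r <= s - t ->
     0 < A1 * rx g d s t + A2 * ry g d s t) ->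
  (forall s t, a - del <= s <= a + del -> a - del <= t <= a + del -> s - t <= - r ->
     A1 * rx g d s t + A2 * ry g d s t < 0) ->
  (forall s t, a - del <= s <= a + del -> a - del <= t <= a + del -> `|s - t| <= r ->
     del / 2 <= t - a <= del -> 0 < B1 * rx g d s t + B2 * ry g d s t) ->
  (forall s t, a - del <= s <= a + del -> a - del <= t <= a + del -> `|s - t| <= r ->
     - del <= t - a <= - (del / 2) -> B1 * rx g d s t + B2 * ry g d s t < 0) ->
  circulation g d (@k_angle R) (a - del) (a + del) (a - del) (a + del) = f * (2 * pi) /\
  forall s t, on_border (a - del) (a + del) (a - del) (a + del) s t -> planar g d s t != 0.
Proof.
move=> r0 rd f1 fAB Ap An Bp Bn; split.
  apply: (@circulation_box R g d smg smd f A1 A2 B1 B2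
    _ _ _ _ (a - del + r) (a + del - r) (a + del - r) (a - del + r)) => //.
  - by apply/andP; split; lra.
  - by apply/andP; split; lra.
  - by apply/andP; split; lra.
  - by apply/andP; split; lra.
  - by move=> s hs; apply: Ap; lra.
  - by move=> t ht; apply: Ap; lra.
  - by move=> t ht; apply: Bp; rewrite ?ler_norml; lra.
  - by move=> s hs; apply: Bp; rewrite ?ler_norml; lra.
  - by move=> s hs; apply: An; lra.
  - by move=> t ht; apply: An; lra.
  - by move=> t ht; apply: Bn; rewrite ?ler_norml; lra.
  - by move=> s hs; apply: Bn; rewrite ?ler_norml; lra.
have nz u v s t : u * rx g d s t + v * ry g d s t != 0 -> planar g d s t != 0.
  apply: contra_neq => /eqP; rewrite /planar paddr_eq0 ?sqr_ge0// !sqrf_eq0.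
  by move=> /andP[/eqP -> /eqP ->]; rewrite !mulr0 addr0.
move=> s t [hs [ht bd]]; have [h|h] := lerP r (s - t).
  by apply: (nz A1 A2); rewrite gt_eqF// Ap.
have [h'|h'] := lerP (s - t) (- r).
  by apply: (nz A1 A2); rewrite lt_eqF// An.
have hst : `|s - t| <= r by rewrite ler_norml; lra.
have lo : - del <= t - a <= - (del / 2) -> planar g d s t != 0.
  by move=> ta; apply: (nz B1 B2); rewrite lt_eqF// Bn.
have hi : del / 2 <= t - a <= del -> planar g d s t != 0.
  by move=> ta; apply: (nz B1 B2); rewrite gt_eqF// Bp.
by case: bd => bd; [apply: lo|apply: hi|apply: lo|apply: hi]; lra.
Qed.

End diagonal_boxes.

(** * Contribution of each box for the tangential push-off *)

Section boxes.
Context {R : realType} (L : R) (G T P N : R -> 'rV[R]_3) (k tau : R -> R).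
Hypothesis dbx : darboux L G T P N k tau.
Context (p q u : 'rV[R]_3) (fpq : frame p q u).
Implicit Types (a b s t r e eps del l : R).

Let fr t : frame (T t) (P t) (N t). Proof. by have [_ h _ _ _] := dbx. Qed.
Let sG : vsmooth G T. Proof. by have [_ _ [] ] := dbx. Qed.
Let sT : vsmooth T (fun t => k t *: P t). Proof. by have [_ _ [] ] := dbx. Qed.
Let sP : vsmooth P (fun t => - k t *: T t + tau t *: N t). Proof. by have [_ _ [] ] := dbx. Qed.
Let sN : vsmooth N (fun t => - tau t *: P t). Proof. by have [_ _ [] ] := dbx. Qed.
Let ck : continuous k. Proof. by have [[]] := dbx. Qed.
Let ct : continuous tau. Proof. by have [[]] := dbx. Qed.

Lemma ribbon_smooth e : vsmooth (ribbon G P e) (ribbon' T N k tau e).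
Proof. exact: vsmooth_add sG sP. Qed.

Let D e := ribbon G P e.
Let g := curve_in p q u G T.
Let d e := curve_in p q u (D e) (ribbon' T N k tau e).
Let smg : smooth g. Proof. exact: smooth_curve_in. Qed.
Let smd e : smooth (d e). Proof. by apply: smooth_curve_in; exact: ribbon_smooth. Qed.

Let rho_pos e : (forall s t, G s != D e t) ->
  forall s t, 0 < rho (rx g (d e) s t) (ry g (d e) s t) (rz g (d e) s t).
Proof. by move=> h s t; exact: rho_in_gt0. Qed.

Let uu : dot u u = 1. Proof. by have [] := frameP fpq. Qed.
Let pp : dot p p = 1. Proof. by have [] := fpq. Qed.
Let qq : dot q q = 1. Proof. by have [] := fpq. Qed.
Let PP t : dot (P t) (P t) = 1. Proof. by have [] := fr t. Qed.

Let FE e s t v : dot (G s - D e t) v = dot (G s - G t) v - e * dot (P t) v.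
Proof. by rewrite /D /ribbon !dotBl dotDl dotZl; ring. Qed.

(** The size [e] is chosen after [del]: the box must be small for the linear approximations, and the
    push-off small compared with the box. *)
Definition box_defect a b w := \forall del \near 0^'+, \forall e \near 0^'+,
  (forall s t, G s != D e t) ->
  defect g (d e) (a - del) (a + del) (b - del) (b + del) = w.

Lemma box_free a b : (\forall r \near 0^'+, forall s t e, `|s - a| <= r -> `|t - b| <= r ->
    0 < e <= r -> Defs.proj u (G s) != Defs.proj u (D e t)) -> box_defect a b 0.
Proof.
move=> h; have d0 := nbhs_right_gt (0 : R); apply: filterS2 h d0 => del h del0.
have e0 := nbhs_right_gt (0 : R); have e1 := nbhs_right_le del0.
apply: filterS2 e0 e1 => e e0 e1 dj.
apply: (defect_free smg (smd e) (rho_pos dj)); [exact: ler_wDD|exact: ler_wDD|].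
move=> s t hs ht; rewrite (planar_in fpq); have [h1 h2] := in_boxE hs ht.
by apply: h => //; rewrite e0.
Qed.

(** The push-off displaces the linear picture of a transversal crossing by at most [e], which is
    absorbed in the error [eta * del] allowed by [linear_box]; the difference of heights keeps its
    sign. *)
Lemma box_crossing a b : Defs.proj u (G a) = Defs.proj u (G b) -> dot (G a - G b) u != 0 ->
  dot (cross (T a) (T b)) u != 0 ->
  box_defect a b (Num.sg (dot (G a - G b) u) * Num.sg (dot (cross (T a) (T b)) u) * (2 * pi)).
Proof.
move=> pab; set z := dot (G a - G b) u => z0 c0.
have up : dot u p = 0 /\ dot u q = 0 by have [_ _ _ _] := frameP fpq.
have X0 v : dot u v = 0 -> dot (G a) v = dot (G b) v.
  move=> uv; have := congr1 (fun x => dot x v) pab.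
  by rewrite /Defs.proj !dotBl !dotZl uv !mulr0 !subr0.
pose p1 := dot (T a) p; pose p2 := dot (T a) q; pose q1 := - dot (T b) p; pose q2 := - dot (T b) q.
pose Dt := p1 * q2 - p2 * q1.
have DE : Dt = - dot (cross (T a) (T b)) u.
  by rewrite -(frame_cross fpq) /Dt /p1 /p2 /q1 /q2; ring.
have D0 : Dt != 0 by rewrite DE oppr_eq0.
pose M := `|p1| + `|p2| + `|q1| + `|q2|.
have M0 : 0 <= M by rewrite !addr_ge0.
pose eta := `|Dt| / 2 / (M + 1).
have Dp : 0 < `|Dt| / 2 by rewrite divr_gt0// normr_gt0.
have eta0 : 0 < eta by rewrite divr_gt0//; lra.
have etaN : M * eta < `|Dt|.
  rewrite mulrC; apply: le_lt_trans (frac_le Dp M0) _.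
  by rewrite ltr_pdivrMr// ltr_pMr ?normr_gt0// ltr1n.
have e4 : 0 < eta / 4 by rewrite divr_gt0.
have z4 : 0 < `|z| / 4 by rewrite divr_gt0// normr_gt0.
have c1 := strand_chord dbx p a e4; have c2 := strand_chord dbx q a e4.
have c3 := strand_chord dbx p b e4; have c4 := strand_chord dbx q b e4.
have c5 := value_near (@smooth_dot_cont _ _ _ u a sG) z4.
have c6 := value_near (@smooth_dot_cont _ _ _ u b sG) z4.
have d0 := nbhs_right_gt (0 : R).
apply: filterS3 (filterI c1 c2) (filterI c3 c4) (filterI (filterI c5 c6) d0) =>
  del [h1 h2] [h3 h4] [[h5 h6] del0].
have e0 := nbhs_right_gt (0 : R).
have ed : 0 < eta / 4 * del by rewrite mulr_gt0.
apply: filterS3 e0 (nbhs_right_le ed) (nbhs_right_le z4) => e e_gt0 e1 e2 dj.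
have eP v t : dot v v = 1 -> `|e * dot (P t) v| <= e.
  by move=> vv; rewrite normrM gtr0_norm// ler_piMr ?(ltW e_gt0)// dot_unit.
have lin v s t : in_box a b del s t -> dot u v = 0 -> dot v v = 1 ->
    (forall s t, `|s - a| <= del -> `|t - a| <= del ->
       `|dot (G s - G t) v - dot (T a) v * (s - t)| <= eta / 4 * `|s - t|) ->
    (forall s t, `|s - b| <= del -> `|t - b| <= del ->
       `|dot (G s - G t) v - dot (T b) v * (s - t)| <= eta / 4 * `|s - t|) ->
    `|dot (G s - D e t) v - (dot (T a) v * (s - a) + - dot (T b) v * (t - b))| <= eta * del.
  move=> [hs ht] uv vv ca cb.
  have aa : `|a - a| <= del by rewrite subrr normr0 ltW.
  have bb : `|b - b| <= del by rewrite subrr normr0 ltW.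
  have k1 := ca _ _ hs aa; have k2 := cb _ _ ht bb; have k3 := eP v t vv.
  have m1 : eta / 4 * `|s - a| <= eta / 4 * del by rewrite ler_wpM2l// ltW.
  have m2 : eta / 4 * `|t - b| <= eta / 4 * del by rewrite ler_wpM2l// ltW.
  rewrite FE (_ : _ - _ = (dot (G s - G a) v - dot (T a) v * (s - a))
     - (dot (G t - G b) v - dot (T b) v * (t - b)) - e * dot (P t) v); last first.
    by rewrite !dotBl (X0 v uv); ring.
  apply: le_trans (ler_normB _ _) _; apply: le_trans (lerD (ler_normB _ _) (lexx _)) _.
  exact: sum_le3 (le_trans k1 m1) (le_trans k2 m2) (le_trans k3 e1) (mulr_ge0 (ltW eta0) (ltW del0)).
have [|circ brd] := @linear_box R g (d e) smg (smd e) p1 p2 q1 q2 eta a b del del0 (ltW eta0) D0 etaN.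
  move=> s t hb; rewrite rx_in ry_in; have [u1 u2] := up.
  by split; [exact: (lin p s t hb u1 pp h1 h3)|exact: (lin q s t hb u2 qq h2 h4)].
rewrite (@defect_box R g (d e) smg (smd e) (rho_pos dj) (Num.sg z))//.
- by rewrite circ -/Dt DE sgrN; ring.
- exact: ler_wDD.
- exact: ler_wDD.
- by rewrite sqr_sg z0.
- move=> s t hs ht _; have [k1 k2] := in_boxE hs ht; rewrite rz_in FE.
  rewrite dotBl; apply: (sign_persist z0 _ e2 (eP u t uu) (h5 _ k1) (h6 _ k2)).
  by rewrite /z dotBl.
Qed.

Let tau_neq0 a : tau a != 0.
Proof.
have [_ _ _ _ [h _]] := dbx; have := h a a.
by apply: contraTneq => ->; rewrite mulr0 ltxx.
Qed.

(* Along the diagonal the projected difference is [(s - t) T - e P] up to errors: its component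
   across [u] in the tangent plane has the sign of [s - t] as soon as [|s - t| >= C e], and its
   normal component at the two remaining corners is [- e tau (t - a)]. *)
Lemma box_tangent a : dot u (N a) = 0 -> dot u (P a) != 0 ->
  box_defect a a (Num.sg (tau a) * (2 * pi)).
Proof.
move=> uN b0; have t0 := tau_neq0 a.
have [TT _ TP TPN] := fr a; have [NN TN PN PT [NT NP]] := frameP (fr a).
pose al := dot u (T a); pose be := dot u (P a).
have ab : al ^+ 2 + be ^+ 2 = 1.
  by have := frame_norm u (fr a); rewrite uN uu expr0n addr0.
(* The unit vector of the tangent plane at [a] orthogonal to [u], which itself lies in this
   plane. *)
pose Q := be *: T a - al *: P a.
have QQ : dot Q Q = 1.
  rewrite /Q !(dotBl, dotBr, dotZl, dotZr) TT PP TP PT -[RHS]ab; ring.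
have Qu : dot Q u = 0.
  by rewrite /Q dotBl !dotZl (dotC (T a)) (dotC (P a)) -/al -/be; ring.
have TQ : dot (T a) Q = be by rewrite /Q dotBr !dotZr TT TP; ring.
have uE : u = al *: T a + be *: P a.
  by rewrite {1}(frame_decomp u (fr a)) uN scale0r addr0.
(* At a zero of the projection the component along [Q] vanishes, so the height is the conormal
   component divided by [be]. *)
have PE F : be * dot F u = dot F (P a) + al * dot F Q.
  have uF : dot F u = al * dot F (T a) + be * dot F (P a) by rewrite [in LHS]uE dotDr !dotZr.
  have QF : dot F Q = be * dot F (T a) - al * dot F (P a) by rewrite /Q dotBr !dotZr.
  apply/eqP; rewrite -subr_eq0 uF QF; move: (dot F (T a)) (dot F (P a)) => x y.
  have -> : be * (al * x + be * y) - (y + al * (be * x - al * y)) =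
    ((al ^+ 2 + be ^+ 2) - 1) * y by ring.
  by rewrite ab subrr mul0r.
have nb : 0 < `|be| by rewrite normr_gt0.
(* The threshold of [steep_gt0] for the slope [be]; [eps] is what [flat_gt0] asks for this [C], and
   [eps'] satisfies [eps' * (C * e) = e / 4] for [dip_lt0]. *)
pose C := 4 / `|be|.
have C0 : 0 < C by rewrite divr_gt0.
have nt : 0 < `|tau a| by rewrite normr_gt0.
pose eps := `|tau a| / 8 / (C + 1).
have C1 : 0 < C + 1 by rewrite ltr_wpDl// ltW.
have eps0 : 0 < eps by rewrite !divr_gt0.
have epsC : eps * (C + 1) <= `|tau a| / 8 by rewrite /eps divfK// gt_eqF.
pose eps' := (4 * C)^-1.
have eps'0 : 0 < eps' by rewrite invr_gt0 mulr_gt0.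
have be2 : 0 < `|be| / 2 by rewrite divr_gt0.
have half0 : 0 < (2^-1 : R) by rewrite invr_gt0.
have c1 := strand_chord dbx Q a be2.
(* Because the normal curvature vanishes, the derivative of the tangent has no normal component at
   [a]: the normal component of a chord is of second order. *)
have c2 : \forall del \near 0^'+, forall s t, `|s - a| <= del -> `|t - a| <= del ->
    `|dot (G s - G t) (N a)| <= eps * del * `|s - t|.
  have cf : {for a, continuous (fun s => dot (k s *: P s) (N a))}.
    rewrite (_ : (fun s => _) = (fun s => k s * dot (P s) (N a))).
      apply: (@contM _ _ k (fun s => dot (P s) (N a)) a); first exact: ck.
      exact: (@smooth_dot_cont _ _ _ (N a) a sP).
    by apply/funext => s; rewrite dotZl.
  have h := chord_near (fun t => vderiv_dot (N a) (sT.1 t)) cf eps0.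
  have d0 := nbhs_right_gt (0 : R); apply: filterS2 h d0 => del h del0 s t hs ht.
  have := @derive_mean_bound R (fun s => dot (G s) (N a)) (fun s => dot (T s) (N a)) t s 0 (eps * del).
  rewrite mul0r subr0 dotBl; apply; first by rewrite mulr_ge0 ?(ltW eps0)// ltW.
  move=> z hz; split; first exact: vderiv_dot (sG.1 z).
  have za := between_ball ht hs hz.
  have aa : `|a - a| <= del by rewrite subrr normr0 ltW.
  have := h _ _ za aa; rewrite TN dotZl PN mulr0 mul0r !subr0 => h'.
  by apply: le_trans h' _; rewrite ler_wpM2l// ltW.
have c3 : \forall del \near 0^'+, forall t, `|t - a| <= del ->
    `|dot (P t) (N a) - tau a * (t - a)| <= eps * `|t - a|.
  have fE s : dot (- k s *: T s + tau s *: N s) (N a) =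
      - k s * dot (T s) (N a) + tau s * dot (N s) (N a) by rewrite dotDl !dotZl.
  have cf : {for a, continuous (fun s => dot (- k s *: T s + tau s *: N s) (N a))}.
    rewrite (_ : (fun s => _) = (fun s => - k s * dot (T s) (N a) + tau s * dot (N s) (N a))).
      apply: (@contA _ _ (fun s => - k s * dot (T s) (N a)) (fun s => tau s * dot (N s) (N a)) a).
        apply: (@contM _ _ (fun s => - k s) (fun s => dot (T s) (N a)) a).
          by apply: contN; exact: ck.
        exact: (@smooth_dot_cont _ _ _ (N a) a sT).
      apply: (@contM _ _ tau (fun s => dot (N s) (N a)) a); first exact: ct.
      exact: (@smooth_dot_cont _ _ _ (N a) a sN).
    by apply/funext => s; rewrite fE.
  have h := chord_near (fun t => vderiv_dot (N a) (sP.1 t)) cf eps0.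
  have d0 := nbhs_right_gt (0 : R); apply: filterS2 h d0 => del h del0 t ht.
  have aa : `|a - a| <= del by rewrite subrr normr0 ltW.
  by have := h _ _ ht aa; rewrite fE TN NN PN mulr0 add0r mulr1 subr0.
have c4 := strand_chord dbx (P a) a eps'0.
have c5 := strand_side dbx (P a) a half0.
have d0 := nbhs_right_gt (0 : R).
apply: filterS3 (filterI c1 c2) (filterI c3 c4) (filterI c5 d0) => del [h1 h2] [h3 h4] [h5 del0].
have e0 := nbhs_right_gt (0 : R).
have ed : 0 < del / 2 / C by rewrite !divr_gt0.
apply: filterS2 e0 (nbhs_right_le ed) => e e_gt0 e1 dj.
have Ce : C * e <= del / 2 by rewrite mulrC -ler_pdivlMr.
have Ce0 : 0 < C * e by rewrite mulr_gt0.
pose sb := Num.sg be; pose st := Num.sg (tau a).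
pose vA := sb *: Q; pose vB := - st *: N a.
have vAu : dot vA u = 0 by rewrite /vA dotZl Qu mulr0.
have vBu : dot vB u = 0 by rewrite /vB dotZl (dotC (N a)) uN mulr0.
have inb s : a - del <= s <= a + del -> `|s - a| <= del by rewrite ler_distl.
have form v s t : dot v u = 0 ->
    dot v p * rx g (d e) s t + dot v q * ry g (d e) s t = dot (G s - D e t) v.
  by move=> vu; rewrite rx_in ry_in; exact: (frame_dot fpq).
have PQ1 t : `|dot (P t) Q| <= 1 by apply: dot_unit.
have h1' s t : `|s - a| <= del -> `|t - a| <= del ->
    `|dot (G s - G t) Q - be * (s - t)| <= `|be| / 2 * `|s - t|.
  by move=> hs ht; have := h1 s t hs ht; rewrite TQ.
have A_pos s t : a - del <= s <= a + del -> a - del <= t <= a + del -> C * e <= s - t ->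
    0 < dot (G s - D e t) vA.
  move=> /inb hs /inb ht st0; rewrite /vA dotZr FE.
  by apply: (steep_gt0 (h := s - t)) => //; exact: h1'.
have A_neg s t : a - del <= s <= a + del -> a - del <= t <= a + del -> s - t <= - (C * e) ->
    dot (G s - D e t) vA < 0.
  move=> /inb hs /inb ht st0; rewrite /vA dotZr FE.
  by apply: (steep_lt0 (h := s - t)) => //; exact: h1'.
have B_pos s t : a - del <= s <= a + del -> a - del <= t <= a + del -> `|s - t| <= C * e ->
    del / 2 <= t - a <= del -> 0 < dot (G s - D e t) vB.
  move=> /inb hs /inb ht st0 ta; rewrite /vB dotZr FE.
  apply: (flat_gt0 (h := s - t) (x := t - a) (del := del) (eps := eps) (C := C)) => //.
  - exact: ltW.
  - exact: h2.
  - exact: h3.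
have B_neg s t : a - del <= s <= a + del -> a - del <= t <= a + del -> `|s - t| <= C * e ->
    - del <= t - a <= - (del / 2) -> dot (G s - D e t) vB < 0.
  move=> /inb hs /inb ht st0 ta; rewrite /vB dotZr FE.
  apply: (flat_lt0 (h := s - t) (x := t - a) (del := del) (eps := eps) (C := C)) => //.
  - exact: ltW.
  - exact: h2.
  - exact: h3.
have sb2 : sb ^+ 2 = 1 by rewrite sqr_sg b0.
have st2 : st ^+ 2 = 1 by rewrite sqr_sg t0.
have crs : dot (cross vA vB) u = sb * st.
  rewrite (_ : cross vA vB = (sb * st) *: (be *: P a + al *: T a)); last first.
    have cNT : cross (N a) (T a) = P a.
      transitivity (dot (T a) (T a) *: P a - dot (T a) (P a) *: T a).
        by rewrite -TPN; move: (T a) (P a) => v w; apply: rv3P; rewrite !vecE; ring.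
      by rewrite TT TP scale1r scale0r subr0.
    have cNP : cross (N a) (P a) = - T a.
      transitivity (dot (T a) (P a) *: P a - dot (P a) (P a) *: T a).
        by rewrite -TPN; move: (T a) (P a) => v w; apply: rv3P; rewrite !vecE; ring.
      by rewrite PP TP scale1r scale0r sub0r.
    transitivity ((sb * st) *: (be *: cross (N a) (T a) - al *: cross (N a) (P a))).
      by rewrite /vA /vB /Q; move: (N a) (T a) (P a) => x y z; apply: rv3P; rewrite !vecE; ring.
    by rewrite cNT cNP scalerN opprK.
  by rewrite addrC -uE dotZl uu mulr1.
have [circ brd] : circulation g (d e) (@k_angle R) (a - del) (a + del) (a - del) (a + del) =
    sb * st * (2 * pi) /\
    forall s t, on_border (a - del) (a + del) (a - del) (a + del) s t -> planar g (d e) s t != 0.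
  apply: (@diagonal_circulation R g (d e) smg (smd e) (sb * st) (dot vA p) (dot vA q) (dot vB p)
    (dot vB q) a del (C * e)) => //.
  - by rewrite exprMn sb2 st2 mulr1.
  - by rewrite (frame_cross fpq) crs -expr2 exprMn sb2 st2 mulr1.
  - by move=> s t hs ht h; rewrite (form vA s t vAu); exact: A_pos.
  - by move=> s t hs ht h; rewrite (form vA s t vAu); exact: A_neg.
  - by move=> s t hs ht h ta; rewrite (form vB s t vBu); exact: B_pos.
  - by move=> s t hs ht h ta; rewrite (form vB s t vBu); exact: B_neg.
have ad : a - del <= a + del by apply: ler_wDD del0.
(* At any zero in the square the conormal component is negative, close to [- e], so the height has
   the sign of [- be]; this sign cancels the factor [sb] of the winding number. *)
rewrite (@defect_box R g (d e) smg (smd e) (rho_pos dj) (- sb))//.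
- by rewrite circ opprK mulrA mulrA mulrA -[sb * sb]expr2 sb2 mul1r mulrA.
- by rewrite sqrrN.
- move=> s t hs ht z0; rewrite rz_in.
  have [x0 y0] : rx g (d e) s t = 0 /\ ry g (d e) s t = 0.
    move: z0 => /eqP; rewrite /planar paddr_eq0 ?sqr_ge0// !sqrf_eq0.
    by move=> /andP[/eqP-> /eqP->].
  have vz v : dot v u = 0 -> dot (G s - D e t) v = 0.
    by move=> vu; rewrite -(form _ _ _ vu) x0 y0 !mulr0 addr0.
  have hst : `|s - t| <= C * e.
    rewrite ler_norml; apply/andP; split; rewrite leNgt; apply/negP => h.
      by have := A_neg s t hs ht (ltW h); rewrite vz// ltxx.
    by have := A_pos s t hs ht (ltW h); rewrite vz// ltxx.
  have h : be * dot (G s - D e t) u = dot (G s - G t) (P a) - e * dot (P t) (P a).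
    by rewrite PE (vz Q Qu) mulr0 addr0 FE.
  have k4 := h4 _ _ (inb _ hs) (inb _ ht); have k5 := h5 _ (inb _ ht).
  rewrite TP mul0r subr0 in k4; rewrite PP in k5.
  apply: sg_opp_gt0; rewrite h.
  apply: (dip_lt0 k4 hst (ltW eps'0) _ k5 e_gt0).
  by rewrite /eps' mulrA invfM -(mulrA 4^-1) mulVf ?gt_eqF// mulr1 mulrC.
Qed.

End boxes.

(** * The linking number of the normal push-off *)

Section periodicity.
Context {R : realType} (L : R) (L0 : 0 < L).

Lemma period_mod (t : R) : exists z : int, 0 <= t - z%:~R * L < L.
Proof.
exists (Num.floor (t / L)).
have h1 : (Num.floor (t / L))%:~R <= t / L by exact: real_floor_le (num_real _).
have h2 : t / L < (Num.floor (t / L))%:~R + 1.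
  by have := real_floorD1_gt (num_real (t / L)); rewrite intrD.
rewrite subr_ge0 -ler_pdivlMr// h1/= ltrBlDl.
rewrite (_ : _ + L = ((Num.floor (t / L))%:~R + 1) * L); last by ring.
by rewrite -ltr_pdivrMr.
Qed.

Lemma periodic_int (X : Type) (f : R -> X) : (forall t, f (t + L) = f t) ->
  forall (z : int) t, f (t - z%:~R * L) = f t.
Proof.
move=> pf; have pn (m : nat) t : f (t + m%:R * L) = f t.
  elim: m t => [|m IH] t; first by rewrite mul0r addr0.
  by rewrite -natr1 mulrDl mul1r addrA pf IH.
move=> [m|m] t; last by rewrite NegzE mulrNz mulNr opprK pn.
by rewrite -[in RHS](subrK (m%:R * L) t) pn.
Qed.

End periodicity.

(** * Evaluation of the integral along [u] *)

Section evaluation.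
Context {R : realType} (L : R) (G T P N : R -> 'rV[R]_3) (k tau : R -> R).
Hypothesis dbx : darboux L G T P N k tau.
Context (u : 'rV[R]_3) (hu : general_position L G u).
Implicit Types (a b s t r e del l : R).

Let L0 : 0 < L. Proof. by have [[]] := dbx. Qed.
Let fr t : frame (T t) (P t) (N t). Proof. by have [_ h _ _ _] := dbx. Qed.
Let sG : vsmooth G T. Proof. by have [_ _ [] ] := dbx. Qed.
Let sT : vsmooth T (fun t => k t *: P t). Proof. by have [_ _ [] ] := dbx. Qed.
Let sP : vsmooth P (fun t => - k t *: T t + tau t *: N t). Proof. by have [_ _ [] ] := dbx. Qed.
Let sN : vsmooth N (fun t => - tau t *: P t). Proof. by have [_ _ [] ] := dbx. Qed.
Let pG t : G (t + L) = G t. Proof. by have [_ _ _ h _] := dbx; have [] := h t. Qed.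
Let pT t : T (t + L) = T t. Proof. by have [_ _ _ h _] := dbx; have [] := h t. Qed.
Let pP t : P (t + L) = P t. Proof. by have [_ _ _ h _] := dbx; have [] := h t. Qed.
Let pN t : N (t + L) = N t. Proof. by have [_ _ _ h _] := dbx; have [] := h t. Qed.
Let uu : dot u u = 1. Proof. by have [] := hu. Qed.

Let derive_proj t : derive1 (Defs.proj u \o G) t = Defs.proj u (T t).
Proof. by apply: vderiv_derive1; apply: vderiv_proj; exact: sG.1. Qed.

(** Otherwise [u] would be parallel to the tangent line, and the projection would not be an
    immersion. *)
Lemma tangency_side t : dot u (N t) = 0 -> dot u (P t) != 0.
Proof.
move=> uN; apply/eqP => uP; have [_ h _ _] := hu.
have uE : u = dot u (T t) *: T t by rewrite {1}(frame_decomp u (fr t)) uN uP !scale0r !addr0.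
have := h t; rewrite derive_proj /Defs.proj; apply/negP/negPn/eqP.
have : dot u (T t) ^+ 2 = 1.
  by have := frame_norm u (fr t); rewrite uN uP uu expr0n !addr0.
rewrite (dotC (T t)) [X in _ - _ *: X]uE scalerA -expr2 => ->.
by rewrite scale1r subrr.
Qed.

(** If the two heights agreed, the strands would meet in space, hence be tangent by the contact
    property, against the transversality of double points. *)
Lemma double_point s t : 0 <= s < L -> 0 <= t < L -> s != t ->
  Defs.proj u (G s) = Defs.proj u (G t) ->
  dot (cross (T s) (T t)) u != 0 /\ dot (G s - G t) u != 0.
Proof.
move=> hs ht st pE; have [_ _ _ h] := hu.
have cp : crossing_points L (Defs.proj u \o G) (Defs.proj u (G s)) by exists s, t; split.
have [s' [t' [pre cr]]] := h _ cp.
have [p [q fpq]] := frame_exists uu.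
have crst : dot (cross (T s) (T t)) u != 0.
  move: cr; rewrite !derive_proj (cross_proj_neq0 fpq) => cr.
  have : [set s'; t'] s by rewrite -pre; split.
  have : [set s'; t'] t by rewrite -pre; split => //=.
  move=> [tE|tE] [sE|sE]; rewrite ?tE ?sE//.
  - by move: st; rewrite tE sE eqxx.
  - rewrite (_ : dot _ u = - dot (cross (T s') (T t')) u) ?oppr_eq0//.
    by rewrite -!(frame_cross fpq); ring.
  - by move: st; rewrite tE sE eqxx.
split=> //; apply: contra crst => /eqP z0.
have [_ _ _ _ [_ contact]] := dbx.
have Gst : G s = G t.
  apply/eqP; rewrite -subr_eq0; apply/eqP.
  transitivity (Defs.proj u (G s) - Defs.proj u (G t) + dot (G s - G t) u *: u).
    rewrite dotBl scalerBl /Defs.proj; move: (dot _ _ *: u) (dot _ _ *: u) => x y.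
    by apply: rv3P; rewrite !vecE; ring.
  by rewrite pE z0 scale0r subrr addr0.
by rewrite (contact _ _ Gst) dotC (_ : dot u 0 = 0) ?eqxx// dotC dot0l.
Qed.

(** Simplicity of the curve: a self-intersection would project to a double point with equal
    heights. *)
Lemma strand_injective s t : 0 <= s < L -> 0 <= t < L -> G s = G t -> s = t.
Proof.
move=> hs ht Gst; apply/eqP/negPn/negP => st.
have [|_] := double_point hs ht st _; first by rewrite Gst.
by rewrite Gst subrr dotC (_ : dot u 0 = 0) ?eqxx// dotC dot0l.
Qed.

(** One [e0] serves all angles [l], as the rotation of push-offs requires. Compactness gives it on
    the closed square, whose sides at [L] are reduced to 0 by periodicity, and periodicity extends
    it to the line. *)
Lemma tilted_disjoint : exists2 e0, 0 < e0 & forall e, 0 < e < e0 ->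
  forall l s t, G s != G t + e *: tilted P N l t.
Proof.
have loc a b : 0 <= a < L -> 0 <= b < L -> exists2 r, 0 < r & forall s t e,
    `|s - a| < r -> `|t - b| < r -> 0 < e < r -> forall l, G s != G t + e *: tilted P N l t.
  move=> ha hb; have [r r0 hr] := near_rightP (ribbon_disjoint dbx (strand_injective ha hb)).
  have r2 : 0 < r / 2 by rewrite divr_gt0.
  have rr : 0 < r / 2 < r by rewrite r2/= gtr_pMr// invf_lt1// ltr1n.
  exists (r / 2) => // s t e hs ht /andP[e0 er] l.
  by apply: (hr _ rr s t e l (ltW hs) (ltW ht)); rewrite e0 (ltW er).
have red a : 0 <= a <= L -> exists2 a', 0 <= a' < L & exists m : int, a' = a - m%:~R * L.
  move=> /andP[a0]; rewrite le_eqVlt => /predU1P[->|aL].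
    by exists 0; [rewrite lexx|exists 1; rewrite mul1r subrr].
  by exists a; [rewrite a0|exists 0; rewrite mul0r subr0].
have tiltp (m : int) l t : tilted P N l (t - m%:~R * L) = tilted P N l t.
  by rewrite /tilted !(periodic_int (L := L)).
have [|e0 e00 h] := @uniform_square R 0 L (fun e s t => forall l, G s != G t + e *: tilted P N l t).
  move=> a b /red[a' ha' [m aE]] /red[b' hb' [m' bE]].
  have [r r0 hr] := loc _ _ ha' hb'; exists r => // s t e hs ht he l.
  rewrite -(periodic_int pG m s) -(periodic_int pG m' t) -(tiltp m' l t).
  apply: hr => //.
    by rewrite (_ : _ - _ = s - a)// aE; ring.
  by rewrite (_ : _ - _ = t - b)// bE; ring.
exists e0 => // e he l s t.
have [m /andP[m0 mL]] := period_mod L0 s; have [m' /andP[m0' mL']] := period_mod L0 t.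
rewrite -(periodic_int pG m s) -(periodic_int pG m' t) -(tiltp m' l t).
by apply: h => //; rewrite ?m0 ?m0' ?ltW.
Qed.

Let Tg : set R := [set t | period L t /\ dot u (N t) = 0].

(** The zeros are simple: at a zero the derivative of [dot (N t) u] is [- tau * dot (P t) u],
    nonzero by [tangency_side]. *)
Lemma tangency_finite : finite_set Tg.
Proof.
have cK := @segment_compact R 0 L.
apply: (@sub_finite_set _ _ (`[0, L]%classic `&` [set t | dot u (N t) = 0])).
  by move=> t [/andP[t0 tL] uN]; split=> //; rewrite /= in_itv/= t0 ltW.
apply: finite_isolated => // a _.
have dN : is_derive a 1 (fun t => dot (N t) u) (dot (- tau a *: P a) u) := vderiv_dot u (sN.1 a).
have [uN|uN] := eqVneq (dot u (N a)) 0; last first.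
  have c0 : {for a, continuous (fun t => dot (N t) u)} := derive_continuous dN.
  have n0 : dot (N a) u != 0 by rewrite dotC.
  have h : \forall t \near a, dot (N t) u != 0 by exact: (@cvgr_neq0 R R _ (nbhs a) _ _ _ c0 n0).
  apply: filterS h => t /= h e.
  by rewrite dotC e eqxx in h.
have t0 : tau a != 0.
  by have [_ _ _ _ [h _]] := dbx; have := h a a; apply: contraTneq => ->; rewrite mulr0 ltxx.
pose m := dot (- tau a *: P a) u.
have m0 : m != 0 by rewrite /m dotZl mulf_neq0 ?oppr_eq0// dotC tangency_side.
have m2 : 0 < `|m| / 2 by rewrite divr_gt0 ?normr_gt0.
have h0 := derive_near dN m2; apply: filterS h0 => t /= h e.
have Nt : dot (N t) u = 0 by rewrite dotC.
have Na : dot (N a) u = 0 by rewrite dotC.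
move: h; rewrite Nt Na subrr sub0r normrN normrM.
apply: contraTeq => ta; rewrite -ltNge ltr_pM2r ?normr_gt0 ?subr_eq0//.
by rewrite gtr_pMr ?normr_gt0// invf_lt1// ltr1n.
Qed.

Let params : exists S : seq R, [/\ path <%R 0 (rcons S L),
  forall t, Tg t -> t \in 0 :: S &
  forall s t, 0 <= s < L -> 0 <= t < L -> s != t -> Defs.proj u (G s) = Defs.proj u (G t) ->
    s \in 0 :: S /\ t \in 0 :: S].
Proof.
pose Gu := Defs.proj u \o G.
pose A := \bigcup_(x in crossing_points L Gu) (period L `&` Gu @^-1` [set x]).
have [_ _ fcp hcp] := hu.
have fA : finite_set A.
  apply: bigcup_finite => // x /hcp[s [t [-> _]]]; exact: finite_set2.
have fU : finite_set (A `|` Tg) by rewrite finite_setU; split=> //; exact: tangency_finite.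
have [|S [hS1 hS2]] := @sorted_window R L (fset_set (A `|` Tg)) L0.
  move=> x; rewrite in_fset_set// inE => -[[y _ [h _]]|[h _]]; exact: h.
exists S; split=> //.
- by move=> t Tt; apply: hS2; rewrite in_fset_set// inE; right.
- move=> s t hs ht st pE.
  have cp : crossing_points L Gu (Gu s) by exists s, t; split.
  by split; apply: hS2; rewrite in_fset_set// inE; left; exists (Gu s).
Qed.

(** Contributions of the boxes: tangencies lie on the diagonal of the grid, and each crossing occurs
    off it, once for each order of its two parameters. *)
Let W a b : R := if a == b then (if dot u (N a) == 0 then Num.sg (tau a) * (2 * pi) else 0)
  else if Defs.proj u (G a) == Defs.proj u (G b) then
    Num.sg (dot (G a - G b) u) * Num.sg (dot (cross (T a) (T b)) u) * (2 * pi) else 0.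

Let box_W p q (fpq : frame p q u) a b : 0 <= a < L -> 0 <= b < L ->
  box_defect G T P N k tau p q u a b (W a b).
Proof.
move=> ha hb; rewrite /W; have [<-|ab] := eqVneq a b.
  have [uN|uN] := eqVneq (dot u (N a)) 0.
    exact: (box_tangent dbx fpq uN (tangency_side uN)).
  apply: (box_free dbx fpq); apply: filterS (diagonal_free dbx uu uN) => r h s t e hs ht /andP[e0 _].
  exact: h.
have [pE|pE] := eqVneq (Defs.proj u (G a)) (Defs.proj u (G b)).
  have [h1 h2] := double_point ha hb ab pE.
  exact: (box_crossing dbx fpq pE h2 h1).
by apply: (box_free dbx fpq); exact: (apart_free dbx pE uu).
Qed.

(** Once the boxes are fixed, a small enough push-off has no zeros outside them: every point of the
    window either is the centre of a box or has a neighbourhood free of zeros, and compactness gives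
    a common threshold. *)
Let window S del : 0 < del -> path (apart del) 0 (rcons S L) ->
  (forall t, Tg t -> t \in 0 :: S) ->
  (forall s t, 0 <= s < L -> 0 <= t < L -> s != t -> Defs.proj u (G s) = Defs.proj u (G t) ->
    s \in 0 :: S /\ t \in 0 :: S) ->
  exists2 e0, 0 < e0 & forall e s t, 0 < e < e0 ->
    - del <= s <= L - del -> - del <= t <= L - del ->
    Defs.proj u (G s) = Defs.proj u (ribbon G P e t) ->
    exists a b, [/\ a \in 0 :: S, b \in 0 :: S, `|s - a| < del & `|t - b| < del].
Proof.
move=> d0 hp hT hC.
have tr : transitive (apart del) by move=> x y z; rewrite /apart; lra.
have hpw : pairwise (apart del) (rcons (0 :: S) L) by rewrite -sorted_pairwise.
move: (hpw); rewrite pairwise_rcons => /andP[/allP SL _].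
have S0 : 0 < L - del by have := SL 0 (mem_head _ _); rewrite /apart; lra.
(* A negative [a] is represented by [a + L], within [del] of [L], where no parameter is listed; a
   listed representative is thus [a] itself. *)
have red a : - del <= a <= L - del -> exists2 m : int, 0 <= a - m%:~R * L < L &
    (a - m%:~R * L \in 0 :: S -> a - m%:~R * L = a).
  move=> /andP[a1 a2]; have [a0|a0] := leP 0 a.
    by exists 0; rewrite mul0r subr0// a0; lra.
  exists (-1); rewrite mulN1r opprK; first by apply/andP; split; lra.
  by move=> /SL; rewrite /apart; lra.
have free_uniform a b (m m' : int) : (\forall r \near 0^'+, forall s t e,
     `|s - (a - m%:~R * L)| <= r -> `|t - (b - m'%:~R * L)| <= r -> 0 < e <= r ->
     Defs.proj u (G s) != Defs.proj u (ribbon G P e t)) ->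
   exists2 r, 0 < r & forall s t e, `|s - a| < r -> `|t - b| < r -> 0 < e < r ->
     Defs.proj u (G s) <> Defs.proj u (ribbon G P e t).
  move=> /near_rightP[r r0 hr].
  have r2 : 0 < r / 2 by rewrite divr_gt0.
  have rr : 0 < r / 2 < r by rewrite r2/= gtr_pMr// invf_lt1// ltr1n.
  exists (r / 2) => // s t e hs ht /andP[e0 er]; apply/eqP.
  have rb : ribbon G P e t = ribbon G P e (t - m'%:~R * L).
    by rewrite /ribbon !(periodic_int (L := L)).
  rewrite rb -(periodic_int pG m s); apply: (hr _ rr); rewrite ?e0 ?(ltW er)//.
    by rewrite opprB addrA subrK ltW.
  by rewrite opprB addrA subrK ltW.
apply: uniform_square => a b ha hb.
have [m ha' ma] := red a ha; have [m' hb' mb] := red b hb.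
move: (free_uniform a b m m').
set a' := a - m%:~R * L in ha' ma *; set b' := b - m'%:~R * L in hb' mb * => fu.
have boxed : a' \in 0 :: S -> b' \in 0 :: S -> exists2 r, 0 < r & forall s t e,
     `|s - a| < r -> `|t - b| < r -> 0 < e < r ->
     Defs.proj u (G s) = Defs.proj u (ribbon G P e t) ->
     exists a b, [/\ a \in 0 :: S, b \in 0 :: S, `|s - a| < del & `|t - b| < del].
  move=> aS bS; exists del => // s t e hs ht _ _.
  by exists a, b; split=> //; [rewrite -(ma aS)|rewrite -(mb bS)].
have freed : (\forall r \near 0^'+, forall s t e,
     `|s - a'| <= r -> `|t - b'| <= r -> 0 < e <= r ->
     Defs.proj u (G s) != Defs.proj u (ribbon G P e t)) -> exists2 r, 0 < r & forall s t e,
     `|s - a| < r -> `|t - b| < r -> 0 < e < r ->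
     Defs.proj u (G s) = Defs.proj u (ribbon G P e t) ->
     exists a b, [/\ a \in 0 :: S, b \in 0 :: S, `|s - a| < del & `|t - b| < del].
  by move=> /fu[r r0 hr]; exists r => // s t e h1 h2 h3 pE; have := hr s t e h1 h2 h3 pE.
have [abE|ab] := eqVneq a' b'.
  have [uN|uN] := eqVneq (dot u (N a')) 0.
    have aS : a' \in 0 :: S by apply: hT; split.
    by apply: boxed => //; rewrite -abE.
  apply: freed; rewrite -abE; apply: filterS (diagonal_free dbx uu uN) =>
    r h s t e hs ht /andP[e0 _].
  exact: h.
have [pE|pE] := eqVneq (Defs.proj u (G a')) (Defs.proj u (G b')).
  by have [aS bS] := hC _ _ ha' hb' ab pE; exact: boxed.
by apply: freed; exact: (apart_free dbx pE uu).
Qed.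

Let total_W : exists S : seq R, [/\ path <%R 0 (rcons S L),
  forall t, Tg t -> t \in 0 :: S,
  forall s t, 0 <= s < L -> 0 <= t < L -> s != t -> Defs.proj u (G s) = Defs.proj u (G t) ->
    s \in 0 :: S /\ t \in 0 :: S &
  exists2 e0, 0 < e0 & forall e, 0 < e < e0 -> (forall s t, G s != ribbon G P e t) ->
    vtotal L G T (ribbon G P e) (ribbon' T N k tau e) =
    \sum_(a <- 0 :: S) \sum_(b <- 0 :: S) W a b].
Proof.
have [S [hp hT hC]] := params; exists S; split=> //.
have [p [q fpq]] := frame_exists uu.
have box : \forall del \near 0^'+, forall a, a \in 0 :: S -> forall b, b \in 0 :: S ->
    \forall e \near 0^'+, (forall s t, G s != ribbon G P e t) ->
    defect (curve_in p q u G T) (curve_in p q u (ribbon G P e) (ribbon' T N k tau e))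
      (a - del) (a + del) (b - del) (b + del) = W a b.
  apply: near_all => a aS; apply: near_all => b bS.
  exact: (box_W fpq (path_window hp aS) (path_window hp bS)).
have [del1 del10 hdel] := near_rightP (filterI box (path_apart_near hp)).
pose del := del1 / 2.
have del0 : 0 < del by rewrite divr_gt0.
have din : 0 < del < del1 by rewrite del0/= gtr_pMr// invf_lt1// ltr1n.
have [hbox hpath] := hdel del din.
have [e1 e10 he1] := window del0 hpath hT hC.
have [e2 e20 he2] : exists2 r, 0 < r & forall e, 0 < e < r ->
    forall a, a \in 0 :: S -> forall b, b \in 0 :: S -> (forall s t, G s != ribbon G P e t) ->
    defect (curve_in p q u G T) (curve_in p q u (ribbon G P e) (ribbon' T N k tau e))
      (a - del) (a + del) (b - del) (b + del) = W a b.
  apply: near_rightP; apply: near_all => a aS; apply: near_all => b bS.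
  exact: hbox.
exists (Num.min e1 e2); first by rewrite lt_min e10.
move=> e /andP[e0]; rewrite lt_min => /andP[ee1 ee2] dj.
have sR := ribbon_smooth dbx e.
have pR : vperiodic L (ribbon G P e) (ribbon' T N k tau e).
  by apply: vperiodic_derive => // t; rewrite /ribbon pG pP.
have pGT : vperiodic L G T by move=> t; rewrite pG pT.
rewrite -(total_angle_in fpq).
apply: (degree_formula (smooth_curve_in p q u sG) (smooth_curve_in p q u sR)
  (periodic_curve_in p q u pGT) (periodic_curve_in p q u pR) L0 (rho_in_gt0 fpq _ _ dj) del0 hpath).
- move=> s t hs ht /eqP; rewrite (planar_in fpq) => /eqP pE.
  by apply: (he1 e s t) => //; rewrite e0.
- by move=> a b aS bS; apply: he2 => //; rewrite e0.
Qed.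

Lemma card_filter (S : seq R) (Z : set R) : uniq S -> (forall t, Z t -> t \in S) ->
  finite_set Z -> #|` fset_set Z|%fset = size [seq t <- S | `[< Z t >]].
Proof.
move=> uS ZS fZ; apply: perm_size; apply: uniq_perm; rewrite ?fset_uniq ?filter_uniq// => t.
apply/idP/idP; last by rewrite mem_filter in_fset_set// inE => /andP[/asboolP].
by rewrite in_fset_set// inE mem_filter => Zt; apply/andP; split; [exact/asboolP|exact: ZS].
Qed.

(** Off the diagonal, [W a b] is the sum of the terms of [Cr] at [(a, b)] and [(b, a)], so the
    double sum gives [Cr] twice; the diagonal gives the tangencies, all with the same sign because
    the torsion keeps its sign. *)
Lemma ribbon_total : exists2 e0, 0 < e0 & forall e, 0 < e < e0 ->
  (forall s t, G s != ribbon G P e t) -> forall t0,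
  vtotal L G T (ribbon G P e) (ribbon' T N k tau e) =
  (2 * Cr L G u + #|` fset_set Tg|%fset%:R * Num.sg (tau t0)) * (2 * pi).
Proof.
have [S [hp hT hC [e0 e00 he]]] := total_W.
exists e0 => // e ee dj t0; have E := he e ee dj; rewrite {}E.
have [p [q fpq]] := frame_exists uu.
have uS : uniq (0 :: S).
  have : sorted <%R (0 :: S) by move: hp; rewrite rcons_path => /andP[].
  exact: sorted_uniq lt_trans ltxx _.
have zdiff s t : 0 <= s < L -> 0 <= t < L -> overcrossings L u G G (s, t) -> s != t.
  by move=> _ _ [_ _ _ /=]; apply: contraTneq => ->; rewrite ltxx.
have H st : overcrossings L u G G st -> st.1 \in 0 :: S /\ st.2 \in 0 :: S.
  case: st => s t h; have [hs ht pE _] := h.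
  by apply: hC => //; exact: zdiff h.
pose h a b : R := if `[< overcrossings L u G G (a, b) >] then crossing_sign u G G (a, b) else 0.
have O : Cr L G u = \sum_(a <- 0 :: S) \sum_(b <- 0 :: S) h a b :=
  fsum_pairs (crossing_sign u G G) uS H.
have O' : Cr L G u = \sum_(a <- 0 :: S) \sum_(b <- 0 :: S) h b a.
  by apply: etrans O _; exact: exchange_big.
have sgt a : Num.sg (tau a) = Num.sg (tau t0).
  have [_ _ _ _ [tt _]] := dbx; have e1 : Num.sg (tau a) * Num.sg (tau t0) = 1.
    by rewrite -sgrM gtr0_sg.
  have t00 : tau t0 != 0 by have := tt t0 t0; apply: contraTneq => ->; rewrite mulr0 ltxx.
  have e2 : Num.sg (tau t0) * Num.sg (tau t0) = 1 by rewrite -expr2 sqr_sg t00.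
  by rewrite -[LHS]mulr1 -{1}e2 mulrA e1 mul1r.
have T1 : #|` fset_set Tg|%fset%:R * Num.sg (tau t0) =
    \sum_(a <- 0 :: S) (if `[< Tg a >] then Num.sg (tau t0) else 0).
  rewrite (card_filter uS hT tangency_finite) -big_mkcond/= -big_filter big_const_seq count_predT.
  by rewrite iter_addr_0 mulr_natl.
transitivity ((\sum_(a <- 0 :: S) \sum_(b <- 0 :: S) h a b + \sum_(a <- 0 :: S) \sum_(b <- 0 :: S) h b a +
  \sum_(a <- 0 :: S) (if `[< Tg a >] then Num.sg (tau t0) else 0)) * (2 * pi)); last first.
  have aux (x y z c m w : R) : c = x -> c = y -> m = z -> (x + y + z) * w = (2 * c + m) * w.
    by move=> <- <- <-; ring.
  exact (aux _ _ _ _ _ _ O O' T1).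
rewrite -!big_split/= mulr_suml.
apply: eq_big_seq => a aS.
have ha := path_window hp aS.
(* The tangency term becomes the diagonal term of a sum over [b], for a comparison box by box. *)
have -> : (if `[< Tg a >] then Num.sg (tau t0) else 0) =
    \sum_(b <- 0 :: S) (if (b == a) && `[< Tg a >] then Num.sg (tau t0) else 0).
  rewrite (bigD1_seq a)//= eqxx/= big1 ?addr0// => b /negbTE -> //.
rewrite -!big_split/= mulr_suml; apply: eq_big_seq => b bS; rewrite /h.
have hb := path_window hp bS.
have zE x y : dot (G x - G y) u = dot (G x) u - dot (G y) u by rewrite dotBl.
rewrite /W eq_sym; have [ba|ba] := eqVneq b a.
  have no : `[< overcrossings L u G G (a, a) >] = false.
    by apply: asboolF => o; have := zdiff _ _ ha ha o; rewrite eqxx.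
  have tE : `[< Tg a >] = (dot u (N a) == 0).
    by apply/asboolP/eqP => [[]//|]; split.
  rewrite ba !no tE /= !add0r.
  by rewrite sgt; case: eqP; rewrite ?mul0r.
have E1 : `[< overcrossings L u G G (a, b) >] =
    (Defs.proj u (G a) == Defs.proj u (G b)) && (0 < dot (G a - G b) u).
  by rewrite zE subr_gt0; apply/asboolP/andP => [[_ _ /= -> ->]|[/eqP e1 e2]]; rewrite ?eqxx.
have E2 : `[< overcrossings L u G G (b, a) >] =
    (Defs.proj u (G a) == Defs.proj u (G b)) && (dot (G a - G b) u < 0).
  by rewrite zE subr_lt0; apply/asboolP/andP => [[_ _ /= -> ->]|[/eqP e1 e2]]; rewrite ?eqxx.
have C1 : crossing_sign u G G (a, b) = Num.sg (dot (cross (T a) (T b)) u).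
  by rewrite /crossing_sign/= !derive_proj (cross_proj_dot fpq).
have C2 : crossing_sign u G G (b, a) = - Num.sg (dot (cross (T a) (T b)) u).
  rewrite /crossing_sign/= !derive_proj (cross_proj_dot fpq) -sgrN; congr (Num.sg _).
  by rewrite -!(frame_cross fpq); ring.
rewrite E1 E2 C1 C2 /= addr0; case: eqP => [pE|_]; last by rewrite !addr0 mul0r.
have ab : a != b by rewrite eq_sym.
have [_ z0] := double_point ha hb ab pE.
by rewrite sg_neq0_if.
Qed.

End evaluation.

(** * From the tangential to the normal push-off *)

Section linking.
Context {R : realType} (L : R) (G T P N : R -> 'rV[R]_3) (k tau : R -> R).
Hypothesis dbx : darboux L G T P N k tau.
Implicit Types (s t e l : R).

Let sG : vsmooth G T. Proof. by have [_ _ [] ] := dbx. Qed.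
Let sP : vsmooth P (fun t => - k t *: T t + tau t *: N t). Proof. by have [_ _ [] ] := dbx. Qed.
Let sN : vsmooth N (fun t => - tau t *: P t). Proof. by have [_ _ [] ] := dbx. Qed.
Let L0 : 0 < L. Proof. by have [[]] := dbx. Qed.

Let D e l t := (G t + (e * cos l) *: N t) + (e * sin l) *: P t.
Let W e l t := (T t + (e * cos l) *: (- tau t *: P t))
  + (e * sin l) *: (- k t *: T t + tau t *: N t).

Lemma tiltedE e l t : G t + e *: tilted P N l t = D e l t.
Proof. by rewrite /tilted scalerDr !scalerA addrA. Qed.

(** Homotopy invariance between the angles 0 and [pi / 2]; disjointness from the curve is asked for
    every angle, as the homotopy is parametrized by the whole line. *)
Lemma push_off_total e : (forall l s t, G s != G t + e *: tilted P N l t) ->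
  vtotal L G T (fun t => G t + e *: N t) (fun t => T t + e *: (- tau t *: P t)) =
  vtotal L G T (ribbon G P e) (ribbon' T N k tau e).
Proof.
move=> dj.
have pD l t : D e l (t + L) = D e l t.
  by rewrite /D; have [_ _ _ h _] := dbx; have [-> _ -> ->] := h t.
have sD l : vsmooth (D e l) (W e l) by apply: vsmooth_add => //; exact: vsmooth_add.
have pG : vperiodic L G T.
  by move=> t; have [_ _ _ h _] := dbx; have [-> -> _ _] := h t.
have cu (f : R -> R) : continuous f -> continuous (fun v : R * R => f v.2).
  by move=> cf v; apply: cont_comp_snd; exact: cf.
have cl (f : R -> R) : continuous f -> continuous (fun v : R * R => e * f v.1).
  move=> cf v; apply: (@contM _ _ (fun=> e) (fun v : R * R => f v.1) v); first exact: contC.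
  by apply: cont_comp_fst; exact: cf.
have ccos := cl _ (@continuous_cos R); have csin := cl _ (@continuous_sin R).
have dcont (H V : R -> 'rV[R]_3) i : vsmooth H V -> continuous (fun t => H t 0 i).
  by move=> sH t; exact: derive_continuous (sH.1 t i).
have comb (H1 H2 H3 : R -> 'rV[R]_3) : (forall i, continuous (fun t => H1 t 0 i)) ->
    (forall i, continuous (fun t => H2 t 0 i)) -> (forall i, continuous (fun t => H3 t 0 i)) ->
    forall i, continuous (fun v : R * R =>
      ((H1 v.2 + (e * cos v.1) *: H2 v.2) + (e * sin v.1) *: H3 v.2) 0 i).
  move=> c1 c2 c3 i v.
  rewrite (_ : (fun v : R * R => _) = (fun v : R * R =>
    H1 v.2 0 i + e * cos v.1 * H2 v.2 0 i + e * sin v.1 * H3 v.2 0 i)); last first.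
    by apply/funext => v'; rewrite !mxE.
  exact (contA (contA (cu _ (c1 i) v) (contM (ccos v) (cu _ (c2 i) v)))
    (contM (csin v) (cu _ (c3 i) v))).
have cD i : continuous (fun v : R * R => D e v.1 v.2 0 i).
  by apply: comb => {}i; [exact: dcont sG|exact: dcont sN|exact: dcont sP].
have cW i : continuous (fun v : R * R => W e v.1 v.2 0 i).
  exact: (comb T (fun t => - tau t *: P t) (fun t => - k t *: T t + tau t *: N t) sG.2 sN.2 sP.2).
have GD l s t : G s != D e l t by rewrite -tiltedE.
have E := vtotal_homotopy L0 sG pG sD (fun l => vperiodic_derive (sD l) (pD l)) cD cW GD 0 (pi / 2).
move: E; rewrite (_ : D e 0 = (fun t => G t + e *: N t)); last first.
  by apply/funext => t; rewrite /D cos0 sin0 mulr1 mulr0 scale0r addr0.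
rewrite (_ : W e 0 = (fun t => T t + e *: (- tau t *: P t))); last first.
  by apply/funext => t; rewrite /W cos0 sin0 mulr1 mulr0 scale0r addr0.
rewrite (_ : D e (pi / 2) = ribbon G P e); last first.
  by apply/funext => t; rewrite /D cos_pihalf sin_pihalf mulr1 mulr0 scale0r addr0.
rewrite (_ : W e (pi / 2) = ribbon' T N k tau e) //.
by apply/funext => t; rewrite /W cos_pihalf sin_pihalf mulr1 mulr0 scale0r addr0.
Qed.

(** Along any generic [w] the crossing sums times [2 * pi] equal the integral, which was evaluated
    along [u]; cancelling [2 * pi] and halving gives a value that does not involve [w]. *)
Lemma push_off_linking u t0 : general_position L G u ->
  Lk_is L G N (Cr L G u + 2^-1 * #|` fset_set [set t | period L t /\ dot u (N t) = 0]|%fset%:R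
                            * Num.sg (tau t0)).
Proof.
move=> hu; have [e1 e10 h1] := tilted_disjoint dbx hu.
have [e2 e20 h2] := ribbon_total dbx hu.
exists (Num.min e1 e2); first by rewrite lt_min e10.
move=> e /andP[e0]; rewrite lt_min => /andP[ee1 ee2].
have dj : forall l s t, G s != G t + e *: tilted P N l t by apply: h1; rewrite e0.
have djN s t : G s != G t + e *: N t.
  by have := dj 0 s t; rewrite /tilted cos0 sin0 scale1r scale0r addr0.
have djP s t : G s != ribbon G P e t.
  by have := dj (pi / 2) s t; rewrite /tilted cos_pihalf sin_pihalf scale1r scale0r add0r.
have sD : vsmooth (fun t => G t + e *: N t) (fun t => T t + e *: (- tau t *: P t)).
  exact: vsmooth_add.
have pG : vperiodic L G T.
  by move=> t; have [_ _ _ h _] := dbx; have [-> -> _ _] := h t.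
have pD : vperiodic L (fun t => G t + e *: N t) (fun t => T t + e *: (- tau t *: P t)).
  apply: vperiodic_derive => // t.
  by have [_ _ _ h _] := dbx; have [-> _ _ ->] := h t.
split; [exact: djN|exact: generic_direction_exists sG sD djN|].
move=> w gw; have := crossing_total L0 sG sD pG pD djN gw.
rewrite (push_off_total dj) (h2 e _ djP t0) ?e0// => /mulIf E.
rewrite -{}E; last by rewrite mulf_neq0// gt_eqF ?pi_gt0.
rewrite mulrDr mulrA mulVf// mul1r mulrA //.
Qed.

End linking.

Local Open Scope fset_scope.
Local Open Scope ring_scope.

Theorem theorem1p1 (R : realType) (M : set 'rV[R]_3)
    (n : 'rV[R]_3 -> 'rV[R]_3) (L : R) (G : R -> 'rV[R]_3) (u : 'rV[R]_3)
    (hM : embedded_C3_surface M) (hn : gauss_map M n)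
    (hK : negatively_curved M n) (hG : closed_asymptotic_curve M n L G)
    (hu : general_position L G u) :
  finite_set (tangency_set L n G u) /\
  forall t0 : R,
    Lk_is L G (n \o G)
      (Cr L G u + 2^-1 * #|` fset_set (tangency_set L n G u)|%:R
                       * Num.sg (geodesic_torsion n G t0)).
Proof.
have [P [T [N [k [tau [dbx NE _ tauE]]]]]] := asymptotic_darboux hM hn hK hG.
have TgE : tangency_set L n G u = [set t | period L t /\ dot u (N t) = 0] by rewrite NE.
split; first by rewrite TgE; exact (tangency_finite dbx hu).
by move=> t0; rewrite -tauE TgE -NE; exact (push_off_linking dbx t0 hu).
Qed.
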